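(* Let $\Lambda^h_{\mathsf{a}}$ be the discrete Dirichlet-to-Neumann (DtN) matrix, divided according to its $\mathcal{H}$-matrix decomposition into $N$ blocks, each of size $n\times n$. For $i=1,\dots,N$ suppose that the $i$-th block has rank $r_i$ and obeys the decoherent condition with constant $\mu_{0,i}>0$ and the delocalization condition with constant $\mu_{1,i}>0$. Let $m_i$ be the number of observed entries of the $i$-th block, with the locations of the observed entries sampled uniformly at random. Let $\tilde{\Lambda}^h_{\mathsf{a}}$ be the matrix reconstructed block by block by nuclear norm minimization from the observed entries. Then there exist constants $C$, $c$ such that if $$m_i \;\ge\; C\max\{\mu_{1,i}^2,\ \sqrt{\mu_{0,i}}\,\mu_{1,i},\ \mu_{0,i}\,n^{1/4}\}\,\beta_i\, r_i\,(n\log n),\qquad i=1,\dots,N,$$ for some $\beta_i>2$, then $$\mathbb{P}\big(\Lambda^h_{\mathsf{a}}=\tilde{\Lambda}^h_{\mathsf{a}}\big)\;\ge\;1-c\sum_{i=1}^N n^{-\beta_i}.$$ Moreover, the sampling sizes can be improved to $m_i\ge C\,\mu_{0,i}\,\beta_i\, r_i\,(n^{6/5}\log n)$ if $r_i\le n^{1/5}/\mu_{0,i}$.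
   Context: **DtN matrix.** Let $\mathcal{D}$ be a polygonal domain with a shape-regular affine mesh of mesh size $h$, and let $a$ be a piecewise constant conductivity on $\mathcal{D}$, with vector of values $\mathsf{a}$. Let $V^h\subset H^1(\mathcal{D})$ be the continuous piecewise linear (Lagrange) finite element space, let $V^h(\partial\mathcal{D})$ be the corresponding space of continuous piecewise linear functions on $\partial\mathcal{D}$ with nodal basis $\{\phi_i\}$, and let $V^h_0=\{v\in V^h: v|_{\partial\mathcal{D}}=0\}$. For $\phi^h\in V^h(\partial\mathcal{D})$ let $\Phi^h\in V^h$ be the finite element solution: $\Phi^h|_{\partial\mathcal{D}}=\phi^h$ and $\int_{\mathcal{D}} a\nabla\Phi^h\cdot\nabla v^h\,dx=0$ for all $v^h\in V^h_0$. The discrete DtN map is the bilinear form $\langle\Lambda^h_{\mathsf{a}}\phi^h,w^h\rangle=\int_{\mathcal{D}}a\nabla\Phi^h\cdot\nabla W^h\,dx$, where $W^h\in V^h$ is any extension of $w^h\in V^h(\partial\mathcal{D})$. The DtN matrix, also denoted $\Lambda^h_{\mathsf{a}}$, is its matrix representation. **Block decomposition.** The $\mathcal{H}$-matrix decomposition is a partition of the DtN matrix into sub-blocks (in this statement $N$ blocks, all of size $n\times n$). **Reconstruction.** For a block $\mathsf{B}\in\mathbb{R}^{n\times n}$ with observed index set $\Omega$, $|\Omega|=m$, the reconstructed block is the solution of $$\min_{\mathsf{A}\in\mathbb{R}^{n\times n}}\|\mathsf{A}\|_*\quad\text{subject to}\quad \mathsf{A}_{ij}=\mathsf{B}_{ij},\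 (i,j)\in\Omega,$$ where $\|\cdot\|_*$ is the nuclear norm (sum of singular values). $\tilde{\Lambda}^h_{\mathsf{a}}$ is the matrix assembled from the reconstructed blocks. **Decoherent and delocalization conditions.** For an $r$-dimensional subspace $\mathsf{W}\subset\mathbb{R}^n$ with orthogonal projection $\mathcal{P}_{\mathsf{W}}$, the coherence index is $\mu(\mathsf{W})=\frac{n}{r}\max_{1\le i\le n}\|\mathcal{P}_{\mathsf{W}}e_i\|_2^2$, with $e_i$ the $i$-th unit vector. Let $\mathsf{A}=\mathsf{U}\Sigma\mathsf{V}^\top$ be the (rank-$r$) singular value decomposition of an $n\times n$ matrix of rank $r$, with left and right singular vectors $u_k,v_k$, $1\le k\le r$, spanning subspaces $U$ and $V$. - $\mathsf{A}$ satisfies the decoherent condition with constant $\mu_0$ if $\max(\mu(U),\mu(V))\le\mu_0$. - $\mathsf{A}$ satisfies the delocalization condition with constant $\mu_1$ if the maximum absolute value of the entries of $\sum_{1\le k\le r}u_kv_k^\top$ is at most $\mu_1\sqrt{r/n^2}$. *)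

(* Defs.v *)
From HB Require Import structures.
From mathcomp Require Import all_boot all_order all_algebra.
From mathcomp Require Import all_classical all_reals all_analysis.

Set Implicit Arguments.
Unset Strict Implicit.
Unset Printing Implicit Defensive.

Import Order.TTheory GRing.Theory Num.Theory.
Import numFieldNormedType.Exports.

Local Open Scope classical_set_scope.
Local Open Scope ring_scope.

(** The library norm on [R * R] is the max norm; it has the right topology, but
    diameters and balls below are Euclidean. *)
Definition edist (R : realType) (x y : R * R) : R :=
  Num.sqrt ((x.1 - y.1) ^+ 2 + (x.2 - y.2) ^+ 2).

Definition diam (R : realType) (A : set (R * R)) : R :=
  sup [set t | exists x y, [/\ A x, A y & t = edist x y]].

Definition segment (R : realType) (x y : R * R) : set (R * R) :=
  [set z | exists2 t : R, 0 <= t <= 1 & z = (1 - t) *: x + t *: y].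

Definition boundary (R : realType) (D : set (R * R)) : set (R * R) :=
  closure D `\` interior D.

(** The equation [interior (closure D) = D] excludes slits. *)
Definition polygonal_domain (R : realType) (D : set (R * R)) : Prop :=
  [/\ open D, connected D, D !=set0, bounded_set D & interior (closure D) = D]
  /\ exists s : seq ((R * R) * (R * R)),
       boundary D = \bigcup_(e in [set` s]) segment e.1 e.2.

Record mesh (R : realType) := Mesh {
  nnodes : nat;
  node : 'I_nnodes -> R * R;
  elements : {set {set 'I_nnodes}} }.

Definition conv (R : realType) (K : mesh R) (S : {set 'I_(nnodes K)}) :
    set (R * R) :=
  [set x | exists l : 'I_(nnodes K) -> R,
     [/\ forall i, 0 <= l i, forall i, i \notin S -> l i = 0,
         \sum_i l i = 1 & x = \sum_i l i *: node i]].

(** Conforming triangulation of [D] into nondegenerate triangles. *)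
Definition mesh_of (R : realType) (D : set (R * R)) (K : mesh R) : Prop :=
  [/\ forall S, S \in elements K -> #|S| = 3%N /\ interior (conv S) !=set0,
      forall S S', S \in elements K -> S' \in elements K ->
        conv S `&` conv S' = conv (S :&: S'),
      forall i : 'I_(nnodes K), exists2 S, S \in elements K & i \in S
    & closure D = \bigcup_(S in [set S | S \in elements K]) conv S].

Definition mesh_size (R : realType) (K : mesh R) : R :=
  \big[Num.max/0]_(S in elements K) diam (conv S).

(** Every element contains a disc whose diameter [2 * rho] satisfies
    [diam <= sigma * (2 * rho)]. *)
Definition shape_regular (R : realType) (K : mesh R) (sigma : R) : Prop :=
  forall S, S \in elements K -> exists (c : R * R) (rho : R),
    [/\ 0 < rho, [set x | edist x c <= rho] `<=` conv S
      & diam (conv S) <= sigma * (2 * rho)].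

(** Elements of the finite element spaces below are represented by functions on the whole plane, of
    which only the values on [closure D], resp. [boundary D], matter. *)

Definition affine_on (R : realType) (A : set (R * R)) (u : R * R -> R) : Prop :=
  exists (g : R * R) (c : R),
    forall x, A x -> u x = g.1 * x.1 + g.2 * x.2 + c.

Definition Vh (R : realType) (D : set (R * R)) (K : mesh R) :
    set (R * R -> R) :=
  [set u | {within closure D, continuous u} /\
     forall S, S \in elements K -> affine_on (conv S) u].

Definition Vh0 (R : realType) (D : set (R * R)) (K : mesh R) :
    set (R * R -> R) :=
  [set u | Vh D K u /\ forall x, boundary D x -> u x = 0].

Definition Vh_boundary (R : realType) (D : set (R * R)) (K : mesh R) :
    set (R * R -> R) :=
  [set phi | {within boundary D, continuous phi} /\
     forall S i j, S \in elements K -> i \in S -> j \in S ->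
       segment (node i) (node j) `<=` boundary D ->
       affine_on (segment (node i) (node j)) phi].

Definition boundary_nodes (R : realType) (D : set (R * R)) (K : mesh R) :
    {set 'I_(nnodes K)} :=
  [set i : 'I_(nnodes K) | `[< boundary D (node i) >]]%SET.

Notation dof D K := #|boundary_nodes D K|.

Definition bnode (R : realType) (D : set (R * R)) (K : mesh R)
    (i : 'I_(dof D K)) : R * R :=
  node (enum_val i).

(** [xget] picks the unique (up to its values off [boundary D]) function of
    [Vh_boundary D K] with the Kronecker property. *)
Definition nodal_basis (R : realType) (D : set (R * R)) (K : mesh R)
    (i : 'I_(dof D K)) : R * R -> R :=
  xget (fun _ => 0) [set phi | Vh_boundary D K phi /\
    forall j, phi (bnode j) = (i == j)%:R].

Definition lebesgue2 (R : realType) :=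
  (@lebesgue_measure R \x @lebesgue_measure R)%E.

(** [val 0 k] is the value on the piece [piece k]. *)
Definition piecewise_constant (R : realType) (p : nat)
    (piece : 'I_p -> set (R * R)) (val : 'rV[R]_p) : R * R -> R :=
  fun x => \sum_(k < p) val 0 k * \1_(piece k) x.

Definition grad (R : realType) (u : R * R -> R) (x : R * R) : R * R :=
  ('D_((1, 0) : R * R) (u : R * R -> R^o) x,
   'D_((0, 1) : R * R) (u : R * R -> R^o) x).

(** For [u] and [v] in [Vh D K] the gradients exist off the mesh edges, which
    form a null set. *)
Definition energy (R : realType) (D : set (R * R)) (a u v : R * R -> R) : R :=
  \int[@lebesgue2 R]_(x in D)
    (a x * ((grad u x).1 * (grad v x).1 + (grad u x).2 * (grad v x).2)).

Definition extends (R : realType) (D : set (R * R)) (K : mesh R)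
    (w W : R * R -> R) : Prop :=
  Vh D K W /\ forall x, boundary D x -> W x = w x.

Definition fe_solution (R : realType) (D : set (R * R)) (K : mesh R)
    (a phi Phi : R * R -> R) : Prop :=
  extends D K phi Phi /\ forall v, Vh0 D K v -> energy D a Phi v = 0.

(** The value depends neither on the choice of the extension of [w], since [Phi]
    is orthogonal to [Vh0], nor on that of [Phi], which is unique on
    [closure D] when the conductivity is positive. *)
Definition dtn_form (R : realType) (D : set (R * R)) (K : mesh R)
    (a phi w : R * R -> R) : R :=
  let Phi := xget (fun _ => 0) [set Phi | fe_solution D K a phi Phi] in
  let W := xget (fun _ => 0) [set W | extends D K w W] in
  energy D a Phi W.

Definition dtn_matrix (R : realType) (D : set (R * R)) (K : mesh R)
    (a : R * R -> R) : 'M[R]_(dof D K) :=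
  \matrix_(i, j) dtn_form D K a (nodal_basis j) (nodal_basis i).

(** Compact form: the existence of such a decomposition forces [r] to be the
    rank of [A]. *)
Definition is_svd (R : realType) (n r : nat) (A : 'M[R]_n)
    (X : 'M[R]_(n, r) * 'rV[R]_r * 'M[R]_(n, r)) : Prop :=
  let: (U, s, V) := X in
  [/\ U^T *m U = 1%:M, V^T *m V = 1%:M, forall k, 0 < s 0 k
    & A = U *m diag_mx s *m V^T].

(** None of the notions below depends on which decomposition is picked: the
    singular values are unique up to order, and the spans of the singular vectors
    and the matrix [U V^T] are determined by [A]. *)
Definition svd (R : realType) (n : nat) (A : 'M[R]_n) :
    'M[R]_(n, \rank A) * 'rV[R]_(\rank A) * 'M[R]_(n, \rank A) :=
  xget (0, 0, 0) [set X | is_svd A X].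

Definition left_singular_vectors (R : realType) (n : nat) (A : 'M[R]_n) :=
  (svd A).1.1.
Definition singular_values (R : realType) (n : nat) (A : 'M[R]_n) :=
  (svd A).1.2.
Definition right_singular_vectors (R : realType) (n : nat) (A : 'M[R]_n) :=
  (svd A).2.

Definition nuclear_norm (R : realType) (n : nat) (A : 'M[R]_n) : R :=
  \sum_k singular_values A 0 k.

(** Subspaces of [R^n] are represented as row spaces. *)
Definition orth_proj (R : realType) (n k : nat) (W : 'M[R]_(k, n)) : 'M[R]_n :=
  xget 0 [set P : 'M[R]_n | [/\ P^T = P, P *m P = P & (P == W)%MS]].

Definition coherence (R : realType) (n k : nat) (W : 'M[R]_(k, n)) : R :=
  n%:R / (\rank W)%:R *
  \big[Num.max/0]_(i < n)
    \sum_(j < n) ((orth_proj W *m (delta_mx i 0 : 'cV[R]_n)) j 0) ^+ 2.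

Definition decoherent (R : realType) (n : nat) (A : 'M[R]_n) (mu0 : R) : Prop :=
  Num.max (coherence (left_singular_vectors A)^T)
          (coherence (right_singular_vectors A)^T) <= mu0.

Definition delocalized (R : realType) (n : nat) (A : 'M[R]_n) (mu1 : R) : Prop :=
  let E := \sum_k col k (left_singular_vectors A) *m
                  (col k (right_singular_vectors A))^T in
  forall i j, `|E i j| <= mu1 * Num.sqrt ((\rank A)%:R / n%:R ^+ 2).

Definition agree_on (R : realType) (n : nat) (Omega : {set 'I_n * 'I_n})
    (A B : 'M[R]_n) : Prop :=
  forall p, p \in Omega -> A p.1 p.2 = B p.1 p.2.

Definition nuclear_minimizer (R : realType) (n : nat)
    (Omega : {set 'I_n * 'I_n}) (B A : 'M[R]_n) : Prop :=
  agree_on Omega A B /\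
  forall A' : 'M[R]_n, agree_on Omega A' B -> nuclear_norm A <= nuclear_norm A'.

(** Block [b] has the row indices [rows b] and the column indices [cols b], which
    need not be contiguous; each entry of the matrix lies in exactly one block. *)
Definition block_partition (M N n : nat) (rows cols : 'I_N -> 'I_n -> 'I_M) :
    Prop :=
  bijective (fun x : 'I_N * ('I_n * 'I_n) =>
               (rows x.1 x.2.1, cols x.1 x.2.2)).

Definition block (R : realType) (M N n : nat) (rows cols : 'I_N -> 'I_n -> 'I_M)
    (L : 'M[R]_M) (b : 'I_N) : 'M[R]_n :=
  mxsub (rows b) (cols b) L.

(** [Lt] maps each family of observed index sets to a matrix assembled from
    solutions of the nuclear norm minimization problems of the blocks of [L]. *)
Definition reconstruction (R : realType) (M N n : nat)
    (rows cols : 'I_N -> 'I_n -> 'I_M) (L : 'M[R]_M)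
    (Lt : {ffun 'I_N -> {set 'I_n * 'I_n}} -> 'M[R]_M) : Prop :=
  forall (Omega : {ffun 'I_N -> {set 'I_n * 'I_n}}) (b : 'I_N),
    nuclear_minimizer (Omega b) (block rows cols L b)
                      (block rows cols (Lt Omega) b).

(** [Omega] is uniformly distributed among the sets of [m] positions. *)
Definition uniform_sample (R : realType) (d : measure_display)
    (T : measurableType d) (P : probability T R) (n m : nat)
    (Omega : T -> {set 'I_n * 'I_n}) : Prop :=
  forall S : {set 'I_n * 'I_n},
    measurable [set w | Omega w = S] /\
    P [set w | Omega w = S] =
      (if #|S| == m then ('C(n * n, m)%:R)^-1 else 0)%:E.

(* Main.v *)
Require Import Defs.
From mathcomp Require Import all_boot all_order all_algebra all_fingroup.
From mathcomp Require Import all_classical all_reals all_analysis.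
From mathcomp Require Import ring lra zify complex.

(** Each block is recovered by the golfing scheme, and the blocks are combined by
    a union bound.  Let [T] be the tangent space at the block [A = U S V^T] to the
    matrices of its rank.  Then [A] is the unique minimizer as soon as the
    tangential part of a matrix vanishing on the sample is bounded by [n^O(1)] times
    its normal part, and some [Y] supported on the sample has [P_T Y] close to
    [U V^T] and normal part of operator norm at most 1/2.  Split the sample into 60
    batches with rescaled sampling operators [R_l], put [Z_0 = U V^T],
    [Z_(l+1) = Z_l - P_T R_l Z_l] and [Y = sum_l R_l Z_l].  The hypotheses leave a
    factor [n^(1/5)] to spare, so by Bernstein's inequality each batch contracts the
    largest entry of [Z_l] by [n^(-1/10) / 2], and boundedly many batches reach
    polynomial accuracy.  The operator norm of [(R_l - 1) Z_l] is controlled by a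
    matrix Chernoff bound that only needs the largest entry of [Z_l]; this is where
    delocalization, or the small rank, is used.  The same scheme started from
    [P_T (e_i e_j^T)] for all [i], [j] gives the first condition.  Finally, failure is
    monotone in the sample, so a uniform [m]-subset is no worse than [m] draws with
    replacement. *)

Set Implicit Arguments.
Unset Strict Implicit.
Unset Printing Implicit Defensive.

Import Order.TTheory GRing.Theory Num.Theory.
Local Open Scope ring_scope.

(** * The real spectral theorem *)

Section SpectralTheorem.
Variable R : rcfType.

(** Both sample-size regimes feed one block theorem with two requirements. Contracting the largest
    entry costs, through Bernstein, [mu0 r n^(6/5) log n] draws. Bounding the normal part of the
    certificate costs [n^3 kap^2 log n], where [kap] bounds the entries of [U V^T]. Delocalization
    gives [kap = mu1 sqrt r / n], hence [n mu1^2 r]; incoherence alone gives [kap = mu0 r / n],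
    hence [n (mu0 r)^2], which stays within [mu0 r n^(6/5)] when [mu0 r <= n^(1/5)]. Halving the
    residual in each batch would take order [log n] batches, each with its own logarithm.
    Contracting by a power of [n] keeps the number of batches bounded and leaves a single logarithm.
    Since polynomial accuracy is then cheap, injectivity on the tangent space can rest on crude
    entrywise bounds with polynomial losses. The union over the entries of a step and over the
    [1 + n^2] starting matrices costs [n^4], which the exponent [beta + 4] pays for. *)

Lemma mulmx_tr_rowE n (u v : 'rV[R]_n) : (u *m v^T) 0 0 = \sum_i u 0 i * v 0 i.
Proof. by rewrite mxE; apply: eq_bigr => i _; rewrite mxE. Qed.

Lemma row_sq_eq0 n (u : 'rV[R]_n) : (u *m u^T) 0 0 = 0 -> u = 0.
Proof.
rewrite mulmx_tr_rowE => /eqP; rewrite psumr_eq0 => [/allP h|i _]; last first.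
  by rewrite -expr2 sqr_ge0.
apply/rowP => i; rewrite mxE; have := h i (mem_index_enum _).
by rewrite /= mulf_eq0 orbb => /eqP.
Qed.

(** An eigenvalue exists over [R[i]]. After splitting eigenvector and eigenvalue into real and
    imaginary parts, symmetry forces [be (|x|^2 + |y|^2) = 0], so a nonzero one of [x], [y] is a
    real eigenvector. *)
Lemma symmetric_eigenvector n (A : 'M[R]_n.+1) : A^T = A ->
  exists (u : 'rV[R]_n.+1) l, u *m u^T = 1%:M /\ u *m A = l *: u.
Proof.
move=> symA.
suff [x [l [x0 xA]]] : exists (x : 'rV[R]_n.+1) l, x != 0 /\ x *m A = l *: x.
  have xx0 : 0 < (x *m x^T) 0 0.
    rewrite lt0r; apply/andP; split.
      by apply: contra x0 => /eqP/row_sq_eq0 ->.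
    by rewrite mulmx_tr_rowE sumr_ge0// => i _; rewrite -expr2 sqr_ge0.
  exists ((Num.sqrt ((x *m x^T) 0 0))^-1 *: x), l; split; last first.
    by rewrite -scalemxAl xA scalerA mulrC -scalerA.
  rewrite linearZ /= -scalemxAl -scalemxAr scalerA -expr2 exprVn sqr_sqrtr ?ltW//.
  rewrite [X in _ *: X = _]mx11_scalar -scalemx1 scalerA mulVf ?scale1r//.
  by rewrite gt_eqF.
pose f : R -> R[i] := real_complex R.
have [a /eigenvalueP [v va v0]] :=
  eigenvalue_closed (map_mx f A) (ltn0Sn n).
pose x := map_mx (@complex.Re R) v; pose y := map_mx (@complex.Im R) v.
pose al := complex.Re a; pose be := complex.Im a.
have ReM (z : R[i]) (t : R) : complex.Re (z * f t) = complex.Re z * t.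
  by case: z => z1 z2 /=; rewrite mulr0 subr0.
have ImM (z : R[i]) (t : R) : complex.Im (z * f t) = complex.Im z * t.
  by case: z => z1 z2 /=; rewrite mulr0 add0r.
have xA : x *m A = al *: x - be *: y.
  apply/rowP => j; have /rowP/(_ j) := va.
  rewrite !mxE => /(congr1 (@complex.Re R)).
  rewrite raddf_sum /= => h.
  transitivity (complex.Re (a * v 0 j)).
    rewrite -h; apply: eq_bigr => i _; rewrite !mxE ReM; congr (_ * _).
  by rewrite /al /be; case: (a) (v 0 j) => ? ? [? ?].
have yA : y *m A = be *: x + al *: y.
  apply/rowP => j; have /rowP/(_ j) := va.
  rewrite !mxE => /(congr1 (@complex.Im R)).
  rewrite raddf_sum /= => h.
  transitivity (complex.Im (a * v 0 j)).
    rewrite -h; apply: eq_bigr => i _; rewrite !mxE ImM; congr (_ * _).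
  by rewrite /al /be; case: (a) (v 0 j) => ? ? [? ?] /=; rewrite addrC.
have be0 : be * ((x *m x^T) 0 0 + (y *m y^T) 0 0) = 0.
  have h : (x *m A *m y^T) 0 0 = (y *m A *m x^T) 0 0.
    have -> : x *m A *m y^T = (y *m A *m x^T)^T.
      by rewrite !trmx_mul trmxK symA mulmxA.
    by rewrite mxE.
  have h2 : (x *m y^T) 0 0 = (y *m x^T) 0 0.
    by rewrite !mulmx_tr_rowE; apply: eq_bigr => i _; rewrite mulrC.
  have entZ c (M : 'M[R]_1) : (c *: M) 0 0 = c * M 0 0 by rewrite mxE.
  have entD (M N : 'M[R]_1) : (M + N) 0 0 = M 0 0 + N 0 0 by rewrite mxE.
  have entN (M : 'M[R]_1) : (- M) 0 0 = - M 0 0 by rewrite mxE.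
  move: h; rewrite xA yA !mulmxDl !mulNmx -!scalemxAl.
  rewrite !entD entN !entZ h2.
  move: ((x *m x^T) 0 0) ((y *m x^T) 0 0) ((y *m y^T) 0 0) => X Y Z.
  by lra.
have [x0|x0] := eqVneq x 0; last first.
  exists x, al; split => //; rewrite xA.
  have xx : (x *m x^T) 0 0 + (y *m y^T) 0 0 != 0.
    apply: contra x0 => /eqP h; apply/eqP/row_sq_eq0.
    have : 0 <= (x *m x^T) 0 0 by rewrite mulmx_tr_rowE sumr_ge0// => i _; rewrite -expr2 sqr_ge0.
    have : 0 <= (y *m y^T) 0 0 by rewrite mulmx_tr_rowE sumr_ge0// => i _; rewrite -expr2 sqr_ge0.
    lra.
  by move/eqP: be0; rewrite mulf_eq0 (negbTE xx) orbF => /eqP ->; rewrite scale0r subr0.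
exists y, al; split; last by rewrite yA x0 scaler0 add0r.
apply: contra v0 => /eqP y0; apply/eqP/rowP => j.
move/rowP/(_ j): x0; move/rowP/(_ j): y0; rewrite !mxE.
by case: (v 0 j) => ? ? /= -> ->.
Qed.

(* The Householder reflection exchanging [u] and the first basis vector. *)
Lemma orthogonal_to_first n (u : 'rV[R]_n.+1) : u *m u^T = 1%:M ->
  exists Q : 'M[R]_n.+1,
    [/\ Q^T = Q, Q *m Q = 1%:M & delta_mx 0 0 *m Q = u].
Proof.
move=> uu; pose e : 'rV[R]_n.+1 := delta_mx 0 0.
have ee : e *m e^T = 1%:M.
  rewrite /e trmx_delta mul_delta_mx; apply/matrixP => i j.
  by rewrite !ord1 !mxE.
have [->|ue] := eqVneq u e.
  by exists 1%:M; rewrite trmx1 mulmx1; split => //; rewrite mulmx1.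
have eu : u *m e^T = e *m u^T.
  apply/matrixP => i j; rewrite !ord1 !mulmx_tr_rowE.
  by apply: eq_bigr => k _; rewrite mulrC.
have [w uE] : exists w : 'rV[R]_n.+1, u = w + e by exists (u - e); rewrite subrK.
pose s : R := (w *m w^T) 0 0.
have s0 : s != 0.
  apply: contra ue => /eqP/row_sq_eq0 w0.
  by rewrite uE w0 add0r.
have ww : w *m w^T = s%:M by rewrite [LHS]mx11_scalar.
have hs : s%:M = 2 *: (1%:M - e *m u^T).
  rewrite -ww (_ : w = u - e); last by rewrite uE addrK.
  rewrite linearB /= mulmxBl !mulmxBr uu ee eu.
  by rewrite scaler_nat mulr2n opprB.
pose Q : 'M[R]_n.+1 := 1%:M - (2 / s) *: (w^T *m w).
have QT : Q^T = Q.
  by rewrite /Q linearB /= trmx1 linearZ /= trmx_mul trmxK.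
exists Q; split => //.
  rewrite /Q; set W := w^T *m w.
  have WW : W *m W = s *: W.
    by rewrite /W -mulmxA (mulmxA w) ww mul_scalar_mx -scalemxAr.
  rewrite mulmxBl mul1mx mulmxBr mulmx1 -scalemxAl -scalemxAr WW !scalerA.
  by apply/matrixP => i j; move: W WW => W _; rewrite !mxE; field.
rewrite /Q mulmxBr mulmx1 -scalemxAr mulmxA.
have -> : delta_mx 0 0 *m w^T = (- (s / 2))%:M.
  rewrite -/e (_ : w = u - e); last by rewrite uE addrK.
  rewrite linearB /= mulmxBr ee -opprB raddfN /=; congr (- _).
  by rewrite mulrC -scale_scalar_mx hs scalerA mulVf ?scale1r// pnatr_eq0.
rewrite mul_scalar_mx scalerA (_ : 2 / s * - (s / 2) = -1); last by field.
by rewrite scaleN1r opprK uE addrC.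
Qed.

Lemma involution_conjK n (A Q : 'M[R]_n) : Q *m Q = 1%:M ->
  Q *m (Q *m A *m Q) *m Q = A.
Proof. by move=> QQ; rewrite !mulmxA QQ mul1mx -mulmxA QQ mulmx1. Qed.

(** Deflation: conjugating by the reflection that sends the first basis vector to an eigenvector
    clears the first row and, by symmetry, the first column off the diagonal; induction treats the
    remaining block. *)
Theorem real_spectral n (A : 'M[R]_n) : A^T = A ->
  exists (P : 'M[R]_n) (d : 'rV[R]_n),
    P *m P^T = 1%:M /\ A = P^T *m diag_mx d *m P.
Proof.
elim: n A => [|n IH] A symA.
  by exists 1%:M, 0; rewrite trmx1 mulmx1; split => //; apply/matrixP => -[].
have [u [l [uu uA]]] := symmetric_eigenvector symA.
have [Q [QT QQ eQ]] := orthogonal_to_first uu.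
pose B : 'M[R]_n.+1 := Q *m A *m Q.
have BT : B^T = B.
  rewrite /B !trmx_mul QT symA. by rewrite -mulmxA.
have AB : A = Q *m B *m Q.
  by rewrite /B involution_conjK.
have eB : (delta_mx 0 0 : 'rV_n.+1) *m B = l *: delta_mx 0 0.
  have -> : (delta_mx 0 0 : 'rV_n.+1) *m B = delta_mx 0 0 *m Q *m A *m Q.
    by rewrite /B -!mulmxA.
  by rewrite eQ uA -scalemxAl -eQ -mulmxA QQ mulmx1.
have B00 j : B 0 j = l * (j == 0)%:R.
  have /rowP/(_ j) := eB; rewrite -rowE !mxE => ->.
  by rewrite eqxx.
move: B BT AB {eB} B00 => /= B BT AB B00.
have [P [d [PP eqd]]] : exists (P : 'M[R]_n) (d : 'rV[R]_n),
    P *m P^T = 1%:M /\ drsubmx (B : 'M[R]_(1 + n)) = P^T *m diag_mx d *m P.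
  by apply: IH; rewrite trmx_drsub BT.
have Bblock : B = block_mx (l%:M : 'M[R]_1) 0 0 (drsubmx (B : 'M[R]_(1 + n))).
  rewrite -[LHS](@submxK _ 1 n 1 n); congr (@block_mx _ 1 n 1 n _ _ _ _).
  - apply/matrixP => i j; rewrite !ord1 !mxE lshift0 B00 eqxx mulr1 mulr1n//.
  - apply/matrixP => i j; rewrite !ord1 !mxE lshift0 B00.
    by rewrite (_ : rshift 1 j == 0 = false) ?mulr0//.
  - apply/matrixP => i j; rewrite !ord1 !mxE -[B]BT mxE lshift0 B00.
    by rewrite (_ : rshift 1 i == 0 = false) ?mulr0//.
pose P1 : 'M[R]_n.+1 := block_mx (1%:M : 'M[R]_1) 0 0 P.
pose D1 : 'rV[R]_n.+1 := row_mx (l%:M : 'M[R]_1) d.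
have PP1 : P1 *m P1^T = 1%:M.
  rewrite /P1 (@tr_block_mx _ 1 n 1 n) !trmx0 trmx1 (@mulmx_block _ 1 n 1 n 1 n).
  by rewrite !mulmx0 !mul0mx !addr0 add0r mulmx1 PP; exact/esym/(@scalar_mx_block _ 1 n).
have DD : diag_mx D1 = block_mx (l%:M : 'M[R]_1) 0 0 (diag_mx d).
  rewrite [LHS](@diag_mx_row _ n 1 (l%:M) d).
  by congr (@block_mx _ 1 n 1 n _ _ _ _); apply/matrixP => i j; rewrite !ord1 !mxE.
have BP : B = P1^T *m diag_mx D1 *m P1.
  rewrite Bblock eqd DD /P1 (@tr_block_mx _ 1 n 1 n) !trmx0 trmx1.
  rewrite !(@mulmx_block _ 1 n 1 n 1 n).
  rewrite !(mulmx0, mul0mx, addr0, add0r, mulmx1, mul1mx).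
  by [].
exists (P1 *m Q), D1; split.
  by rewrite trmx_mul mulmxA -(mulmxA P1) QT QQ mulmx1.
by rewrite trmx_mul QT AB BP !mulmxA.
Qed.

End SpectralTheorem.

(** * Singular values and the nuclear norm *)

Section Frobenius.
Variable R : realType.
Implicit Types m n p : nat.

(** The trace inner product. On column vectors it is the Euclidean one, so quadratic forms and
    vector norms share its lemmas. *)
Definition frob m n (A B : 'M[R]_(m, n)) : R := \tr (A^T *m B).

Lemma frobE m n (A B : 'M[R]_(m, n)) : frob A B = \sum_i \sum_j A i j * B i j.
Proof.
rewrite /frob /mxtrace exchange_big; apply: eq_bigr => j _.
by rewrite mxE; apply: eq_bigr => i _; rewrite mxE.
Qed.

Lemma frobC m n (A B : 'M[R]_(m, n)) : frob A B = frob B A.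
Proof. by rewrite /frob -mxtrace_tr trmx_mul trmxK. Qed.

Lemma frobDl m n (A B C : 'M[R]_(m, n)) : frob (A + B) C = frob A C + frob B C.
Proof. by rewrite /frob linearD /= mulmxDl mxtraceD. Qed.

Lemma frobDr m n (A B C : 'M[R]_(m, n)) : frob A (B + C) = frob A B + frob A C.
Proof. by rewrite /frob mulmxDr mxtraceD. Qed.

Lemma frobNl m n (A B : 'M[R]_(m, n)) : frob (- A) B = - frob A B.
Proof. by rewrite /frob linearN /= mulNmx raddfN. Qed.

Lemma frobNr m n (A B : 'M[R]_(m, n)) : frob A (- B) = - frob A B.
Proof. by rewrite /frob mulmxN raddfN. Qed.

Lemma frobBl m n (A B C : 'M[R]_(m, n)) : frob (A - B) C = frob A C - frob B C.
Proof. by rewrite frobDl frobNl. Qed.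

Lemma frobBr m n (A B C : 'M[R]_(m, n)) : frob A (B - C) = frob A B - frob A C.
Proof. by rewrite frobDr frobNr. Qed.

Lemma frobZl m n c (A B : 'M[R]_(m, n)) : frob (c *: A) B = c * frob A B.
Proof. by rewrite /frob linearZ /= -scalemxAl mxtraceZ. Qed.

Lemma frobZr m n c (A B : 'M[R]_(m, n)) : frob A (c *: B) = c * frob A B.
Proof. by rewrite frobC frobZl frobC. Qed.

Lemma frob0r m n (A : 'M[R]_(m, n)) : frob A 0 = 0.
Proof. by rewrite /frob mulmx0 mxtrace0. Qed.

Lemma frob0l m n (A : 'M[R]_(m, n)) : frob 0 A = 0.
Proof. by rewrite frobC frob0r. Qed.

Lemma frob_suml m n (I : finType) (F : I -> 'M[R]_(m, n)) (A : 'M[R]_(m, n)) :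
  frob (\sum_i F i) A = \sum_i frob (F i) A.
Proof.
apply: (big_ind2 (fun X y => frob X A = y)) => //; first by rewrite frob0l.
by move=> X1 x1 X2 x2 <- <-; rewrite frobDl.
Qed.

Lemma frob_sumr m n (I : finType) (F : I -> 'M[R]_(m, n)) (A : 'M[R]_(m, n)) :
  frob A (\sum_i F i) = \sum_i frob A (F i).
Proof. by rewrite frobC frob_suml; apply: eq_bigr => i _; rewrite frobC. Qed.

Lemma frob_mull m n p (A : 'M[R]_(m, n)) (B : 'M[R]_(n, p)) (C : 'M[R]_(m, p)) :
  frob (A *m B) C = frob B (A^T *m C).
Proof. by rewrite /frob trmx_mul mulmxA. Qed.

Lemma frob_mulr m n p (A : 'M[R]_(m, n)) (B : 'M[R]_(n, p)) (C : 'M[R]_(m, p)) :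
  frob (A *m B) C = frob A (C *m B^T).
Proof. by rewrite /frob trmx_mul -mulmxA mxtrace_mulC mulmxA. Qed.

Lemma frob_tr m n (A B : 'M[R]_(m, n)) : frob A^T B^T = frob A B.
Proof. by rewrite /frob trmxK mxtrace_mulC -mxtrace_tr trmx_mul !trmxK. Qed.

Lemma frob_deltal m n (A : 'M[R]_(m, n)) i j : frob (delta_mx i j) A = A i j.
Proof.
rewrite frobE (bigD1 i)//= (bigD1 j)//= !mxE !eqxx mul1r big1 => [|k kj].
  rewrite addr0 big1 ?addr0// => l li; rewrite big1// => k _.
  by rewrite mxE (negbTE li) mul0r.
by rewrite mxE (negbTE kj) andbF mul0r.
Qed.

Lemma frob_ge0 m n (A : 'M[R]_(m, n)) : 0 <= frob A A.
Proof.
by rewrite frobE; apply: sumr_ge0 => i _; apply: sumr_ge0 => j _; rewrite -expr2 sqr_ge0.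
Qed.

Lemma sqr_entry_le_frob m n (A : 'M[R]_(m, n)) i j : A i j ^+ 2 <= frob A A.
Proof.
rewrite frobE (bigD1 i)//= (bigD1 j)//= -expr2 -addrA lerDl addr_ge0//.
  by apply: sumr_ge0 => k _; rewrite -expr2 sqr_ge0.
by apply: sumr_ge0 => l _; apply: sumr_ge0 => k _; rewrite -expr2 sqr_ge0.
Qed.

Lemma frob_eq0 m n (A : 'M[R]_(m, n)) : frob A A <= 0 -> A = 0.
Proof.
move=> A0; apply/matrixP => i j; rewrite mxE; apply/eqP; rewrite -sqrf_eq0.
by rewrite eq_le sqr_ge0 andbT (le_trans (sqr_entry_le_frob A i j)).
Qed.

Lemma frob_AMGM m n (A B : 'M[R]_(m, n)) : 2 * frob A B <= frob A A + frob B B.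
Proof.
have := frob_ge0 (A - B); rewrite frobBl !frobBr (frobC B A); lra.
Qed.

Lemma frob_CS m n (A B : 'M[R]_(m, n)) : frob A B ^+ 2 <= frob A A * frob B B.
Proof.
have := frob_ge0 A; rewrite le_eqVlt => /orP[/eqP A0|A0].
  have -> : A = 0 by apply: frob_eq0; rewrite -A0.
  by rewrite !frob0l expr0n /= mul0r.
have := frob_ge0 (frob A A *: B - frob A B *: A).
rewrite frobBl !frobBr !frobZl !frobZr (frobC B A).
set a := frob A A; set b := frob A B; set c := frob B B => h.
have {}h : 0 <= a * (a * c - b ^+ 2) by move: h; nra.
by move: h; rewrite pmulr_rge0// subr_ge0.
Qed.

Lemma frob_orthogonal m n p (U : 'M[R]_(m, p)) (A B : 'M[R]_(p, n)) :
  U^T *m U = 1%:M -> frob (U *m A) (U *m B) = frob A B.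
Proof. by move=> UU; rewrite frob_mull mulmxA UU mul1mx. Qed.

End Frobenius.

(** * The compact singular value decomposition and norm duality *)

Section SingularValues.
Variable R : realType.

(** With [A^T A = P^T diag(d) P], the columns of [M = A P^T] are orthogonal with squared lengths
    [d]. Normalizing the nonzero ones gives [U], and the matching rows of [P] give [V]. *)
Lemma svd_exists n (A : 'M[R]_n) :
  exists r (X : 'M[R]_(n, r) * 'rV[R]_r * 'M[R]_(n, r)), is_svd A X.
Proof.
have symA : (A^T *m A)^T = A^T *m A by rewrite trmx_mul trmxK.
have [P [d [PP AE]]] := real_spectral symA.
have PtP : P^T *m P = 1%:M by apply: mulmx1C.
pose M := A *m P^T.
have MM : M^T *m M = diag_mx d.
  rewrite /M trmx_mul trmxK mulmxA -(mulmxA P) AE !mulmxA PP mul1mx.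
  by rewrite -mulmxA PP mulmx1.
have MMk k l : \sum_i M i k * M i l = d 0 k *+ (k == l).
  have /matrixP/(_ k l) := MM; rewrite !mxE => <-.
  by apply: eq_bigr => i _; rewrite !mxE.
have d0 k : 0 <= d 0 k.
  by have := MMk k k; rewrite eqxx mulr1n => <-; apply: sumr_ge0 => i _; rewrite -expr2 sqr_ge0.
pose S := [set k | 0 < d 0 k]%SET.
have Mz i k : k \notin S -> M i k = 0.
  rewrite inE -leNgt => dk; apply/eqP; rewrite -sqrf_eq0 eq_le sqr_ge0 andbT.
  apply: le_trans dk; have := MMk k k; rewrite eqxx mulr1n => <-.
  by rewrite (bigD1 i)//= -expr2 lerDl; apply: sumr_ge0 => j _; rewrite -expr2 sqr_ge0.
pose V : 'M[R]_(n, #|S|) := \matrix_(i, k) P (enum_val k) i.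
have [s sE] : exists s : 'rV[R]_#|S|, forall k, s 0 k = Num.sqrt (d 0 (enum_val k)).
  by exists (\row_k Num.sqrt (d 0 (enum_val k))) => k; rewrite mxE.
have s0 k : 0 < s 0 k.
  by rewrite sE sqrtr_gt0; have := enum_valP k; rewrite inE.
have [U UE] : exists U : 'M[R]_(n, #|S|), forall i k, U i k = M i (enum_val k) / s 0 k.
  by exists (\matrix_(i, k) (M i (enum_val k) / s 0 k)) => i k; rewrite mxE.
exists #|S|, (U, s, V); split=> //.
- apply/matrixP => k l; rewrite [LHS]mxE [RHS]mxE.
  transitivity ((s 0 k)^-1 * (s 0 l)^-1 * \sum_i M i (enum_val k) * M i (enum_val l)).
    rewrite mulr_sumr; apply: eq_bigr => i _.
    by rewrite mxE !UE mulrACA mulrC.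
  rewrite MMk (inj_eq enum_val_inj); have [->|] := eqVneq k l; last by rewrite mulr0.
  rewrite !mulr1n -[d _ _]sqr_sqrtr// -sE.
  by field; rewrite gt_eqF.
- apply/matrixP => k l; rewrite !mxE.
  have /matrixP/(_ (enum_val k) (enum_val l)) := PP; rewrite !mxE (inj_eq enum_val_inj) => <-.
  by apply: eq_bigr => i _; rewrite !mxE.
- apply/matrixP => i j.
  have -> : A = M *m P by rewrite /M -mulmxA PtP mulmx1.
  rewrite mxE (bigID [in S])/= [X in _ + X]big1 ?addr0; last first.
    by move=> k kS; rewrite Mz// mul0r.
  rewrite big_enum_val mxE; apply: eq_bigr => k _.
  by rewrite mul_mx_diag [V^T _ _]mxE [V _ _]mxE mxE UE divfK// gt_eqF.
Qed.

(** The middle factor is invertible, so the size of any compact decomposition is the rank. This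
    moves the existence result to the type over which [svd] chooses. *)
Lemma svd_rank n r (A : 'M[R]_n) (X : 'M[R]_(n, r) * 'rV[R]_r * 'M[R]_(n, r)) :
  is_svd A X -> \rank A = r.
Proof.
case: X => -[U s] V [UU VV s0 AE].
apply/eqP; rewrite eqn_leq; apply/andP; split.
  by rewrite AE (leq_trans (mxrankM_maxl _ _))// (leq_trans (mxrankM_maxr _ _)) ?rank_leq_row.
have <- : \rank (diag_mx s) = r.
  apply/mxrank_unit; rewrite unitmxE det_diag unitfE; apply/prodf_neq0 => k _.
  by rewrite gt_eqF.
have -> : diag_mx s = U^T *m A *m V.
  by rewrite AE !mulmxA UU mul1mx -mulmxA VV mulmx1.
by rewrite (leq_trans (mxrankM_maxl _ _)) ?mxrankM_maxr.
Qed.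

Lemma svdP n (A : 'M[R]_n) : is_svd A (svd A).
Proof.
have [r [X XA]] := svd_exists A.
have e := svd_rank XA; subst r.
exact: (xgetPex _ (ex_intro _ X XA)).
Qed.

(* [W] has operator norm at most [c]; the arithmetic mean avoids square roots. *)
Definition op_bound n (W : 'M[R]_n) (c : R) : Prop :=
  forall x y : 'cV[R]_n, 2 * frob x (W *m y) <= c * (frob x x + frob y y).

Lemma frob_diag_svd n r (W : 'M[R]_n) (U V : 'M[R]_(n, r)) (s : 'rV[R]_r) :
  frob W (U *m diag_mx s *m V^T) = \sum_k s 0 k * frob (col k U) (W *m col k V).
Proof.
have -> : frob W (U *m diag_mx s *m V^T) = frob (diag_mx s) (U^T *m W *m V).
  by rewrite frobC frob_mulr trmxK frob_mull mulmxA.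
rewrite frobE; apply: eq_bigr => k _; rewrite (bigD1 k)//= big1 ?addr0 => [|j jk].
  rewrite !mxE eqxx mulr1n; congr (_ * _).
  rewrite frobE; rewrite [RHS](eq_bigr (fun i => U i k * (W *m col k V) i 0)).
    under [RHS]eq_bigr => i _ do rewrite mxE mulr_sumr.
    rewrite exchange_big /=; apply: eq_bigr => j _.
    rewrite mxE mulr_suml; apply: eq_bigr => i _.
    by rewrite !mxE mulrA.
  by move=> i _; rewrite big_ord1 mxE.
by rewrite mxE eq_sym (negbTE jk) mulr0n mul0r.
Qed.

(** One half of the duality between operator and nuclear norm: on unit singular vectors [op_bound]
    reads [<u_k, W v_k> <= c]. Equality is attained at [W = U V^T]. *)
Lemma nuclear_norm_ge n (A W : 'M[R]_n) c :
  op_bound W c -> frob W A <= c * nuclear_norm A.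
Proof.
move=> Wc; have := svdP A; rewrite /nuclear_norm /singular_values.
case: (svd A) => -[U s] V /= [UU VV s0 AE]; rewrite [in frob _ _]AE frob_diag_svd.
rewrite mulr_sumr; apply: ler_sum => k _; rewrite [leRHS]mulrC ler_pM2l//.
have colE (X : 'M[R]_(n, \rank A)) : X^T *m X = 1%:M -> frob (col k X) (col k X) = 1.
  move=> XX; have /matrixP/(_ k k) := XX; rewrite !mxE eqxx [RHS]mulr1n => <-.
  by rewrite frobE; apply: eq_bigr => i _; rewrite big_ord1 !mxE.
have := Wc (col k U) (col k V); rewrite !colE//; lra.
Qed.

Lemma nuclear_norm_eq n (A : 'M[R]_n) :
  frob (left_singular_vectors A *m (right_singular_vectors A)^T) A = nuclear_norm A.
Proof.
have := svdP A; rewrite /nuclear_norm /singular_values /left_singular_vectors.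
rewrite /right_singular_vectors.
case: (svd A) => -[U s] V /= [UU VV s0 AE].
have -> : frob (U *m V^T) A = frob (U *m V^T) (U *m diag_mx s *m V^T) by rewrite -AE.
rewrite -mulmxA frob_orthogonal// -frob_tr trmx_mul !trmxK.
rewrite tr_diag_mx -[V in frob V _]mulmx1 frob_orthogonal//.
rewrite /frob trmx1 mul1mx /mxtrace; apply: eq_bigr => k _.
by rewrite mxE eqxx mulr1n.
Qed.

Lemma frob_le_nuclear_norm n (A : 'M[R]_n) : frob A A <= nuclear_norm A ^+ 2.
Proof.
have := svdP A; rewrite /nuclear_norm /singular_values.
case: (svd A) => -[U s] V /= [UU VV s0 AE].
rewrite [in frob _ _]AE -!mulmxA frob_orthogonal// -frob_tr !trmx_mul !trmxK.
rewrite tr_diag_mx frob_orthogonal// frobE expr2 mulr_suml.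
apply: ler_sum => k _; rewrite (bigD1 k)//= big1 ?addr0 => [|j jk]; last first.
  by rewrite !mxE eq_sym (negbTE jk) mulr0n mul0r.
rewrite !mxE eqxx mulr1n ler_pM2l// (bigD1 k)//= lerDl.
by apply: sumr_ge0 => j _; rewrite ltW.
Qed.

Lemma nuclear_norm_ge0 n (A : 'M[R]_n) : 0 <= nuclear_norm A.
Proof.
have := svdP A; rewrite /nuclear_norm /singular_values.
case: (svd A) => -[U s] V /= [_ _ s0 _].
by apply: sumr_ge0 => k _; rewrite ltW.
Qed.

End SingularValues.

(* Orthogonal projections onto the tangent space
   [T = {U X^T + Y V^T}] of the rank-[r] matrices at [A = U S V^T],
   and onto its orthogonal complement. *)
Section TangentSpace.
Variables (R : realType) (n r : nat) (U V : 'M[R]_(n, r)).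
Hypotheses (UU : U^T *m U = 1%:M) (VV : V^T *m V = 1%:M).

Definition tangent_proj (X : 'M[R]_n) : 'M[R]_n :=
  U *m U^T *m X + X *m (V *m V^T) - U *m U^T *m X *m (V *m V^T).

Definition normal_proj (X : 'M[R]_n) : 'M[R]_n :=
  (1%:M - U *m U^T) *m X *m (1%:M - V *m V^T).

Lemma tangentDnormal X : tangent_proj X + normal_proj X = X.
Proof.
rewrite /tangent_proj /normal_proj !(mulmxBl, mulmxBr, mulmx1, mul1mx) !mulmxA.
by apply/matrixP => i j; rewrite !mxE; ring.
Qed.

Let P_idem : U *m U^T *m (U *m U^T) = U *m U^T.
Proof. by rewrite !mulmxA -(mulmxA U) UU mulmx1. Qed.

Let Q_idem : V *m V^T *m (V *m V^T) = V *m V^T.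
Proof. by rewrite !mulmxA -(mulmxA V) VV mulmx1. Qed.

Let PC_idem : (1%:M - U *m U^T) *m (1%:M - U *m U^T) = 1%:M - U *m U^T.
Proof. by rewrite mulmxBl mul1mx mulmxBr P_idem mulmx1 subrr subr0. Qed.

Let QC_idem : (1%:M - V *m V^T) *m (1%:M - V *m V^T) = 1%:M - V *m V^T.
Proof. by rewrite mulmxBl mul1mx mulmxBr Q_idem mulmx1 subrr subr0. Qed.

Let PC_tr : (1%:M - U *m U^T)^T = 1%:M - U *m U^T.
Proof. by rewrite linearB /= trmx1 trmx_mul trmxK. Qed.

Let QC_tr : (1%:M - V *m V^T)^T = 1%:M - V *m V^T.
Proof. by rewrite linearB /= trmx1 trmx_mul trmxK. Qed.

Lemma normal_proj_idem X : normal_proj (normal_proj X) = normal_proj X.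
Proof.
by rewrite /normal_proj -!mulmxA QC_idem [LHS]mulmxA PC_idem.
Qed.

Lemma normal_proj_sym X Y : frob (normal_proj X) Y = frob X (normal_proj Y).
Proof. by rewrite /normal_proj frob_mulr frob_mull QC_tr PC_tr mulmxA. Qed.

Lemma tangent_projE X : tangent_proj X = X - normal_proj X.
Proof. by rewrite -{2}[X]tangentDnormal addrK. Qed.

Lemma normal_projB X Y : normal_proj (X - Y) = normal_proj X - normal_proj Y.
Proof. by rewrite /normal_proj (mulmxBr _ X Y) mulmxBl. Qed.

Lemma tangent_projB X Y : tangent_proj (X - Y) = tangent_proj X - tangent_proj Y.
Proof. rewrite !tangent_projE normal_projB; by apply/matrixP => i j; rewrite !mxE; ring. Qed.

Lemma tangent_proj_idem X : tangent_proj (tangent_proj X) = tangent_proj X.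
Proof.
rewrite [in LHS]tangent_projE -[RHS]subr0; congr (_ - _).
by rewrite tangent_projE normal_projB normal_proj_idem subrr.
Qed.

Lemma tangent_proj_sym X Y : frob (tangent_proj X) Y = frob X (tangent_proj Y).
Proof. by rewrite !tangent_projE frobBl frobBr normal_proj_sym. Qed.

Lemma op_bound_normal_proj Y c : 0 <= c ->
  op_bound Y c -> op_bound (normal_proj Y) c.
Proof.
move=> c0 Yc x y.
have proj_le (P : 'M[R]_n) (z : 'cV[R]_n) : P^T = P -> P *m P = P ->
    frob (P *m z) (P *m z) <= frob z z.
  move=> PT PP; have := frob_ge0 (z - P *m z).
  have e : frob (P *m z) (P *m z) = frob z (P *m z).
    by rewrite frob_mull PT mulmxA PP.
  by rewrite frobBl !frobBr e (frobC (P *m z) z); lra.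
have -> : frob x (normal_proj Y *m y) =
    frob ((1%:M - U *m U^T) *m x) (Y *m ((1%:M - V *m V^T) *m y)).
  by rewrite frob_mull PC_tr /normal_proj !mulmxA.
apply: le_trans (Yc _ _) _; apply: ler_wpM2l => //.
by apply: lerD; apply: proj_le.
Qed.

End TangentSpace.

(** * Dual certificates *)

Section DualCertificate.
Variable R : realType.

Lemma sum_const_ord2 n (c : R) : \sum_(i < n) \sum_(j < n) c = n%:R ^+ 2 * c.
Proof. by rewrite !sumr_const !card_ord -[LHS]mulr_natl -[X in _ * X]mulr_natl mulrA expr2. Qed.

(** Bessel's inequality for the two orthogonal families bounds each side. In the uniqueness proof
    the sum is [U V^T] plus the sign matrix of the normal part of a perturbation. *)
Lemma op_bound_orthogonal_sum n r r' (U V : 'M[R]_(n, r)) (U' V' : 'M[R]_(n, r')) :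
  U^T *m U = 1%:M -> V^T *m V = 1%:M -> U'^T *m U' = 1%:M -> V'^T *m V' = 1%:M ->
  U^T *m U' = 0 -> V^T *m V' = 0 ->
  op_bound (U *m V^T + U' *m V'^T) 1.
Proof.
have bessel (X : 'M[R]_(n, r)) (X' : 'M[R]_(n, r')) (x : 'cV[R]_n) :
    X^T *m X = 1%:M -> X'^T *m X' = 1%:M -> X^T *m X' = 0 ->
    frob (X^T *m x) (X^T *m x) + frob (X'^T *m x) (X'^T *m x) <= frob x x.
  move=> XX XX' XX0.
  have := frob_ge0 (x - X *m (X^T *m x) - X' *m (X'^T *m x)).
  have e1 : frob x (X *m (X^T *m x)) = frob (X^T *m x) (X^T *m x).
    by rewrite frobC frob_mull.
  have e2 : frob x (X' *m (X'^T *m x)) = frob (X'^T *m x) (X'^T *m x).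
    by rewrite frobC frob_mull.
  have e3 : frob (X *m (X^T *m x)) (X' *m (X'^T *m x)) = 0.
    by rewrite frob_mull !mulmxA XX0 !mul0mx frob0r.
  have e4 := frob_orthogonal (X^T *m x) (X^T *m x) XX.
  have e5 := frob_orthogonal (X'^T *m x) (X'^T *m x) XX'.
  rewrite !(frobBl, frobBr) (frobC (X *m _) x) (frobC (X' *m _) x).
  rewrite (frobC (X' *m _) (X *m _)) e1 e2 e3 e4 e5.
  lra.
move=> UU VV UU' VV' U0 V0 x y.
have := bessel _ _ x UU UU' U0; have := bessel _ _ y VV VV' V0.
have := frob_AMGM (U^T *m x) (V^T *m y); have := frob_AMGM (U'^T *m x) (V'^T *m y).
rewrite mulmxDl frobDr.
have -> : frob x (U *m V^T *m y) = frob (U^T *m x) (V^T *m y).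
  by rewrite frob_mull trmxK mulmxA.
have -> : frob x (U' *m V'^T *m y) = frob (U'^T *m x) (V'^T *m y).
  by rewrite frob_mull trmxK mulmxA.
lra.
Qed.

(** [U = A V S^-1], so what annihilates [A] annihilates [U]. Applied to a normal part, it makes the
    singular vectors of that part orthogonal to those of [A]. *)
Lemma svd_mul_eq0 n k (A : 'M[R]_n) (Z : 'M[R]_(k, n)) :
  Z *m A = 0 -> Z *m left_singular_vectors A = 0.
Proof.
have := svdP A; rewrite /left_singular_vectors.
case: (svd A) => -[U s] V /= [UU VV s0 AE] ZA.
have h : Z *m U *m diag_mx s = 0.
  have -> : Z *m U *m diag_mx s = Z *m (U *m diag_mx s *m V^T) *m V.
    by rewrite !mulmxA -(mulmxA _ V^T) VV mulmx1.
  by rewrite -AE ZA mul0mx.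
apply/matrixP => i j; move/matrixP/(_ i j): h.
rewrite mul_mx_diag [LHS]mxE [RHS]mxE => /eqP.
by rewrite mulf_eq0 (gt_eqF (s0 j)) orbF => /eqP ->; rewrite mxE.
Qed.

Lemma svd_mul_eq0r n k (A : 'M[R]_n) (Z : 'M[R]_(n, k)) :
  A *m Z = 0 -> (right_singular_vectors A)^T *m Z = 0.
Proof.
have := svdP A; rewrite /right_singular_vectors.
case: (svd A) => -[U s] V /= [UU VV s0 AE] ZA.
have h : diag_mx s *m (V^T *m Z) = 0.
  have -> : diag_mx s *m (V^T *m Z) = U^T *m (U *m diag_mx s *m V^T *m Z).
    by rewrite !mulmxA UU mul1mx.
  by rewrite -AE ZA mulmx0.
apply/matrixP => i j; move/matrixP/(_ i j): h.
rewrite mul_diag_mx [LHS]mxE [RHS]mxE => /eqP.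
by rewrite mulf_eq0 (gt_eqF (s0 i)) /= => /eqP ->; rewrite mxE.
Qed.

Variables (n : nat) (A : 'M[R]_n).
Let U := left_singular_vectors A.
Let V := right_singular_vectors A.

Lemma left_singular_vectors_orthonormal : U^T *m U = 1%:M.
Proof.
by have := svdP A; rewrite /U /left_singular_vectors; case: svd => -[? ?] ? [].
Qed.

Lemma right_singular_vectors_orthonormal : V^T *m V = 1%:M.
Proof.
by have := svdP A; rewrite /V /right_singular_vectors; case: svd => -[? ?] ? [].
Qed.

Let UU := left_singular_vectors_orthonormal.
Let VV := right_singular_vectors_orthonormal.

Lemma normal_proj_svd0 : normal_proj U V A = 0.
Proof.
have [s AE] : exists s, A = U *m diag_mx s *m V^T.
  have := svdP A; rewrite /U /V /left_singular_vectors /right_singular_vectors.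
  by case: svd => -[? s] ? [_ _ _ ?]; exists s.
rewrite /normal_proj.
have -> : (1%:M - U *m U^T) *m A = 0.
  by rewrite [X in _ *m X]AE !mulmxA mulmxBl mul1mx -(mulmxA U) UU mulmx1 subrr !mul0mx.
by rewrite mul0mx.
Qed.

Lemma normal_proj_sign0 : normal_proj U V (U *m V^T) = 0.
Proof.
rewrite /normal_proj mulmxA mulmxBl mul1mx -(mulmxA U) UU mulmx1 subrr.
by rewrite !mul0mx.
Qed.

(* An approximate dual certificate [Y], together with the quantitative
   injectivity [K] of the sampling operator on the tangent space. *)
Theorem certificate_unique_minimizer (Omega : {set 'I_n * 'I_n}) (Y : 'M[R]_n)
    (delta K : R) (A' : 'M[R]_n) :
  (forall p, p \notin Omega -> Y p.1 p.2 = 0) ->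
  op_bound (normal_proj U V Y) (1 / 2) ->
  (forall i j, `|(U *m V^T - tangent_proj U V Y) i j| <= delta) ->
  (forall M : 'M[R]_n, (forall p, p \in Omega -> M p.1 p.2 = 0) ->
     forall i j, `|tangent_proj U V M i j| <=
       K * Num.sqrt (frob (normal_proj U V M) (normal_proj U V M))) ->
  0 <= K -> 0 <= delta -> n%:R ^+ 2 * delta * K <= 1 / 4 ->
  agree_on Omega A' A -> nuclear_norm A' <= nuclear_norm A -> A' = A.
Proof.
move=> Ysupp Yc Yd inj K0 delta0 dK agree A'le.
have [M MA] : exists M, A' = A + M by exists (A' - A); rewrite addrC subrK.
pose N := normal_proj U V M; pose T := tangent_proj U V M.
have M0 p : p \in Omega -> M p.1 p.2 = 0.
  by move=> /agree; rewrite MA mxE => /(canRL (addKr _)) ->; rewrite addNr.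
pose U' := left_singular_vectors N; pose V' := right_singular_vectors N.
have [UU' VV'] : U'^T *m U' = 1%:M /\ V'^T *m V' = 1%:M.
  have := svdP N; rewrite /U' /V' /left_singular_vectors /right_singular_vectors.
  by case: svd => -[? ?] ? [].
have U0 : U^T *m U' = 0.
  apply: svd_mul_eq0; rewrite /N /normal_proj !(mulmxA U^T).
  by rewrite [U^T *m _]mulmxBr mulmx1 mulmxA UU mul1mx subrr !mul0mx.
have V0 : V'^T *m V = 0.
  apply: svd_mul_eq0r; rewrite /N /normal_proj -(mulmxA _ _ V).
  by rewrite [_ *m V]mulmxBl mul1mx -(mulmxA V) VV mulmx1 subrr mulmx0.
have V0' : V^T *m V' = 0 by rewrite -[LHS]trmxK trmx_mul trmxK V0 trmx0.
have U0' : U'^T *m U = 0 by rewrite -[LHS]trmxK trmx_mul trmxK U0 trmx0.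
(* [W] is the sign matrix of [N]. Since [U V^T + W] has operator norm at most 1, its pairing with
   [A'] bounds the nuclear norm of [A'] from below. *)
pose W := U' *m V'^T.
have EWc := op_bound_orthogonal_sum UU VV UU' VV' U0 V0'.
have := nuclear_norm_ge A' EWc; rewrite mul1r -/W.
rewrite [in frob _ _]MA.
have EA : frob (U *m V^T) A = nuclear_norm A by exact: nuclear_norm_eq.
have WN : normal_proj U V W = W.
  rewrite /normal_proj /W mulmxA mulmxBl mul1mx -(mulmxA U) U0 mulmx0 subr0.
  by rewrite mulmxBr mulmx1 -!mulmxA (mulmxA V'^T) V0 mul0mx mulmx0 subr0.
have WA : frob W A = 0 by rewrite -WN normal_proj_sym normal_proj_svd0 frob0r.
have WM : frob W M = nuclear_norm N by rewrite -WN normal_proj_sym; exact: nuclear_norm_eq.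
pose D := U *m V^T - tangent_proj U V Y.
have ND : normal_proj U V D = 0.
  rewrite /D normal_projB normal_proj_sign0 tangent_projE normal_projB.
  by rewrite normal_proj_idem// subrr subr0.
(* [Y] lives on the sample and [M] off it, so [frob Y M = 0]; this trades the pairing with [U V^T]
   for the certificate error and the normal part of [Y]. *)
have EM : frob (U *m V^T) M = frob D T - frob (normal_proj U V Y) N.
  have -> : frob D T = frob D M.
    rewrite /T tangent_projE frobBr -normal_proj_sym ND frob0l subr0//.
  have -> : frob (normal_proj U V Y) N = frob (normal_proj U V Y) M.
    by rewrite /N -normal_proj_sym normal_proj_idem.
  have YM : frob Y M = 0.
    rewrite frobE big1// => i _; rewrite big1// => j _.
    have [h|h] := boolP ((i, j) \in Omega); first by rewrite (M0 _ h) mulr0.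
    by rewrite (Ysupp _ h) mul0r.
  by rewrite /D frobBl tangent_projE frobBl YM; ring.
have YN := nuclear_norm_ge N Yc.
have sN : Num.sqrt (frob N N) <= nuclear_norm N.
  rewrite -(ger0_norm (nuclear_norm_ge0 N)) -sqrtr_sqr ler_sqrt ?sqr_ge0//.
  exact: frob_le_nuclear_norm.
have DT : `|frob D T| <= 1 / 4 * nuclear_norm N.
  apply: (@le_trans _ _ (\sum_(i < n) \sum_(j < n) delta * (K * nuclear_norm N))).
    rewrite frobE; apply: (le_trans (ler_norm_sum _ _ _)); apply: ler_sum => i _.
    apply: (le_trans (ler_norm_sum _ _ _)); apply: ler_sum => j _.
    rewrite normrM ler_pM ?Yd//; apply: (le_trans (inj _ M0 _ _)).
    by rewrite ler_wpM2l.
  rewrite sum_const_ord2 !mulrA.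
  by apply: ler_wpM2r dK; exact: nuclear_norm_ge0.
have N0 : nuclear_norm N <= 0 -> N = 0.
  move=> h; apply: frob_eq0; apply: le_trans (frob_le_nuclear_norm N) _.
  by have -> : nuclear_norm N = 0; [apply/le_anti; rewrite h nuclear_norm_ge0|rewrite expr0n].
(* Altogether [|A'|_* >= |A|_* + (1 - 1/4 - 1/2) |N|_*], with 1/4 lost to the certificate error and
   1/2 to the normal part of [Y]. *)
rewrite frobDl !frobDr EA WA WM EM => h.
have {}N0 : N = 0.
  apply: N0; move: h A'le; move: DT; rewrite ler_norml => /andP[]; lra.
suff M_0 : M = 0 by rewrite MA M_0 addr0.
rewrite -(tangentDnormal U V M) -/N N0 addr0; apply/matrixP => i j.
have := inj _ M0 i j; rewrite -/N N0 frob0r sqrtr0 mulr0 normr_le0 => /eqP ->.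
by rewrite mxE.
Qed.

End DualCertificate.

(** * Traces of matrix powers *)

Section TracePowers.
Variable R : realType.

(** After [x - y] is factored out, each of the [2k+1] remaining monomials of degree [2k] is at most
    [max(|x|, |y|)^(2k)]. *)
Lemma mean_value_odd_power (x y : R) k :
  (x - y) * (x ^+ k.*2.+1 - y ^+ k.*2.+1) <=
  k.*2.+1%:R * (x - y) ^+ 2 * (x ^+ k.*2 + y ^+ k.*2).
Proof.
rewrite subrXX mulrA -expr2 (mulrC _%:R) -[leRHS]mulrA.
rewrite ler_wpM2l ?sqr_ge0//.
have -> : k.*2.+1%:R * (x ^+ k.*2 + y ^+ k.*2) =
    \sum_(i < k.*2.+1) (x ^+ k.*2 + y ^+ k.*2).
  by rewrite sumr_const card_ord mulr_natl.
apply: ler_sum => i _ /=.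
apply: (le_trans (ler_norm _)); rewrite normrM !normrX.
have ev z : z ^+ k.*2 = `|z| ^+ k.*2 :> R.
  by rewrite -mul2n !exprM real_normK ?num_real.
have ik : (i <= k.*2)%N by rewrite -ltnS.
rewrite (ev x) (ev y); move: (normr_ge0 x) (normr_ge0 y) => {ev}.
move: (`|x|) (`|y|) => a b a0 b0.
have [ab|/ltW ba] := leP a b.
  apply: (@le_trans _ _ (b ^+ k.*2)); last by rewrite lerDr exprn_ge0.
  rewrite -[in leRHS](subnK ik) exprD ler_wpM2r ?exprn_ge0//.
  by apply: lerXn2r; rewrite ?nnegrE.
apply: (@le_trans _ _ (a ^+ k.*2)); last by rewrite lerDl exprn_ge0.
rewrite -[in leRHS](subnK ik) exprD ler_wpM2l ?exprn_ge0//.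
by apply: lerXn2r; rewrite ?nnegrE.
Qed.

Variable d : nat.
Implicit Types (X Y D G P Q : 'M[R]_d) (e f : 'rV[R]_d).

Definition mxpow X k : 'M[R]_d := iter k (mulmx X) 1%:M.

Lemma frob_spectral P e D k : P *m P^T = 1%:M ->
  frob D (mxpow (P^T *m diag_mx e *m P) k) =
  \sum_i e 0 i ^+ k * (P *m D *m P^T) i i.
Proof.
move=> PP.
have -> : mxpow (P^T *m diag_mx e *m P) k =
    P^T *m diag_mx (\row_i e 0 i ^+ k) *m P.
  elim: k => [|k IH].
    have -> : diag_mx (\row_i e 0 i ^+ 0) = 1%:M :> 'M[R]_d.
      by apply/matrixP => i j; rewrite !mxE expr0.
    by rewrite mulmx1 (mulmx1C PP).
  rewrite /mxpow /= -/(mxpow _ _) IH !mulmxA -(mulmxA _ P) PP mulmx1.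
  congr (_ *m _); rewrite -mulmxA; congr (_ *m _).
  apply/matrixP => i j; rewrite mul_diag_mx !mxE.
  by rewrite exprS mulrnAr.
rewrite frobC frob_mulr frob_mull trmxK mulmxA frobE.
apply: eq_bigr => i _; rewrite (bigD1 i)//= big1 ?addr0 => [|j ji].
  by rewrite mxE [X in X *+ _]mxE eqxx mulr1n.
by rewrite mxE eq_sym (negbTE ji) mulr0n mul0r.
Qed.

(** Even powers of [X] are positive semidefinite: in an eigenbasis of [X] the trace sees only the
    quadratic forms of [G1] and [G2] at eigenvectors, with nonnegative weights. *)
Lemma frob_mxpow_le G1 G2 X k : X^T = X ->
  (forall x : 'cV[R]_d, frob x (G1 *m x) <= frob x (G2 *m x)) ->
  frob G1 (mxpow X k.*2) <= frob G2 (mxpow X k.*2).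
Proof.
move=> symX G12; have [P [e [PP ->]]] := real_spectral symX.
rewrite !frob_spectral//; apply: ler_sum => i _.
have ev : 0 <= e 0 i ^+ k.*2 by rewrite -mul2n exprM exprn_ge0 ?sqr_ge0.
have diagE G : (P *m G *m P^T) i i = frob (col i P^T) (G *m col i P^T).
  rewrite -mulmxA mxE frobE; apply: eq_bigr => a _.
  by rewrite big_ord1 !mxE; congr (_ * _); apply: eq_bigr => b _; rewrite !mxE.
by rewrite ler_wpM2l// !diagE.
Qed.

(* In eigenbases [u_i] of [X] and [v_j] of [Y] the entries of [X - Y] are
   [(e_i - f_j) <u_i, v_j>], which reduces the claim to the scalar inequality. *)
Lemma trace_mean_value X Y k : X^T = X -> Y^T = Y ->
  frob (X - Y) (mxpow X k.*2.+1) - frob (X - Y) (mxpow Y k.*2.+1) <=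
  k.*2.+1%:R * (frob ((X - Y) *m (X - Y)) (mxpow X k.*2) +
                frob ((X - Y) *m (X - Y)) (mxpow Y k.*2)).
Proof.
move=> symX symY.
have [P [e [PP XE]]] := real_spectral symX.
have [Q [f [QQ YE]]] := real_spectral symY.
have [D DE] : exists D, D = X - Y by exists (X - Y).
have symD : D^T = D by rewrite DE linearB /= symX symY.
rewrite -DE XE YE !frob_spectral//.
have [C CE] : exists C, C = P *m Q^T by exists (P *m Q^T).
have DC i j : (P *m D *m Q^T) i j = (e 0 i - f 0 j) * C i j.
  have -> : P *m D *m Q^T = diag_mx e *m C - C *m diag_mx f.
    rewrite DE mulmxBr mulmxBl {1}XE {1}YE CE !mulmxA PP mul1mx.
    by rewrite -(mulmxA _ Q) QQ mulmx1.
  rewrite mxE [X in _ + X]mxE mul_diag_mx mul_mx_diag mxE [X in _ - X]mxE.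
  by rewrite mulrBl [f 0 j * _]mulrC.
have QtQ := mulmx1C QQ; have PtP := mulmx1C PP.
have PD i : (P *m D *m P^T) i i = \sum_j (e 0 i - f 0 j) * C i j ^+ 2.
  have -> : P *m D *m P^T = P *m D *m Q^T *m C^T.
    by rewrite CE trmx_mul trmxK mulmxA -(mulmxA _ Q^T) QtQ mulmx1.
  by rewrite mxE; apply: eq_bigr => j _; rewrite DC mxE expr2 mulrA.
have QD j : (Q *m D *m Q^T) j j = \sum_i (e 0 i - f 0 j) * C i j ^+ 2.
  have -> : Q *m D *m Q^T = C^T *m (P *m D *m Q^T).
    by rewrite CE trmx_mul trmxK !mulmxA -(mulmxA _ P^T) PtP mulmx1.
  by rewrite mxE; apply: eq_bigr => i _; rewrite DC mxE mulrC expr2 mulrA.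
have PDD i : (P *m (D *m D) *m P^T) i i = \sum_j (e 0 i - f 0 j) ^+ 2 * C i j ^+ 2.
  have -> : P *m (D *m D) *m P^T = P *m D *m Q^T *m (P *m D *m Q^T)^T.
    by rewrite !trmx_mul trmxK symD !mulmxA -(mulmxA _ Q^T) QtQ mulmx1.
  by rewrite mxE; apply: eq_bigr => j _; rewrite [_^T _ _]mxE DC -expr2 exprMn.
have QDD j : (Q *m (D *m D) *m Q^T) j j = \sum_i (e 0 i - f 0 j) ^+ 2 * C i j ^+ 2.
  have -> : Q *m (D *m D) *m Q^T = (P *m D *m Q^T)^T *m (P *m D *m Q^T).
    by rewrite !trmx_mul trmxK symD !mulmxA -(mulmxA _ P^T) PtP mulmx1.
  by rewrite mxE; apply: eq_bigr => i _; rewrite [_^T _ _]mxE DC -expr2 exprMn.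
have -> : \sum_i e 0 i ^+ k.*2.+1 * (P *m D *m P^T) i i =
    \sum_i \sum_j e 0 i ^+ k.*2.+1 * ((e 0 i - f 0 j) * C i j ^+ 2).
  by apply: eq_bigr => i _; rewrite PD mulr_sumr.
have -> : \sum_i f 0 i ^+ k.*2.+1 * (Q *m D *m Q^T) i i =
    \sum_i \sum_j f 0 j ^+ k.*2.+1 * ((e 0 i - f 0 j) * C i j ^+ 2).
  rewrite exchange_big; apply: eq_bigr => i _; rewrite QD mulr_sumr//.
have -> : \sum_i e 0 i ^+ k.*2 * (P *m (D *m D) *m P^T) i i =
    \sum_i \sum_j e 0 i ^+ k.*2 * ((e 0 i - f 0 j) ^+ 2 * C i j ^+ 2).
  by apply: eq_bigr => i _; rewrite PDD mulr_sumr.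
have -> : \sum_i f 0 i ^+ k.*2 * (Q *m (D *m D) *m Q^T) i i =
    \sum_i \sum_j f 0 j ^+ k.*2 * ((e 0 i - f 0 j) ^+ 2 * C i j ^+ 2).
  rewrite exchange_big; apply: eq_bigr => i _; rewrite QDD mulr_sumr//.
rewrite -sumrB -big_split /= mulr_sumr; apply: ler_sum => i _.
rewrite -sumrB -big_split /= mulr_sumr; apply: ler_sum => j _.
have := mean_value_odd_power (e 0 i) (f 0 j) k.
move: (e 0 i) (f 0 j) (C i j) => x y c h.
rewrite -mulrBl -mulrDl.
have -> : (x ^+ k.*2.+1 - y ^+ k.*2.+1) * ((x - y) * c ^+ 2) =
    (x - y) * (x ^+ k.*2.+1 - y ^+ k.*2.+1) * c ^+ 2.
  by rewrite [X in _ = X * _]mulrC mulrA.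
have -> : k.*2.+1%:R * ((x ^+ k.*2 + y ^+ k.*2) * ((x - y) ^+ 2 * c ^+ 2)) =
    k.*2.+1%:R * (x - y) ^+ 2 * (x ^+ k.*2 + y ^+ k.*2) * c ^+ 2.
  by move: (x ^+ k.*2) (y ^+ k.*2) => u v; ring.
by rewrite ler_wpM2r ?sqr_ge0.
Qed.

(** Eigenvalue by eigenvalue this is [2 a x <= x^2 / 2 + 2 a^2], multiplied by [x^(2k)]. It lets the
    next even moment absorb the odd one in the recursion. *)
Lemma trace_power_absorb X k a : X^T = X ->
  2 * a * \tr (mxpow X k.*2.+1) <=
  1 / 2 * \tr (mxpow X k.+1.*2) + 2 * a ^+ 2 * \tr (mxpow X k.*2).
Proof.
move=> symX; have [P [e [PP ->]]] := real_spectral symX.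
have trE m : \tr (mxpow (P^T *m diag_mx e *m P) m) = \sum_i e 0 i ^+ m.
  transitivity (frob 1%:M (mxpow (P^T *m diag_mx e *m P) m)).
    by rewrite /frob trmx1 mul1mx.
  rewrite frob_spectral// mulmx1 PP; apply: eq_bigr => i _.
  by rewrite mxE eqxx mulr1.
rewrite !trE !mulr_sumr -big_split; apply: ler_sum => i _ /=.
rewrite doubleS !(exprS (e 0 i)).
have : 0 <= e 0 i ^+ k.*2 by rewrite -mul2n exprM exprn_ge0 ?sqr_ge0.
have sq (u x : R) : 0 <= u ->
    2 * a * (x * u) <= 1 / 2 * (x * (x * u)) + 2 * a ^+ 2 * u.
  move=> u0; have := mulr_ge0 u0 (sqr_ge0 (x - 2 * a)); lra.
by move=> /sq.
Qed.

Lemma form_le_of_trace X p (tau : R) : X^T = X -> 0 <= tau -> (0 < p)%N ->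
  \tr (mxpow X p.*2) <= tau ^+ p.*2 ->
  forall x : 'cV[R]_d, `|frob x (X *m x)| <= tau * frob x x.
Proof.
move=> symX tau0 p0.
have [P [e [PP XE]]] := real_spectral symX; rewrite [in \tr _]XE.
have -> : \tr (mxpow (P^T *m diag_mx e *m P) p.*2) = \sum_i e 0 i ^+ p.*2.
  transitivity (frob 1%:M (mxpow (P^T *m diag_mx e *m P) p.*2)).
    by rewrite /frob trmx1 mul1mx.
  rewrite frob_spectral// mulmx1 PP; apply: eq_bigr => i _.
  by rewrite mxE eqxx mulr1.
move=> tr_le x.
have ev z : z ^+ p.*2 = `|z| ^+ p.*2 :> R.
  by rewrite -mul2n !exprM real_normK ?num_real.
have e_le i : `|e 0 i| <= tau.
  rewrite -(@ler_pXn2r _ p.*2) ?nnegrE ?double_gt0// -ev.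
  apply: le_trans tr_le; rewrite (bigD1 i)//= lerDl.
  by apply: sumr_ge0 => j _; rewrite ev exprn_ge0.
have PtP := mulmx1C PP.
have -> : frob x (X *m x) = \sum_i e 0 i * (P *m x) i 0 ^+ 2.
  rewrite XE -!mulmxA frobC frob_mull trmxK frobE.
  by apply: eq_bigr => i _; rewrite big_ord1 mul_diag_mx mxE -mulrA expr2.
have -> : frob x x = \sum_i (P *m x) i 0 ^+ 2.
  transitivity (frob (P *m x) (P *m x)).
    by rewrite frob_mull mulmxA PtP mul1mx.
  by rewrite frobE; apply: eq_bigr => i _; rewrite big_ord1 expr2.
rewrite mulr_sumr; apply: (le_trans (ler_norm_sum _ _ _)); apply: ler_sum => i _.
by rewrite normrM [`|_ ^+ 2|]ger0_norm ?sqr_ge0// ler_wpM2r ?sqr_ge0.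
Qed.

End TracePowers.

(** * A matrix Chernoff bound *)

Section Average.
Variable R : realType.

(** Expectation for the uniform law on [T]; probabilities appear as averages of indicators. *)
Definition avg (T : finType) (F : T -> R) : R := (\sum_x F x) / #|T|%:R.

Lemma eq_avg (T : finType) (F G : T -> R) : F =1 G -> avg F = avg G.
Proof. by move=> FG; rewrite /avg; congr (_ / _); apply: eq_bigr. Qed.

Lemma avg_le (T : finType) (F G : T -> R) : (forall x, F x <= G x) -> avg F <= avg G.
Proof.
by move=> FG; rewrite /avg ler_wpM2r ?invr_ge0//; apply: ler_sum.
Qed.

Lemma avgD (T : finType) (F G : T -> R) : avg (fun x => F x + G x) = avg F + avg G.
Proof. by rewrite /avg big_split mulrDl. Qed.

Lemma avgZ (T : finType) c (F : T -> R) : avg (fun x => c * F x) = c * avg F.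
Proof. by rewrite /avg -mulr_sumr mulrA. Qed.

Lemma avgB (T : finType) (F G : T -> R) : avg (fun x => F x - G x) = avg F - avg G.
Proof. by rewrite /avg sumrB mulrBl. Qed.

Lemma avg_const (T : finType) c : (0 < #|T|)%N -> avg (fun _ : T => c) = c.
Proof.
by move=> T0; rewrite /avg sumr_const -[_ *+ _]mulr_natr mulfK// pnatr_eq0 -lt0n.
Qed.

Lemma avg_ge0 (T : finType) (F : T -> R) : (forall x, 0 <= F x) -> 0 <= avg F.
Proof. by move=> F0; rewrite /avg divr_ge0// sumr_ge0. Qed.

Lemma avg_sum (T I : finType) (F : I -> T -> R) :
  avg (fun x => \sum_i F i x) = \sum_i avg (F i).
Proof. by rewrite /avg exchange_big /= mulr_suml. Qed.

Lemma avg_exchange (T U : finType) (F : T -> U -> R) :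
  avg (fun x => avg (F x)) = avg (fun y => avg (fun x => F x y)).
Proof.
rewrite /avg -!mulr_suml exchange_big /= mulrAC.
by congr (_ / _); rewrite -mulr_suml.
Qed.

Lemma avg_reindex (T : finType) (h : T -> T) (F : T -> R) :
  injective h -> avg (F \o h) = avg F.
Proof. by move=> hI; rewrite /avg [in RHS](reindex_inj hI). Qed.

Lemma avg_pair (T U : finType) (F : T -> U -> R) :
  avg (fun x => avg (F x)) = avg (fun p : T * U => F p.1 p.2).
Proof. by rewrite /avg -mulr_suml pair_big card_prod natrM invfM mulrA mulrAC. Qed.

Lemma avg_markov (T : finType) (P : pred T) (F : T -> R) c : 0 < c ->
  (forall x, 0 <= F x) -> (forall x, P x -> c <= F x) ->
  avg (fun x => (P x)%:R) <= avg F / c.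
Proof.
move=> c0 F0 PF; rewrite mulrC -avgZ; apply: avg_le => x.
case: (boolP (P x)) => [/PF h|_]; last by rewrite mulr_ge0// invr_ge0 ltW.
by rewrite mulrC ler_pdivlMr// mulr1n mul1r.
Qed.

Definition fupd (t : nat) (T : finType) (w : {ffun 'I_t -> T}) s z : {ffun 'I_t -> T} :=
  [ffun i => if i == s then z else w i].

(** Exchangeability: swapping the [s]-th draw with the fresh draw [z] is an involution on pairs. *)
Lemma avg_swap (t : nat) (T : finType) s (F : {ffun 'I_t -> T} -> T -> R) :
  avg (fun w => avg (fun z => F (fupd w s z) (w s))) = avg (fun w => avg (F w)).
Proof.
rewrite !avg_pair.
pose h (p : {ffun 'I_t -> T} * T) := (fupd p.1 s p.2, p.1 s).
apply: (avg_reindex (h := h) (fun p => F p.1 p.2)).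
apply: (can_inj (g := h)) => -[w z]; rewrite /h /= ffunE eqxx; congr (_, _).
by apply/ffunP => i; rewrite !ffunE; case: eqP => // ->.
Qed.

End Average.

(** * Moments of sums of independent positive semidefinite matrices *)

Section MatrixChernoff.
Variables (R : realType) (T : finType) (d t : nat) (A : T -> 'M[R]_d) (L V : R).
Hypothesis T_gt0 : (0 < #|T|)%N.
Hypothesis symA : forall x, (A x)^T = A x.
Hypothesis L_ge0 : 0 <= L.
(** As quadratic forms, [A^2 <= L A]: the spectrum of each summand lies in [[0, L]]. Hence [V], a
    bound on the mean of the sum, also controls its variance by [L V]. *)
Hypothesis sqA : forall x v, frob (A x *m v) (A x *m v) <= L * frob v (A x *m v :> 'cV_d).

Let Abar : 'M[R]_d := (#|T|%:R)^-1 *: \sum_x A x.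

Hypothesis meanA : forall v : 'cV[R]_d, t%:R * frob v (Abar *m v) <= V * frob v v.

Definition centered_sum (w : {ffun 'I_t -> T}) : 'M[R]_d :=
  \sum_s (A (w s) - (#|T|%:R)^-1 *: \sum_x A x).

Let S := centered_sum.

Lemma trmx_centered_sum w : (S w)^T = S w.
Proof.
rewrite /S /centered_sum linear_sum; apply: eq_bigr => s _.
rewrite linearB /= symA linearZ /= linear_sum; congr (_ - _ *: _).
by apply: eq_bigr => x _; exact: symA.
Qed.

Lemma avg_frobl (Z : 'M[R]_d) : avg (fun x => frob (A x) Z) = frob Abar Z.
Proof. by rewrite /avg /Abar frobZl frob_suml mulrC. Qed.

Lemma centered_sum_fupd w s z : S w - S (fupd w s z) = A (w s) - A z.
Proof.
rewrite /S /centered_sum -sumrB (bigD1 s)//= [X in _ + X]big1 ?addr0 => [|i is_].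
  by rewrite ffunE eqxx opprB addrA subrK.
by rewrite ffunE (negbTE is_) subrr.
Qed.

(** [(X - Z)^2 <= 2 X^2 + 2 Z^2 <= 2 L (X + Z)] as quadratic forms, tested against a positive
    semidefinite power. *)
Lemma sq_diff_le x z k w :
  frob ((A x - A z) *m (A x - A z)) (mxpow (S w) k.*2) <=
  2 * L * (frob (A x) (mxpow (S w) k.*2) + frob (A z) (mxpow (S w) k.*2)).
Proof.
rewrite -frobDl -frobZl; apply: frob_mxpow_le; first exact: trmx_centered_sum.
move=> v; have symD : (A x - A z)^T = A x - A z by rewrite linearB /= !symA.
have -> : frob v ((A x - A z) *m (A x - A z) *m v) =
    frob ((A x - A z) *m v) ((A x - A z) *m v).
  by rewrite frob_mull symD mulmxA.
have := frob_ge0 ((A x + A z) *m v); have := sqA x v; have := sqA z v.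
rewrite !mulmxBl !mulmxDl -!scalemxAl frobZr mulmxDl frobDr.
rewrite !(frobBl, frobDl) !(frobBr, frobDr).
rewrite (frobC (A z *m v) (A x *m v)); lra.
Qed.

(* Resampling the [s]-th draw leaves the law invariant, and the antisymmetric part
   of the summand is a difference of powers of two sums that differ by one term. *)
Lemma centered_sum_moment_step k :
  avg (fun w : {ffun 'I_t -> T} => \tr (mxpow (S w) k.+1.*2)) <=
  k.*2.+1%:R * (2 * L) *
  (avg (fun w : {ffun 'I_t -> T} => \tr (mxpow (S w) k.*2.+1)) + 2 * V * avg (fun w : {ffun 'I_t -> T} => \tr (mxpow (S w) k.*2))).
Proof.
have trS w m : \tr (mxpow (S w) m.+1) = frob (S w) (mxpow (S w) m).
  by rewrite /frob trmx_centered_sum.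
have sumS w Z : frob (S w) Z = \sum_s (frob (A (w s)) Z - frob Abar Z).
  by rewrite /S /centered_sum frob_suml; apply: eq_bigr => s _; rewrite frobBl.
have step s : avg (fun w : {ffun 'I_t -> T} => frob (A (w s)) (mxpow (S w) k.*2.+1) - frob Abar (mxpow (S w) k.*2.+1))
    <= k.*2.+1%:R * (2 * L) *
    avg (fun w : {ffun 'I_t -> T} => frob (A (w s)) (mxpow (S w) k.*2) + frob Abar (mxpow (S w) k.*2)).
  pose F (w : {ffun 'I_t -> T}) z := frob (A (w s) - A z) (mxpow (S w) k.*2.+1).
  pose G (w : {ffun 'I_t -> T}) z :=
    frob ((A (w s) - A z) *m (A (w s) - A z)) (mxpow (S w) k.*2).
  have FE : avg (fun w : {ffun 'I_t -> T} => frob (A (w s)) (mxpow (S w) k.*2.+1) - frob Abar (mxpow (S w) k.*2.+1))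
      = avg (fun w : {ffun 'I_t -> T} => avg (F w)).
    apply: eq_avg => w; rewrite -avg_frobl -[X in X - _](avg_const _ T_gt0) -avgB.
    by apply: eq_avg => z; rewrite /F frobBl.
  have FG w z : F w z + F (fupd w s z) (w s) <= k.*2.+1%:R * (G w z + G (fupd w s z) (w s)).
    rewrite /F /G ffunE eqxx.
    have := trace_mean_value k (trmx_centered_sum w) (trmx_centered_sum (fupd w s z)).
    rewrite centered_sum_fupd.
    rewrite -(opprB (A (w s)) (A z)) frobNl mulNmx mulmxN opprK.
    by [].
  have FG2 : avg (fun w : {ffun 'I_t -> T} => avg (F w)) <= k.*2.+1%:R * avg (fun w : {ffun 'I_t -> T} => avg (G w)).
    have : avg (fun w : {ffun 'I_t -> T} => avg (fun z => F w z + F (fupd w s z) (w s))) <=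
        avg (fun w : {ffun 'I_t -> T} => avg (fun z => k.*2.+1%:R * (G w z + G (fupd w s z) (w s)))).
      by apply: avg_le => w; apply: avg_le => z.
    under eq_avg => w do rewrite avgD.
    under [X in _ <= X]eq_avg => w do rewrite avgZ avgD.
    rewrite avgD avgZ avgD !avg_swap; lra.
  rewrite FE; apply: (le_trans FG2); rewrite -mulrA ler_wpM2l//.
  rewrite -avgZ; apply: avg_le => w.
  rewrite -avg_frobl -[X in 2 * L * (X + _)](avg_const _ T_gt0) -avgD -avgZ.
  by apply: avg_le => z; apply: sq_diff_le.
have -> : avg (fun w : {ffun 'I_t -> T} => \tr (mxpow (S w) k.+1.*2)) = \sum_s
    avg (fun w : {ffun 'I_t -> T} => frob (A (w s)) (mxpow (S w) k.*2.+1) - frob Abar (mxpow (S w) k.*2.+1)).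
  by rewrite -avg_sum; apply: eq_avg => w; rewrite doubleS trS sumS.
apply: (le_trans (ler_sum _ (fun s _ => step s))).
rewrite -mulr_sumr ler_wpM2l ?mulr_ge0//.
rewrite -avg_sum -avgZ -avgD; apply: avg_le => w.
(* The draws add up to [S + t Abar]: [S] produces the odd moment, and the hypothesis on the mean
   turns [2 t Abar] into [2 V]. *)
have -> : \sum_s (frob (A (w s)) (mxpow (S w) k.*2) + frob Abar (mxpow (S w) k.*2)) =
    \tr (mxpow (S w) k.*2.+1) + 2 * frob (t%:R *: Abar) (mxpow (S w) k.*2).
  rewrite trS sumS sumrB big_split /= !sumr_const !card_ord frobZl -mulr_natl; ring.
rewrite lerD2l -mulrA ler_wpM2l//.
have -> : V * \tr (mxpow (S w) k.*2) = frob (V *: 1%:M) (mxpow (S w) k.*2).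
  by rewrite frobZl /frob trmx1 mul1mx.
apply: frob_mxpow_le; first exact: trmx_centered_sum.
by move=> v; rewrite -(scalemxAl t%:R) -(scalemxAl V) !frobZr mul1mx; exact: meanA.
Qed.

(** With [a = (2k+1) L], absorbing the odd moment leaves [M2 <= (4 a^2 + 8 a V) M0]. Since [a <= V]
    and [a <= 2 p L], the factor is at most [12 a V <= 24 p L V]. *)
Lemma centered_sum_moment p k : (k <= p)%N -> 2 * p%:R * L <= V ->
  avg (fun w : {ffun 'I_t -> T} => \tr (mxpow (S w) k.*2)) <= d%:R * (24 * p%:R * L * V) ^+ k.
Proof.
move=> kp pLV; elim: k kp => [|k IH] kp.
  rewrite expr0 mulr1 /mxpow /= (avg_const (\tr 1%:M : R)) ?mxtrace1//.
  by rewrite card_ffun expn_gt0 T_gt0.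
have := centered_sum_moment_step k.
set a : R := k.*2.+1%:R * L.
have a0 : 0 <= a by rewrite mulr_ge0.
have aV : a <= V.
  apply: le_trans pLV; rewrite ler_wpM2r// -natrM ler_nat mul2n.
  by rewrite (leq_trans _ (_ : k.+1.*2 <= _)%N) ?leq_double// doubleS.
have ap : a <= 2 * p%:R * L.
  rewrite ler_wpM2r// -natrM ler_nat mul2n.
  by rewrite (leq_trans _ (_ : k.+1.*2 <= _)%N) ?leq_double// doubleS.
have absorb : 2 * a * avg (fun w : {ffun 'I_t -> T} => \tr (mxpow (S w) k.*2.+1)) <=
    1 / 2 * avg (fun w : {ffun 'I_t -> T} => \tr (mxpow (S w) k.+1.*2)) +
    2 * a ^+ 2 * avg (fun w : {ffun 'I_t -> T} => \tr (mxpow (S w) k.*2)).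
  rewrite -!avgZ -avgD; apply: avg_le => w.
  exact: trace_power_absorb (trmx_centered_sum w).
set M2 := avg (fun w : {ffun 'I_t -> T} => \tr (mxpow (S w) k.+1.*2)) in absorb *.
set M1 := avg (fun w : {ffun 'I_t -> T} => \tr (mxpow (S w) k.*2.+1)) in absorb *.
set M0 := avg (fun w : {ffun 'I_t -> T} => \tr (mxpow (S w) k.*2)) in absorb IH *.
move=> stp.
have {}stp : M2 <= 2 * a * M1 + 4 * a * V * M0.
  by apply: (le_trans stp); rewrite le_eqVlt; apply/orP; left; apply/eqP; rewrite /a; ring.
have M00 : 0 <= M0.
  apply: avg_ge0 => w.
  have -> : \tr (mxpow (S w) k.*2) = frob 1%:M (mxpow (S w) k.*2).
    by rewrite /frob trmx1 mul1mx.
  rewrite -(frob0l (mxpow (S w) k.*2)); apply: frob_mxpow_le; first exact: trmx_centered_sum.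
  by move=> v; rewrite mul0mx frob0r mul1mx frob_ge0.
have {IH} IH := IH (ltnW kp).
have h : M2 <= 24 * p%:R * L * V * M0.
  have h1 : M2 <= (4 * a ^+ 2 + 8 * a * V) * M0 by lra.
  apply: (le_trans h1); apply: ler_wpM2r => //.
  have V0 : 0 <= V by exact: le_trans a0 aV.
  have := ler_wpM2l a0 aV; have := ler_wpM2r V0 ap.
  rewrite expr2; lra.
apply: (le_trans h); rewrite exprS [leRHS]mulrCA; apply: ler_wpM2l => //.
have V0 : 0 <= V by exact: le_trans a0 aV.
by rewrite !mulr_ge0.
Qed.

(* A matrix Chernoff bound without the matrix exponential: even moments of the
   spectrum are controlled by exchangeable pairs. *)
Theorem matrix_chernoff p (tau : R) : (0 < p)%N -> 2 * p%:R * L <= V -> 0 < tau ->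
  96 * p%:R * L * V <= tau ^+ 2 ->
  avg (fun w : {ffun 'I_t -> T} => (~~ `[< forall x : 'cV[R]_d, `|frob x (S w *m x)| <= tau * frob x x >])%:R : R) <=
  d%:R / 4 ^+ p.
Proof.
move=> p0 pLV tau0 htau.
have tr_ge0 w : 0 <= \tr (mxpow (S w) p.*2).
  have -> : \tr (mxpow (S w) p.*2) = frob 1%:M (mxpow (S w) p.*2).
    by rewrite /frob trmx1 mul1mx.
  rewrite -(frob0l (mxpow (S w) p.*2)); apply: frob_mxpow_le; first exact: trmx_centered_sum.
  by move=> v; rewrite mul0mx frob0r mul1mx frob_ge0.
have taup : 0 < tau ^+ p.*2 by rewrite exprn_gt0.
apply: le_trans (avg_markov taup tr_ge0 _) _ => [w|].
  apply: contraNT; rewrite -ltNge => /ltW h; apply/asboolP.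
  exact: form_le_of_trace (trmx_centered_sum w) (ltW tau0) p0 h.
(* Here [96 = 4 * 24]: Markov's inequality at [tau^(2p)] gains [4^p] over the moment bound. *)
rewrite ler_pdivrMr//; apply: (le_trans (centered_sum_moment (leqnn p) pLV)).
rewrite -[leRHS]mulrA ler_wpM2l// -mul2n exprM [leRHS]mulrC ler_pdivlMr ?exprn_gt0//.
rewrite -exprMn.
have V0 : 0 <= V by apply: le_trans pLV; rewrite !mulr_ge0.
apply: lerXn2r; rewrite ?nnegrE ?sqr_ge0 ?mulr_ge0//.
by apply: le_trans htau; rewrite le_eqVlt; apply/orP; left; apply/eqP; ring.
Qed.

End MatrixChernoff.

(** * Sampling with replacement *)

Section Bernstein.
Variable R : realType.

Lemma expR_le_quadratic (x : R) : `|x| <= 1 / 4 -> expR x <= 1 + x + x ^+ 2.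
Proof.
rewrite ler_norml => /andP[x1 x2].
have inv (y : R) : y < 1 -> expR y <= (1 - y)^-1.
  move=> y1; have y0 : 0 < 1 - y by lra.
  rewrite -[expR y]invrK -expRN lef_pV2 ?posrE ?expR_gt0//.
  by have := expR_ge1Dx (- y).
have [x0|x0] := leP x 0.
  have x1' : 0 < 1 - x by lra.
  apply: (le_trans (inv x _)); first by lra.
  rewrite -[leLHS]mul1r ler_pdivrMr//.
  have : 0 <= - x * x ^+ 2 by rewrite mulr_ge0 ?sqr_ge0//; lra.
  by lra.
(* For [x > 0] the bound [1 / (1 - x)] exceeds the quadratic, so it is applied to [x / 2] and
   squared. *)
have h : expR (x / 2) <= (1 - x / 2)^-1 by apply: inv; lra.
have -> : expR x = expR (x / 2) ^+ 2.
  by rewrite expr2 -expRD -splitr.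
apply: (@le_trans _ _ ((1 - x / 2)^-1 ^+ 2)).
  by apply: lerXn2r; rewrite ?nnegrE ?expR_ge0 ?invr_ge0//; lra.
have x3 : 0 < (1 - x / 2) ^+ 2 by rewrite exprn_gt0//; lra.
rewrite exprVn -[leLHS]mul1r ler_pdivrMr//.
have : 0 <= x ^+ 2 * (1 - 3 * x + x ^+ 2).
  by rewrite mulr_ge0 ?sqr_ge0//; have := sqr_ge0 x; lra.
by rewrite !expr2; lra.
Qed.

Lemma avg_prod (T : finType) t (h : T -> R) :
  avg (fun w : {ffun 'I_t -> T} => \prod_s h (w s)) = avg h ^+ t.
Proof.
rewrite /avg -(bigA_distr_bigA (fun _ => h)) prodr_const card_ord.
by rewrite card_ffun card_ord natrX expr_div_n.
Qed.

(** Exponential Markov inequality with a free [lambda]. The condition [8 lambda M <= 1] keeps each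
    exponent within 1/4, the range of the quadratic bound on [expR]. *)
Lemma bernstein_upper (T : finType) t (g : T -> R) (M sigma2 lambda delta : R) :
  (0 < #|T|)%N -> (forall x, `|g x| <= M) -> avg (fun x => g x ^+ 2) <= sigma2 ->
  0 <= lambda -> 8 * lambda * M <= 1 ->
  avg (fun w : {ffun 'I_t -> T} => (delta < \sum_s (g (w s) - avg g))%R%:R : R) <=
  expR (- (lambda * delta) + t%:R * (lambda ^+ 2 * sigma2)).
Proof.
move=> T0 gM gs lam0 lamM.
pose m := avg g; rewrite -/m.
have mM : `|m| <= M.
  rewrite ler_norml; apply/andP; split.
    rewrite -[- M](avg_const _ T0); apply: avg_le => x.
    by have := gM x; rewrite ler_norml => /andP[].
  rewrite -[M](avg_const _ T0); apply: avg_le => x.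
  by have := gM x; rewrite ler_norml => /andP[].
have mgf : avg (fun x => expR (lambda * (g x - m))) <= expR (lambda ^+ 2 * sigma2).
  apply: (@le_trans _ _ (avg (fun x => 1 + lambda * (g x - m) + (lambda * (g x - m)) ^+ 2))).
    apply: avg_le => x; apply: expR_le_quadratic.
    rewrite normrM (ger0_norm lam0).
    have : `|g x - m| <= 2 * M.
      by apply: (le_trans (ler_normB _ _)); have := gM x; lra.
    by move=> /(ler_wpM2l lam0); lra.
  apply: le_trans (expR_ge1Dx _).
  have -> : avg (fun x => 1 + lambda * (g x - m) + (lambda * (g x - m)) ^+ 2) =
      1 + lambda ^+ 2 * (avg (fun x => g x ^+ 2) - m ^+ 2).
    rewrite avgD avgD (avg_const _ T0) avgZ avgB (avg_const _ T0) -/m subrr mulr0 addr0.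
    congr (_ + _); transitivity (avg (fun x => lambda ^+ 2 * (g x ^+ 2 + (- 2 * m * g x + m ^+ 2)))).
      by apply: eq_avg => x; ring.
    by rewrite avgZ avgD avgD avgZ (avg_const _ T0) -/m; ring.
  rewrite lerD2l ler_wpM2l ?sqr_ge0//; apply: le_trans gs.
  by rewrite gerBl sqr_ge0.
pose F (w : {ffun 'I_t -> T}) := expR (lambda * \sum_s (g (w s) - m)).
have FE w : F w = \prod_s expR (lambda * (g (w s) - m)).
  by rewrite /F mulr_sumr expR_sum.
have h : avg F <= expR (t%:R * (lambda ^+ 2 * sigma2)).
  rewrite (eq_avg FE) (avg_prod t (fun x => expR (lambda * (g x - m)))).
  rewrite expRM_natl; apply: lerXn2r => //; rewrite nnegrE ?expR_ge0//.
  by apply: avg_ge0 => x; exact: expR_ge0.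
apply: le_trans (avg_markov (expR_gt0 (lambda * delta)) (fun w => expR_ge0 _) _ : _ <= avg F / _) _.
  by move=> w /ltW d; rewrite ler_expR ler_wpM2l.
rewrite -expRN mulrC expRD ler_wpM2l ?expR_ge0//.
Qed.

Lemma bernstein (T : finType) t (g : T -> R) (M sigma2 lambda delta : R) :
  (0 < #|T|)%N -> (forall x, `|g x| <= M) -> avg (fun x => g x ^+ 2) <= sigma2 ->
  0 <= lambda -> 8 * lambda * M <= 1 ->
  avg (fun w : {ffun 'I_t -> T} => (delta < `|\sum_s (g (w s) - avg g)|)%R%:R : R) <=
  2 * expR (- (lambda * delta) + t%:R * (lambda ^+ 2 * sigma2)).
Proof.
move=> T0 gM gs lam0 lamM.
have h1 := bernstein_upper t delta T0 gM gs lam0 lamM.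
have avgN : avg (fun x => - g x) = - avg g by rewrite /avg sumrN mulNr.
have gM' x : `|- g x| <= M by rewrite normrN.
have gs' : avg (fun x => (- g x) ^+ 2) <= sigma2.
  by apply: le_trans gs; apply: avg_le => x; rewrite sqrrN.
have h2 := bernstein_upper t delta T0 gM' gs' lam0 lamM.
rewrite mulr2n mulrDl mul1r; apply: le_trans (lerD h1 h2); rewrite -avgD.
apply: avg_le => w; rewrite avgN.
have -> : \sum_s (- g (w s) - - avg g) = - \sum_s (g (w s) - avg g).
  by rewrite -sumrN; apply: eq_bigr => s _; rewrite opprB opprK addrC.
rewrite lter_normr; do 2 case: (_ < _); rewrite ?mulr0n ?mulr1n; lra.
Qed.

End Bernstein.

(** * Concentration of the rescaled sampling operator *)

Section Sampling.
Variables (R : realType) (n t : nat).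
Hypotheses (n_gt0 : (0 < n)%N) (t_gt0 : (0 < t)%N).

Notation pos := ('I_n * 'I_n)%type.

(** Scaled so that its mean is [Z]; a position drawn several times counts with multiplicity. *)
Definition sampling (w : {ffun 'I_t -> pos}) (Z : 'M[R]_n) : 'M[R]_n :=
  (n%:R ^+ 2 / t%:R) *: \sum_s Z (w s).1 (w s).2 *: delta_mx (w s).1 (w s).2.

Lemma card_pos : #|{: pos}| = (n ^ 2)%N.
Proof. by rewrite card_prod card_ord mulnn. Qed.

Lemma card_pos_gt0 : (0 < #|{: pos}|)%N.
Proof. by rewrite card_pos expn_gt0 n_gt0. Qed.

Lemma frob_pair (G Z : 'M[R]_n) : frob G Z = \sum_(p : pos) G p.1 p.2 * Z p.1 p.2.
Proof. by rewrite frobE pair_big. Qed.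

Lemma frob_sampling w (G Z : 'M[R]_n) : frob G (sampling w Z) =
  n%:R ^+ 2 / t%:R * \sum_s G (w s).1 (w s).2 * Z (w s).1 (w s).2.
Proof.
rewrite /sampling frobZr frob_sumr; congr (_ * _); apply: eq_bigr => s _.
by rewrite frobZr frobC frob_deltal mulrC.
Qed.

Lemma sampling_frob_concentration (G Z : 'M[R]_n) (rho kappa eps : R) (p : nat) :
  0 < rho -> 0 < kappa -> 0 < eps -> eps <= 1 ->
  (forall i j, `|G i j| <= rho) -> frob G G <= rho ->
  (forall i j, `|Z i j| <= kappa) ->
  10 * p%:R * rho * n%:R ^+ 2 <= t%:R * eps ^+ 2 ->
  avg (fun w => (eps * kappa < `|frob G (Z - sampling w Z)|)%R%:R : R) <= 2 * expR (- p%:R).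
Proof.
move=> rho0 kap0 eps0 eps1 Grho GG Zk tp.
have n0 : 0 < n%:R :> R by rewrite ltr0n.
have t0 : 0 < t%:R :> R by rewrite ltr0n.
pose g (x : pos) := G x.1 x.2 * Z x.1 x.2.
have gM x : `|g x| <= rho * kappa by rewrite normrM ler_pM.
have gs : avg (fun x => g x ^+ 2) <= rho * kappa ^+ 2 / n%:R ^+ 2.
  rewrite /avg card_pos natrX ler_pM2r ?invr_gt0 ?exprn_gt0//.
  apply: le_trans (ler_wpM2r (sqr_ge0 kappa) GG).
  rewrite frob_pair mulr_suml; apply: ler_sum => x _.
  rewrite exprMn expr2 ler_wpM2l -?expr2 ?sqr_ge0//.
  by rewrite -[Z _ _ ^+ 2]real_normK ?num_real// lerXn2r ?nnegrE// ltW.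
(* This [lambda] makes [8 lambda M = eps], and the exponent becomes [-(7/64) t eps^2 / (rho n^2)];
   the constant 10 in the hypothesis brings it below [-p]. *)
have lam0 : 0 <= eps / (8 * rho * kappa) by rewrite divr_ge0 ?ltW ?mulr_gt0.
have lamM : 8 * (eps / (8 * rho * kappa)) * (rho * kappa) <= 1.
  by have -> : 8 * (eps / (8 * rho * kappa)) * (rho * kappa) = eps by field; rewrite !gt_eqF.
have := bernstein t (eps * kappa * t%:R / n%:R ^+ 2) card_pos_gt0 gM gs lam0 lamM.
set lhs := avg _; set rhs := 2 * expR _ => h.
apply: (@le_trans _ _ lhs).
  rewrite le_eqVlt; apply/orP; left; apply/eqP; apply: eq_avg => w.
  congr ((_ : bool)%:R).
  have -> : frob G (Z - sampling w Z) =
      - (n%:R ^+ 2 / t%:R * \sum_s (g (w s) - avg g)).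
    rewrite frobBr frob_sampling sumrB sumr_const card_ord -[avg g *+ t]mulr_natl /avg card_pos natrX.
    by rewrite frob_pair -/(g _); field; rewrite !gt_eqF.
  rewrite normrN normrM ger0_norm ?divr_ge0 ?exprn_ge0 ?ltW//.
  rewrite -[eps * kappa * _ / _]mulrA -[RHS](@ltr_pM2l _ (n%:R ^+ 2 / t%:R)) ?divr_gt0 ?exprn_gt0//.
  by congr (_ < _); field; rewrite !gt_eqF.
apply: (le_trans h); rewrite /rhs ler_pM2l// ler_expR.
have -> : - (eps / (8 * rho * kappa) * (eps * kappa * t%:R / n%:R ^+ 2)) +
    t%:R * ((eps / (8 * rho * kappa)) ^+ 2 * (rho * kappa ^+ 2 / n%:R ^+ 2)) =
    - (7 / 64 * (t%:R * eps ^+ 2 / (rho * n%:R ^+ 2))) by field; rewrite !gt_eqF.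
have : 10 * p%:R <= t%:R * eps ^+ 2 / (rho * n%:R ^+ 2).
  by rewrite ler_pdivlMr ?mulr_gt0 ?exprn_gt0// mulrA.
by have : 0 <= p%:R :> R by []; lra.
Qed.

Definition psd_summand kappa (Z : 'M[R]_n) (x : pos) : 'M[R]_(n + n) :=
  block_mx (kappa *: delta_mx x.1 x.1) (Z x.1 x.2 *: delta_mx x.1 x.2)
           (Z x.1 x.2 *: delta_mx x.2 x.1) (kappa *: delta_mx x.2 x.2).

Lemma frob_col_mx m (a c : 'cV[R]_m) (b e : 'cV[R]_m) :
  frob (col_mx a b) (col_mx c e) = frob a c + frob b e.
Proof. by rewrite /frob tr_col_mx mul_row_col mxtraceD. Qed.

Lemma delta_mulmx_col (i j : 'I_n) (v : 'cV[R]_n) :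
  delta_mx i j *m v = v j 0 *: delta_mx i 0.
Proof.
apply/matrixP => k l; rewrite !mxE (bigD1 j)//= big1 ?addr0 => [|a aj].
  by rewrite !mxE !ord1 !eqxx !andbT mulrC.
by rewrite mxE (negbTE aj) andbF mul0r.
Qed.

Lemma psd_summand_mul kappa (Z : 'M[R]_n) x (u v : 'cV[R]_n) :
  psd_summand kappa Z x *m col_mx u v =
  col_mx ((kappa * u x.1 0 + Z x.1 x.2 * v x.2 0) *: delta_mx x.1 0)
         ((Z x.1 x.2 * u x.1 0 + kappa * v x.2 0) *: delta_mx x.2 0).
Proof.
rewrite /psd_summand mul_block_col -!scalemxAl !delta_mulmx_col !scalerA.
by rewrite -!scalerDl.
Qed.

Lemma psd_summand_form kappa (Z : 'M[R]_n) x (u v : 'cV[R]_n) :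
  frob (col_mx u v) (psd_summand kappa Z x *m col_mx u v) =
  kappa * u x.1 0 ^+ 2 + 2 * (Z x.1 x.2 * u x.1 0 * v x.2 0) + kappa * v x.2 0 ^+ 2.
Proof.
rewrite psd_summand_mul frob_col_mx !frobZr !(frobC _ (delta_mx _ _)) !frob_deltal.
ring.
Qed.

Lemma trmx_psd_summand kappa (Z : 'M[R]_n) x :
  (psd_summand kappa Z x)^T = psd_summand kappa Z x.
Proof. by rewrite /psd_summand tr_block_mx !linearZ /= !trmx_delta. Qed.

(** The nontrivial eigenvalues are [kappa - z] and [kappa + z], in [[0, 2 kappa]]; this fixes
    [L = 2 kappa]. *)
Lemma psd_summand_sq kappa (Z : 'M[R]_n) x (v : 'cV[R]_(n + n)) :
  `|Z x.1 x.2| <= kappa ->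
  frob (psd_summand kappa Z x *m v) (psd_summand kappa Z x *m v) <=
  2 * kappa * frob v (psd_summand kappa Z x *m v).
Proof.
move=> zk; rewrite -[v]vsubmxK; move: (usubmx v) (dsubmx v) => {v} a b.
rewrite psd_summand_form psd_summand_mul frob_col_mx !frobZr !frobZl.
rewrite !frob_deltal !mxE !eqxx /= !mulr1.
have k0 : 0 <= kappa by apply: le_trans zk.
have : 0 <= kappa ^+ 2 - Z x.1 x.2 ^+ 2.
  by rewrite subr_ge0 -[Z _ _ ^+ 2]real_normK ?num_real// lerXn2r// nnegrE.
move: (Z x.1 x.2) (a x.1 0) (b x.2 0) => z p q h.
have := mulr_ge0 h (addr_ge0 (sqr_ge0 p) (sqr_ge0 q)).
lra.
Qed.

(** Each form is at most [2 kappa (a_i^2 + b_j^2)], and averaging over all positions gives every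
    squared coordinate the weight [1 / n]. *)
Lemma psd_summand_mean kappa (Z : 'M[R]_n) (v : 'cV[R]_(n + n)) :
  (forall i j, `|Z i j| <= kappa) ->
  frob v (((#|{: pos}|%:R)^-1 *: \sum_x psd_summand kappa Z x) *m v) <=
  2 * kappa / n%:R * frob v v.
Proof.
move=> Zk; have n0 : 0 < n%:R :> R by rewrite ltr0n.
rewrite -[v]vsubmxK; move: (usubmx v) (dsubmx v) => {v} a b.
rewrite -scalemxAl frobZr mulmx_suml frob_sumr frob_col_mx card_pos natrX.
have -> : 2 * kappa / n%:R * (frob a a + frob b b) = (n%:R ^+ 2)^-1 *
    \sum_(x : pos) 2 * kappa * (a x.1 0 ^+ 2 + b x.2 0 ^+ 2).
  rewrite -mulr_sumr -(pair_big predT predT (fun i j => a i 0 ^+ 2 + b j 0 ^+ 2))/=.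
  have -> : \sum_i \sum_j (a i 0 ^+ 2 + b j 0 ^+ 2) = n%:R * (frob a a + frob b b).
    have frobE1 (c : 'cV[R]_n) : frob c c = \sum_i c i 0 ^+ 2.
      by rewrite frobE; apply: eq_bigr => i _; rewrite big_ord1 expr2.
    rewrite (eq_bigr (fun i => n%:R * a i 0 ^+ 2 + frob b b)) => [|i _].
      by rewrite big_split /= -mulr_sumr sumr_const card_ord -[frob b b *+ n]mulr_natl -frobE1 mulrDr.
    by rewrite big_split /= sumr_const card_ord -[_ *+ n]mulr_natl -frobE1.
  by field; rewrite gt_eqF.
rewrite ler_wpM2l ?invr_ge0 ?sqr_ge0//; apply: ler_sum => x _.
rewrite psd_summand_form.
have := Zk x.1 x.2; move: (Z x.1 x.2) (a x.1 0) (b x.2 0) => z p q.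
rewrite ler_norml => /andP[h1 h2].
have h3 : 0 <= kappa - z by rewrite subr_ge0.
have h4 : 0 <= kappa + z by lra.
have := mulr_ge0 h3 (sqr_ge0 (p + q)); have := mulr_ge0 h4 (sqr_ge0 (p - q)).
lra.
Qed.

(** The diagonal blocks are the same for [Z] and [- Z] and cancel, leaving only the sampling
    error. *)
Lemma centered_psd_form kappa (Z : 'M[R]_n) (w : {ffun 'I_t -> pos}) (u v : 'cV[R]_n) :
  let Q Z := frob (col_mx u v) (centered_sum (psd_summand kappa Z) w *m col_mx u v) in
  Q Z - Q (- Z) = 4 * (t%:R / n%:R ^+ 2) * frob u ((sampling w Z - Z) *m v).
Proof.
have n0 : 0 < n%:R :> R by rewrite ltr0n.
have t0 : 0 < t%:R :> R by rewrite ltr0n.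
have QE Y : frob (col_mx u v) (centered_sum (psd_summand kappa Y) w *m col_mx u v) =
    \sum_s frob (col_mx u v) (psd_summand kappa Y (w s) *m col_mx u v) -
    t%:R / n%:R ^+ 2 * \sum_x frob (col_mx u v) (psd_summand kappa Y x *m col_mx u v).
  rewrite /centered_sum sumrB sumr_const card_ord mulmxBl frobBr mulmx_suml frob_sumr.
  congr (_ - _); rewrite -scaler_nat -!scalemxAl !frobZr mulmx_suml frob_sumr.
  by rewrite card_pos natrX mulrA.
have dQ x : frob (col_mx u v) (psd_summand kappa Z x *m col_mx u v) -
    frob (col_mx u v) (psd_summand kappa (- Z) x *m col_mx u v) =
    4 * ((u *m v^T) x.1 x.2 * Z x.1 x.2).
  rewrite !psd_summand_form [(- Z) _ _]mxE [(u *m v^T) _ _]mxE big_ord1 [v^T _ _]mxE; ring.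
have dsum (I : finType) (f : I -> pos) :
    \sum_i frob (col_mx u v) (psd_summand kappa Z (f i) *m col_mx u v) =
    \sum_i frob (col_mx u v) (psd_summand kappa (- Z) (f i) *m col_mx u v) +
    4 * \sum_i (u *m v^T) (f i).1 (f i).2 * Z (f i).1 (f i).2.
  by rewrite mulr_sumr -big_split; apply: eq_bigr => i _ /=; rewrite -dQ addrC subrK.
have -> : frob u ((sampling w Z - Z) *m v) = frob (u *m v^T) (sampling w Z - Z).
  by rewrite frob_mulr trmxK.
rewrite /= !QE (dsum _ w) (dsum _ id) frobBr frob_sampling frob_pair.
by field; rewrite !gt_eqF.
Qed.

(* [[kappa, z], [z, kappa]] is positive semidefinite for [|z| <= kappa], so the
   dilation of [Z] is half the difference of two sums of such blocks. *)
Lemma sampling_op_concentration (Z : 'M[R]_n) (kappa tau : R) (p : nat) :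
  0 < kappa -> 0 < tau -> (forall i j, `|Z i j| <= kappa) -> (0 < p)%N ->
  2 * p%:R * n%:R <= t%:R :> R ->
  384 * p%:R * n%:R ^+ 3 <= tau ^+ 2 * t%:R ->
  avg (fun w => (~~ `[< op_bound (sampling w Z - Z) (tau * kappa) >])%:R : R) <=
  4 * n%:R / 4 ^+ p.
Proof.
move=> kap0 tau0 Zk p0 tpn htau.
have n0 : 0 < n%:R :> R by rewrite ltr0n.
have t0 : 0 < t%:R :> R by rewrite ltr0n.
(* The Chernoff bound runs on sums without the factor [n^2 / t], hence the scaling of [tau']. With
   [L = 2 kappa], [384 = 96 * 2 * 2]; two signs in dimension [2 n] give [4 n]. *)
pose V := 2 * kappa * t%:R / n%:R; pose tau' := tau * kappa * t%:R / n%:R ^+ 2.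
have tau'0 : 0 < tau' by rewrite divr_gt0 ?exprn_gt0// !mulr_gt0.
have pV : 2 * p%:R * (2 * kappa) <= V.
  rewrite /V ler_pdivlMr//; have := ler_wpM2l (ltW kap0) tpn; lra.
have htau' : 96 * p%:R * (2 * kappa) * V <= tau' ^+ 2.
  have -> : 96 * p%:R * (2 * kappa) * V = 384 * p%:R * n%:R ^+ 3 * (kappa ^+ 2 * t%:R / n%:R ^+ 4).
    by rewrite /V; field; rewrite gt_eqF.
  have -> : tau' ^+ 2 = tau ^+ 2 * t%:R * (kappa ^+ 2 * t%:R / n%:R ^+ 4).
    by rewrite /tau'; field; rewrite gt_eqF.
  by rewrite ler_wpM2r// divr_ge0 ?exprn_ge0 ?mulr_ge0 ?exprn_ge0 ?ltW.
pose good (Y : 'M[R]_n) (w : {ffun 'I_t -> pos}) := `[< forall x : 'cV[R]_(n + n),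
  `|frob x (centered_sum (psd_summand kappa Y) w *m x)| <= tau' * frob x x >].
have chernoff (Y : 'M[R]_n) : (forall i j, `|Y i j| <= kappa) ->
    avg (fun w => (~~ good Y w)%:R : R) <= (n + n)%:R / 4 ^+ p.
  move=> Yk; apply: (@matrix_chernoff _ _ _ _ _ (2 * kappa) V) => //.
  - exact: card_pos_gt0.
  - exact: trmx_psd_summand.
  - by rewrite mulr_ge0// ltW.
  - by move=> x v; exact: psd_summand_sq.
  - move=> v; apply: (le_trans (ler_wpM2l (ler0n _ t) (psd_summand_mean v Yk))).
    rewrite le_eqVlt; apply/orP; left; apply/eqP; rewrite /V; field.
    by rewrite gt_eqF.
have Nk i j : `|(- Z) i j| <= kappa by rewrite mxE normrN.
have := lerD (chernoff Z Zk) (chernoff (- Z) Nk); rewrite -avgD.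
have -> : (n + n)%:R / 4 ^+ p + (n + n)%:R / 4 ^+ p = 4 * n%:R / 4 ^+ p :> R.
  by rewrite natrD; field; rewrite ?expf_neq0 ?pnatr_eq0.
apply: le_trans; apply: avg_le => w.
have [_|nb] := boolP `[< op_bound _ _ >]; first by rewrite mulr0n addr_ge0.
have [/asboolP h1|_] := boolP (good Z w); last by rewrite mulr1n lerDl.
have [/asboolP h2|_] := boolP (good (- Z) w); last by rewrite mulr1n lerDr.
exfalso; apply: (negP nb); apply/asboolP => u v.
have Qd := centered_psd_form kappa Z w u v; rewrite /= in Qd.
have := h1 (col_mx u v); have := h2 (col_mx u v).
rewrite frob_col_mx; move: (frob _ (centered_sum _ _ *m _)) Qd.
move: (frob _ (centered_sum _ _ *m _)) => Q1 Q2 Qd.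
rewrite !ler_norml => /andP[l2 _] /andP[_ u1].
have tn : 0 < 2 * (t%:R / n%:R ^+ 2) :> R by rewrite mulr_gt0// divr_gt0// exprn_gt0.
rewrite -(ler_pM2l tn) [leLHS]mulrA.
have -> : 2 * (t%:R / n%:R ^+ 2) * 2 * frob u ((sampling w Z - Z) *m v) = Q2 - Q1.
  by rewrite Qd; field; rewrite gt_eqF.
have -> : 2 * (t%:R / n%:R ^+ 2) * (tau * kappa * (frob u u + frob v v)) =
    2 * (tau' * (frob u u + frob v v)).
  by rewrite /tau'; field; rewrite gt_eqF.
by move: l2 u1; move: (tau' * _) => y; clear; lra.
Qed.

End Sampling.

(** * The golfing scheme *)

Section IteratedAverage.
Variables (R : realType) (W : finType).

(** Expectation over [k] independent batches, nested so that the first batch can be fixed before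
    averaging over the rest. *)
Fixpoint avgs k (F : seq W -> R) : R :=
  if k is k'.+1 then avg (fun w => avgs k' (fun ws => F (w :: ws))) else F [::].

Lemma avgs_le k (F G : seq W -> R) :
  (forall ws, size ws = k -> F ws <= G ws) -> avgs k F <= avgs k G.
Proof.
elim: k F G => [|k IH] F G FG /=; first exact: FG.
by apply: avg_le => w; apply: IH => ws sws; apply: FG; rewrite /= sws.
Qed.

Lemma eq_avgs k (F G : seq W -> R) : F =1 G -> avgs k F = avgs k G.
Proof.
elim: k F G => [|k IH] F G FG /=; first exact: FG.
by apply: eq_avg => w; apply: IH => ws; apply: FG.
Qed.

Lemma avgs_sum k (I : finType) (F : I -> seq W -> R) :
  avgs k (fun ws => \sum_i F i ws) = \sum_i avgs k (F i).
Proof.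
elim: k F => [//|k IH] F /=; rewrite -avg_sum; apply: eq_avg => w.
exact: (IH (fun i ws => F i (w :: ws))).
Qed.

Lemma avgsD k (F G : seq W -> R) :
  avgs k (fun ws => F ws + G ws) = avgs k F + avgs k G.
Proof.
elim: k F G => [//|k IH] F G /=; rewrite -avgD; apply: eq_avg => w.
exact: (IH (fun ws => F (w :: ws))).
Qed.

Lemma avgs_exchange k (T : finType) (F : seq W -> T -> R) :
  avgs k (fun ws => avg (F ws)) = avg (fun x => avgs k (fun ws => F ws x)).
Proof.
elim: k F => [//|k IH] F /=; rewrite avg_exchange; apply: eq_avg => w.
exact: (IH (fun ws => F (w :: ws))).
Qed.

Lemma avgs_const k c : (0 < #|W|)%N -> avgs k (fun _ => c) = c.
Proof.
move=> W0; elim: k => [//|k IH] /=; rewrite -[RHS](avg_const c W0).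
by apply: eq_avg => w; exact: IH.
Qed.

End IteratedAverage.

(** * Deterministic consequences of a good chain of batches *)

Section Golfing.
Variables (R : realType) (n r t : nat) (U V : 'M[R]_(n, r)).
Hypotheses (n_gt0 : (0 < n)%N) (t_gt0 : (0 < t)%N).
Hypotheses (UU : U^T *m U = 1%:M) (VV : V^T *m V = 1%:M).

Notation pos := ('I_n * 'I_n)%type.
Notation batch := {ffun 'I_t -> pos}.
Notation T := (tangent_proj U V).

(** When [T Z = Z] this is the tangent part of the sampling error [Z - sampling w Z]. *)
Definition golf_step (w : batch) (Z : 'M[R]_n) : 'M[R]_n := Z - T (sampling w Z).

Fixpoint residual (Z : 'M[R]_n) (ws : seq batch) : 'M[R]_n :=
  if ws is w :: ws' then residual (golf_step w Z) ws' else Z.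

Fixpoint certificate (Z : 'M[R]_n) (ws : seq batch) : 'M[R]_n :=
  if ws is w :: ws' then sampling w Z + certificate (golf_step w Z) ws' else 0.

Definition positions (ws : seq batch) : {set pos} :=
  [set p | has (fun w : batch => [exists s, w s == p]) ws]%SET.

Variables (eps tau : R).

Fixpoint good_chain (Z : 'M[R]_n) (kappa : R) (ws : seq batch) : Prop :=
  if ws is w :: ws' then
    [/\ forall i j, `|golf_step w Z i j| <= eps * kappa,
        op_bound (sampling w Z - Z) (tau * kappa)
      & good_chain (golf_step w Z) (eps * kappa) ws']
  else True.

Lemma tangent_projD X Y : T (X + Y) = T X + T Y.
Proof. by have := tangent_projB U V (X + Y) Y; rewrite addrK => ->; rewrite subrK. Qed.

Lemma normal_projD X Y : normal_proj U V (X + Y) = normal_proj U V X + normal_proj U V Y.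
Proof. by have := normal_projB U V (X + Y) Y; rewrite addrK => ->; rewrite subrK. Qed.

Lemma tangent_golf_step w Z : T Z = Z -> T (golf_step w Z) = golf_step w Z.
Proof. by move=> TZ; rewrite /golf_step tangent_projB TZ tangent_proj_idem. Qed.

(** Telescoping: each batch contributes [T (sampling w Z) = Z - golf_step w Z]. *)
Lemma tangent_certificate Z ws : T (certificate Z ws) = Z - residual Z ws.
Proof.
elim: ws Z => [|w ws IH] Z /=.
  by rewrite subrr /tangent_proj !(mulmx0, mul0mx) addr0 subrr.
by rewrite tangent_projD IH /golf_step addrA addrCA subrr addr0.
Qed.

Lemma certificate_support Z ws p : p \notin positions ws -> certificate Z ws p.1 p.2 = 0.
Proof.
elim: ws Z => [|w ws IH] Z /=; first by rewrite mxE.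
rewrite inE /= negb_or => /andP[pw pws]; rewrite mxE IH ?inE// addr0.
rewrite /sampling mxE summxE big1 ?mulr0// => s _; rewrite !mxE.
have [e1|] := eqVneq p.1 (w s).1; last by rewrite mulr0.
have [e2|] := eqVneq p.2 (w s).2; last by rewrite mulr0.
case/existsP: pw; exists s; apply/eqP.
by rewrite [RHS]surjective_pairing e1 e2 -surjective_pairing.
Qed.

Lemma residual_le Z kappa ws : good_chain Z kappa ws ->
  (forall i j, `|Z i j| <= kappa) ->
  forall i j, `|residual Z ws i j| <= eps ^+ size ws * kappa.
Proof.
elim: ws Z kappa => [|w ws IH] Z kappa /=; first by rewrite expr0 mul1r.
move=> [gw _ gws] _ i j; apply: (le_trans (IH _ _ gws gw i j)).
by rewrite exprSr mulrA.
Qed.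

Lemma op_boundD (X Y : 'M[R]_n) a b :
  op_bound X a -> op_bound Y b -> op_bound (X + Y) (a + b).
Proof.
move=> Xa Yb x y; rewrite mulmxDl frobDr mulrDr [leRHS]mulrDl.
by apply: lerD; [exact: Xa|exact: Yb].
Qed.

Lemma op_bound_mono (X : 'M[R]_n) a b : a <= b -> op_bound X a -> op_bound X b.
Proof.
move=> ab Xa x y; apply: le_trans (Xa x y) _.
by apply: ler_wpM2r => //; rewrite addr_ge0 ?frob_ge0.
Qed.

Hypotheses (eps_ge0 : 0 <= eps) (eps_half : eps <= 1 / 2) (tau_ge0 : 0 <= tau).

(** A tangent [Z] has no normal part, so [sampling w Z] and the error [sampling w Z - Z] have the
    same one. The bounds [tau kappa eps^l] sum to at most [2 tau kappa]. *)
Lemma certificate_op_bound Z kappa ws : 0 <= kappa -> T Z = Z ->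
  good_chain Z kappa ws -> op_bound (normal_proj U V (certificate Z ws)) (2 * tau * kappa).
Proof.
elim: ws Z kappa => [|w ws IH] Z kappa k0 TZ /=.
  move=> _ x y; rewrite /normal_proj mulmx0 !mul0mx frob0r mulr0.
  by rewrite !mulr_ge0 ?addr_ge0 ?frob_ge0.
move=> [gw gop gws].
have ek0 : 0 <= eps * kappa by rewrite mulr_ge0.
have h := IH _ _ ek0 (tangent_golf_step w TZ) gws.
have NZ : normal_proj U V Z = 0.
  by apply: (addrI Z); rewrite -{1}TZ tangentDnormal addr0.
have NE : normal_proj U V (sampling w Z + certificate (golf_step w Z) ws) =
    normal_proj U V (sampling w Z - Z) + normal_proj U V (certificate (golf_step w Z) ws).
  by rewrite normal_projB NZ subr0 normal_projD.
rewrite NE; apply: op_bound_mono (op_boundD (op_bound_normal_proj UU VV _ gop) h); last first.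
  by rewrite mulr_ge0.
have := ler_wpM2r (mulr_ge0 tau_ge0 k0) eps_half; lra.
Qed.

Lemma frob_sampling_le (w : batch) (Z N : 'M[R]_n) kappa : (forall i j, `|Z i j| <= kappa) ->
  `|frob (sampling w Z) N| <= n%:R ^+ 2 * kappa * Num.sqrt (frob N N).
Proof.
move=> Zk; have t0 : 0 < t%:R :> R by rewrite ltr0n.
rewrite frobC frob_sampling normrM ger0_norm ?divr_ge0 ?exprn_ge0//.
have -> : n%:R ^+ 2 * kappa * Num.sqrt (frob N N) =
    n%:R ^+ 2 / t%:R * (t%:R * (kappa * Num.sqrt (frob N N))).
  by field; rewrite gt_eqF.
rewrite ler_wpM2l ?divr_ge0 ?exprn_ge0//; apply: (le_trans (ler_norm_sum _ _ _)).
have -> : t%:R * (kappa * Num.sqrt (frob N N)) = \sum_(s < t) kappa * Num.sqrt (frob N N).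
  by rewrite sumr_const card_ord mulr_natl.
apply: ler_sum => s _.
rewrite normrM mulrC ler_pM//.
by rewrite -sqrtr_sqr ler_sqrt ?frob_ge0// sqr_entry_le_frob.
Qed.

(** A worst-case bound along a good chain; its factor [n^2] ends up in the injectivity constant,
    where the tiny final residual compensates for it. *)
Lemma frob_certificate_le (Z : 'M[R]_n) (kappa : R) ws (N : 'M[R]_n) : 0 <= kappa ->
  (forall i j, `|Z i j| <= kappa) -> good_chain Z kappa ws ->
  `|frob (certificate Z ws) N| <= 2 * n%:R ^+ 2 * kappa * Num.sqrt (frob N N).
Proof.
elim: ws Z kappa => [|w ws IH] Z kappa k0 Zk /=.
  by move=> _; rewrite frob0l normr0 !mulr_ge0 ?sqr_ge0 ?sqrtr_ge0.
move=> [gw gop gws].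
have ek0 : 0 <= eps * kappa by rewrite mulr_ge0.
rewrite frobDl; apply: (le_trans (ler_normD _ _)).
apply: (le_trans (lerD (frob_sampling_le w N Zk) (IH _ _ ek0 gw gws))).
have c0 : 0 <= n%:R ^+ 2 * kappa * Num.sqrt (frob N N).
  by rewrite !mulr_ge0 ?sqr_ge0 ?sqrtr_ge0.
have := ler_wpM2r c0 eps_half; lra.
Qed.

Lemma frob_le_l1 (X Y : 'M[R]_n) c : (forall i j, `|X i j| <= c) ->
  `|frob X Y| <= c * \sum_i \sum_j `|Y i j|.
Proof.
move=> Xc; rewrite frobE mulr_sumr; apply: (le_trans (ler_norm_sum _ _ _)).
apply: ler_sum => i _; rewrite mulr_sumr; apply: (le_trans (ler_norm_sum _ _ _)).
by apply: ler_sum => j _; rewrite normrM ler_wpM2r.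
Qed.

(** For [D = T (delta_mx i j)] the squared norm is the entry [x = D i j]. Hence [x^2 <= x], so
    [x <= 1], and every squared entry is at most [x]. *)
Lemma tangent_delta_le1 i j a b : `|T (delta_mx i j) a b| <= 1.
Proof.
set D := T _; pose x := D i j.
have DD : frob D D = x.
  by rewrite {1}/D tangent_proj_sym// tangent_proj_idem// frob_deltal.
have x2 : x ^+ 2 <= x by rewrite -{2}DD sqr_entry_le_frob.
have x1 : x <= 1.
  by rewrite leNgt; apply/negP => x1; move: x2; rewrite expr2; nra.
rewrite -(@ler_pXn2r _ 2)// ?nnegrE// expr1n real_normK ?num_real//.
by apply: le_trans x1; rewrite -DD sqr_entry_le_frob.
Qed.

(* Pairing [M] with the certificates of all [P_T (e_i e_j^T)] bounds the entrywise
   sum [S] of [P_T M] by [S / 2] plus a multiple of the normal part. *)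
Lemma tangent_injectivity ws (M : 'M[R]_n) :
  (forall i j, good_chain (T (delta_mx i j)) 1 ws) ->
  2 * n%:R ^+ 2 * eps ^+ size ws <= 1 ->
  (forall p, p \in positions ws -> M p.1 p.2 = 0) ->
  forall i j, `|T M i j| <=
    4 * n%:R ^+ 4 * Num.sqrt (frob (normal_proj U V M) (normal_proj U V M)).
Proof.
move=> gws epsn M0; set N := normal_proj U V M.
pose S := \sum_i \sum_j `|T M i j|.
have S0 : 0 <= S by apply: sumr_ge0 => i _; apply: sumr_ge0.
have entry i j : `|T M i j| <= eps ^+ size ws * S + 2 * n%:R ^+ 2 * Num.sqrt (frob N N).
  pose D := T (delta_mx i j); pose Y := certificate D ws.
  have YM : frob Y M = 0.
    rewrite frob_pair big1// => p _.
    have [h|h] := boolP (p \in positions ws); first by rewrite (M0 _ h) mulr0.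
    by rewrite (certificate_support _ h) mul0r.
  have TMij : T M i j = frob (residual D ws) (T M) - frob Y N.
    have -> : T M i j = frob D (T M).
      by rewrite /D tangent_proj_sym// tangent_proj_idem// frob_deltal.
    have e1 : frob Y (T M) + frob Y N = 0 by rewrite -frobDr tangentDnormal.
    have e2 : frob Y (T M) = frob D (T M) - frob (residual D ws) (T M).
      by rewrite -frobBl -tangent_certificate tangent_proj_sym// tangent_proj_idem.
    by move: e1; rewrite e2; lra.
  rewrite TMij; apply: (le_trans (ler_normB _ _)); apply: lerD.
    apply: frob_le_l1 => a b; rewrite -[X in _ <= X]mulr1.
    by apply: residual_le (gws i j) _ _ _ => a' b'; exact: tangent_delta_le1.
  have := @frob_certificate_le D 1 ws N ler01 _ (gws i j).
  by rewrite mulr1; apply => a b; exact: tangent_delta_le1.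
have S_le : S <= 4 * n%:R ^+ 4 * Num.sqrt (frob N N).
  have : S <= n%:R ^+ 2 * (eps ^+ size ws * S + 2 * n%:R ^+ 2 * Num.sqrt (frob N N)).
    by rewrite -sum_const_ord2; apply: ler_sum => i _; apply: ler_sum => j _.
  have := ler_wpM2r S0 epsn.
  have -> : n%:R ^+ 4 = n%:R ^+ 2 * n%:R ^+ 2 :> R by rewrite -exprD.
  move: (n%:R ^+ 2) (eps ^+ _) (Num.sqrt _) => a b c; lra.
move=> i j; apply: le_trans S_le; rewrite /S (bigD1 i)//= (bigD1 j)//= -addrA lerDl.
by rewrite addr_ge0 ?sumr_ge0// => k _; rewrite sumr_ge0.
Qed.

End Golfing.

(** * Probability that the batches form good chains *)

Section GolfingProbability.
Variables (R : realType) (n t p : nat) (A : 'M[R]_n) (rho eps tau : R).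
Hypotheses (n_gt0 : (0 < n)%N) (t_gt0 : (0 < t)%N) (p_gt0 : (0 < p)%N).

Notation pos := ('I_n * 'I_n)%type.
Notation batch := {ffun 'I_t -> pos}.
Notation U := (left_singular_vectors A).
Notation V := (right_singular_vectors A).
Notation T := (tangent_proj U V).

Hypotheses (eps_gt0 : 0 < eps) (eps_half : eps <= 1 / 2) (tau_gt0 : 0 < tau).

Let UU := left_singular_vectors_orthonormal A.
Let VV := right_singular_vectors_orthonormal A.

Definition unique_minimizer (Omega : {set pos}) : Prop :=
  forall A' : 'M[R]_n, agree_on Omega A' A -> nuclear_norm A' <= nuclear_norm A -> A' = A.

Lemma good_chain_unique_minimizer ws kappa :
  0 <= kappa -> kappa <= 1 -> (forall i j, `|(U *m V^T) i j| <= kappa) ->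
  2 * tau * kappa <= 1 / 2 -> 16 * n%:R ^+ 6 * eps ^+ size ws <= 1 ->
  good_chain U V eps tau (U *m V^T) kappa ws ->
  (forall i j, good_chain U V eps tau (T (delta_mx i j)) 1 ws) ->
  unique_minimizer (positions (ws : seq batch)).
Proof.
move=> k0 k1 Ek tauk epsn gE gD A'.
have n1 : 1 <= n%:R :> R by rewrite ler1n.
have ek0 : 0 <= eps ^+ size ws by rewrite exprn_ge0// ltW.
have TE : T (U *m V^T) = U *m V^T.
  by rewrite tangent_projE normal_proj_sign0 subr0.
apply: (@certificate_unique_minimizer _ _ _ _ (certificate U V (U *m V^T) ws)
  (eps ^+ size ws * kappa) (4 * n%:R ^+ 4)).
- by move=> q; exact: certificate_support.
- apply: op_bound_mono (certificate_op_bound UU VV (ltW eps_gt0) eps_half (ltW tau_gt0) k0 TE gE).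
  exact: tauk.
- by move=> i j; rewrite tangent_certificate// subKr; exact: residual_le gE Ek i j.
- move=> M M0; apply: (tangent_injectivity _ _ _ _ _ gD _ M0) => //; first exact: ltW.
  apply: le_trans epsn; apply: ler_wpM2r => //.
  have : n%:R ^+ 2 <= n%:R ^+ 6 :> R by apply: ler_weXn2l.
  by have := sqr_ge0 (n%:R : R); lra.
- by rewrite mulr_ge0 ?exprn_ge0.
- by rewrite mulr_ge0.
(* The certificate error over [n^2] entries meets the injectivity constant [4 n^4], and their
   product must stay below 1/4: hence the factor [16 n^6]. *)
- have -> : n%:R ^+ 2 * (eps ^+ size ws * kappa) * (4 * n%:R ^+ 4) =
    kappa * (16 * n%:R ^+ 6 * eps ^+ size ws) / 4 by field.
  rewrite ler_pM2r ?invr_gt0//; apply: le_trans k1; rewrite -[leRHS]mulr1.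
  by rewrite ler_wpM2l.
Qed.

Hypothesis rhoP : 0 < rho.
Hypothesis frob_tangent_delta : forall i j,
  frob (T (delta_mx i j)) (T (delta_mx i j)) <= rho.
Hypothesis t_contract : 10 * p%:R * rho * n%:R ^+ 2 <= t%:R * eps ^+ 2.
Hypothesis t_large : 2 * p%:R * n%:R <= t%:R :> R.
Hypothesis t_op : 384 * p%:R * n%:R ^+ 3 <= tau ^+ 2 * t%:R.

(* Bernstein's inequality for [n ^ 2] entries, and the matrix Chernoff bound in
   dimension [2 n] for both signs of the dilation. *)
Definition step_failure : R := 2 * n%:R ^+ 2 * expR (- p%:R) + 4 * n%:R / 4 ^+ p.

Lemma step_failure_ge0 : 0 <= step_failure.
Proof. by rewrite addr_ge0// ?divr_ge0 ?mulr_ge0 ?exprn_ge0 ?expR_ge0. Qed.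

(** These entries are themselves inner products of two projected units, so Cauchy-Schwarz lets [rho]
    serve as entry bound as well as squared-norm bound. *)
Lemma tangent_delta_entry i j a b : `|T (delta_mx i j) a b| <= rho.
Proof.
rewrite -(@ler_pXn2r _ 2)// ?nnegrE ?(ltW rhoP)// real_normK ?num_real//.
have -> : T (delta_mx i j) a b = frob (T (delta_mx a b)) (T (delta_mx i j)).
  by rewrite tangent_proj_sym// tangent_proj_idem// frob_deltal.
apply: (le_trans (frob_CS _ _)); rewrite expr2.
by rewrite ler_pM ?frob_ge0.
Qed.

(** Entry [(i, j)] of the step is the pairing of [T (delta_mx i j)] with the sampling error, to
    which Bernstein's inequality applies; a union bound adds the operator event. *)
Lemma golf_step_prob Z kappa : 0 < kappa -> T Z = Z -> (forall i j, `|Z i j| <= kappa) ->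
  avg (fun w : batch =>
    (~~ `[< (forall i j, `|golf_step U V w Z i j| <= eps * kappa) /\
            op_bound (sampling w Z - Z) (tau * kappa) >])%:R : R) <= step_failure.
Proof.
move=> k0 TZ Zk.
have eps1 : eps <= 1.
  by apply: (le_trans eps_half); rewrite ler_pdivrMr// mul1r ler1n.
have entry i j : avg (fun w : batch => (eps * kappa < `|golf_step U V w Z i j|)%R%:R : R) <=
    2 * expR (- p%:R).
  have := @sampling_frob_concentration R n t n_gt0 t_gt0 (T (delta_mx i j)) Z rho kappa eps p
    rhoP k0 eps_gt0 eps1 (tangent_delta_entry i j) (frob_tangent_delta i j) Zk t_contract.
  apply: le_trans; rewrite le_eqVlt; apply/orP; left; apply/eqP; apply: eq_avg => w.
  by rewrite /golf_step -{1}TZ -tangent_projB -frob_deltal -tangent_proj_sym.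
have op := sampling_op_concentration n_gt0 t_gt0 k0 tau_gt0 Zk p_gt0 t_large t_op.
have -> : step_failure = \sum_(i < n) \sum_(j < n) 2 * expR (- p%:R) + 4 * n%:R / 4 ^+ p.
  by rewrite sum_const_ord2 /step_failure; congr (_ + _); ring.
apply: le_trans (lerD (ler_sum _ (fun i _ => ler_sum _ (fun j _ => entry i j))) op).
under eq_bigr => i _ do rewrite -avg_sum.
rewrite -avg_sum -avgD; apply: avg_le => w.
have [_|nb] := boolP `[< _ /\ _ >].
  by rewrite mulr0n addr_ge0// sumr_ge0// => i _; rewrite sumr_ge0.
have [/asboolP gop|_] := boolP `[< op_bound _ _ >]; last first.
  by rewrite lerDr sumr_ge0// => i _; rewrite sumr_ge0.
have [/forallP gw|] := boolP [forall i, forall j, `|golf_step U V w Z i j| <= eps * kappa].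
  exfalso; apply: (negP nb); apply/asboolP; split => // i j.
  by move/forallP: (gw i); apply.
rewrite negb_forall => /existsP[a]; rewrite negb_forall => /existsP[b].
rewrite -ltNge => h; rewrite mulr0n addr0 (bigD1 a)//= (bigD1 b)//= h.
by rewrite -addrA lerDl addr_ge0 ?sumr_ge0// => k' _; rewrite sumr_ge0.
Qed.

Lemma card_batch_gt0 : (0 < #|{: batch}|)%N.
Proof. by rewrite card_ffun expn_gt0 card_pos_gt0. Qed.

(** If the first batch succeeds, the new residual is again tangent, with entry bound [eps * kappa],
    and the later batches are independent of it; otherwise the failure is charged to the first
    batch. *)
Lemma good_chain_prob Z kappa k : 0 < kappa -> T Z = Z -> (forall i j, `|Z i j| <= kappa) ->
  avgs k (fun ws : seq batch => (~~ `[< good_chain U V eps tau Z kappa ws >])%:R : R) <=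
  k%:R * step_failure.
Proof.
elim: k Z kappa => [|k IH] Z kappa k0 TZ Zk /=.
  by rewrite mul0r; case: asboolP.
rewrite -natr1 mulrDl mul1r addrC.
rewrite -[X in _ <= _ + X](avg_const _ card_batch_gt0).
apply: le_trans (lerD (golf_step_prob k0 TZ Zk) (lexx _)); rewrite -avgD.
apply: avg_le => w.
have [/asboolP [gw gop]|_] := boolP `[< _ /\ _ >].
  rewrite mulr0n add0r.
  apply: le_trans (IH _ _ (mulr_gt0 eps_gt0 k0) (tangent_golf_step UU VV w TZ) gw).
  apply: avgs_le => ws _; case: asboolP => // ng.
  by case: asboolP => // g; exfalso; apply: ng.
rewrite mulr1n -[leLHS]addr0; apply: lerD; last by rewrite mulr_ge0 ?step_failure_ge0.
rewrite -[leRHS](avgs_const k 1 card_batch_gt0); apply: avgs_le => ws _.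
by case: asboolP.
Qed.

(** The certificates of [U V^T] and of the [n^2] projected units share the same batches, whence a
    union bound over [1 + n^2] chains. *)
Theorem golfing k kappa : 0 < kappa -> kappa <= 1 ->
  (forall i j, `|(U *m V^T) i j| <= kappa) ->
  2 * tau * kappa <= 1 / 2 -> 16 * n%:R ^+ 6 * eps ^+ k <= 1 ->
  avgs k (fun ws : seq batch => (~~ `[< unique_minimizer (positions ws) >])%:R : R) <=
  (1 + n%:R ^+ 2) * (k%:R * step_failure).
Proof.
move=> k0 k1 Ek tauk epsn.
have TE : T (U *m V^T) = U *m V^T.
  by rewrite tangent_projE normal_proj_sign0 subr0.
have h1 := good_chain_prob k k0 TE Ek.
have h2 i j := good_chain_prob k ltr01 (tangent_proj_idem UU VV (delta_mx i j))
  (tangent_delta_le1 UU VV i j).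
rewrite mulrDl mul1r -sum_const_ord2.
apply: le_trans (lerD h1 (ler_sum _ (fun i _ => ler_sum _ (fun j _ => h2 i j)))).
under [X in _ <= _ + X]eq_bigr => i _ do rewrite -avgs_sum.
rewrite -avgs_sum -avgsD; apply: avgs_le => ws sws.
have [_|nb] := boolP `[< unique_minimizer _ >].
  by rewrite mulr0n addr_ge0// sumr_ge0// => i _; rewrite sumr_ge0.
have [/asboolP gE|_] := boolP `[< good_chain U V eps tau (U *m V^T) kappa ws >]; last first.
  by rewrite lerDl sumr_ge0// => i _; rewrite sumr_ge0.
have [/forallP gD|] := boolP [forall i, forall j,
    `[< good_chain U V eps tau (T (delta_mx i j)) 1 ws >]].
  exfalso; apply: (negP nb); apply/asboolP.
  apply: (good_chain_unique_minimizer (ltW k0) k1 Ek tauk _ gE); first by rewrite sws.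
  by move=> i j; apply/asboolP; move/forallP: (gD i); apply.
rewrite negb_forall => /existsP[a]; rewrite negb_forall => /existsP[b] h.
rewrite mulr0n add0r (bigD1 a)//= (bigD1 b)//= h.
by rewrite -addrA lerDl addr_ge0 ?sumr_ge0// => k' _; rewrite sumr_ge0.
Qed.

End GolfingProbability.

(** * Uniform subsets *)

Section UniformSubsets.
Variables (R : realType) (T : finType).

Lemma perm_imset_eq_card (M M' : {set T}) : #|M| = #|M'| ->
  exists pi : {perm T}, pi @: M = M'.
Proof.
move=> cM; pose s := enum M ++ enum (~: M)%SET; pose s' := enum M' ++ enum (~: M')%SET.
have all_in (A : {set T}) x : x \in enum A ++ enum (~: A)%SET.
  by rewrite mem_cat !mem_enum inE orbN.
have us (A : {set T}) : uniq (enum A ++ enum (~: A)%SET).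
  rewrite cat_uniq !enum_uniq andbT /=; apply/hasPn => x.
  by rewrite !mem_enum inE.
have ss' : size s = size s' by rewrite /s /s' !size_cat -!cardE !cardsC.
pose f x := nth x s' (index x s).
have finj : injective f.
  move=> x y; rewrite /f => /eqP; rewrite (set_nth_default x) -?ss' ?index_mem ?all_in//.
  rewrite nth_uniq ?us -?ss' ?index_mem ?all_in// => /eqP h.
  by rewrite -(nth_index x (all_in M x)) -/s h nth_index// all_in.
exists (perm finj); apply/eqP; rewrite eqEcard card_imset ?cM ?leqnn ?andbT; last exact: perm_inj.
apply/fintype.subsetP => y /imsetP[x xM ->]; rewrite permE /f /s' nth_cat.
have idx : (index x s < size (enum M'))%N.
  by rewrite -cardE -cM cardE /s index_cat mem_enum xM index_mem mem_enum.
by rewrite idx -mem_enum mem_nth.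
Qed.

Lemma imset_permM (s u : {perm T}) (M : {set T}) : (s * u)%g @: M = u @: (s @: M).
Proof. by rewrite -imset_comp; apply: eq_imset => x; rewrite permM. Qed.

Definition subset_fraction (bad : pred {set T}) m : R :=
  #|[set S : {set T} | (#|S| == m) && bad S]%SET|%:R / 'C(#|T|, m)%:R.

(** A uniformly random permutation carries a fixed set to a uniform set of its size. This is double
    counting, with transitivity of permutations on sets of equal size. *)
Lemma avg_perm_imset (bad : pred {set T}) (M : {set T}) :
  avg (fun pi : {perm T} => (bad (pi @: M))%:R : R) = subset_fraction bad #|M|.
Proof.
pose D := [set S : {set T} | #|S| == #|M|]%SET.
have cD : #|D| = 'C(#|T|, #|M|) by rewrite card_draws.
have D0 : (0 < 'C(#|T|, #|M|))%N by rewrite bin_gt0 max_card.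
pose a : R := \sum_(pi : {perm T}) (bad (pi @: M))%:R.
have same S : S \in D -> \sum_(pi : {perm T}) (bad (pi @: S))%:R = a.
  rewrite inE => /eqP SM; have [tau tauM] := perm_imset_eq_card (esym SM).
  rewrite /a [in RHS](reindex_inj (mulgI tau)) /=.
  by apply: eq_bigr => pi _; rewrite imset_permM tauM.
have count (pi : {perm T}) : \sum_(S in D) (bad (pi @: S))%:R =
    #|[set S : {set T} | (#|S| == #|M|) && bad S]%SET|%:R :> R.
  have inj : injective (fun S : {set T} => pi @: S) by apply: imset_inj; exact: perm_inj.
  rewrite -natr_sum; congr (_%:R); rewrite -sum1_card [RHS](reindex_inj inj) /=.
  rewrite [LHS]big_mkcond [RHS]big_mkcond; apply: eq_bigr => S _.
  rewrite !inE card_imset; last exact: perm_inj.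
  by case: eqP => //= _; case: (bad _).
have dbl : a * #|D|%:R = #|{: {perm T}}|%:R *
    #|[set S : {set T} | (#|S| == #|M|) && bad S]%SET|%:R.
  rewrite -[X in _ = X * _]/(#|_|%:R) mulr_natr -sumr_const -(eq_bigr _ same).
  rewrite exchange_big /= (eq_bigr _ (fun pi _ => count pi)) sumr_const mulr_natl.
  by rewrite cardT.
have P0 : (0 < #|{: {perm T}}|)%N by apply/card_gt0P; exists 1%g.
rewrite /avg /subset_fraction -cD -/a; apply/eqP.
rewrite eqr_div ?pnatr_eq0 -?lt0n ?cD//; apply/eqP.
by rewrite -cD dbl mulrC.
Qed.

Lemma exists_superset_card (S : {set T}) m : (#|S| <= m <= #|T|)%N ->
  exists2 M : {set T}, S \subset M & #|M| = m.
Proof.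
move=> /andP[Sm mT].
have : (0 < #|[set B : {set T} | B \subset (~: S)%SET & #|B| == (m - #|S|)%N]%SET|)%N.
  by rewrite cards_draws bin_gt0 (cardsCs (~: S)%SET) finset.setCK leq_sub2r.
case/card_gt0P => B; rewrite inE => /andP[BS /eqP cB].
exists (S :|: B)%SET; first exact: finset.subsetUl.
rewrite cardsU cB (_ : (S :&: B = finset.set0)%SET) ?cards0 ?subn0 ?subnKC//.
by apply/eqP; rewrite finset.setI_eq0 disjoint_sym finset.disjoints_subset.
Qed.

(** Failure passes to subsets, so enlarging [S] to [m] elements before permuting only lowers it. *)
Lemma subset_fraction_le (bad : pred {set T}) m (S : {set T}) :
  (forall A B : {set T}, A \subset B -> bad B -> bad A) ->
  (#|S| <= m <= #|T|)%N ->
  subset_fraction bad m <= avg (fun pi : {perm T} => (bad (pi @: S))%:R : R).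
Proof.
move=> anti /exists_superset_card[M SM <-]; rewrite -avg_perm_imset; apply: avg_le => pi.
have [h|_] := boolP (bad (pi @: M)); last by rewrite mulr0n.
by rewrite (anti _ _ (imsetS pi SM) h).
Qed.

End UniformSubsets.

Section UniformSubsetsOfPositions.
Variables (R : realType) (n t : nat).
Hypotheses (n_gt0 : (0 < n)%N).

Notation pos := ('I_n * 'I_n)%type.
Notation batch := {ffun 'I_t -> pos}.

Lemma card_positions (ws : seq batch) : (#|positions ws| <= size ws * t)%N.
Proof.
elim: ws => [|w ws IH].
  by rewrite (_ : positions [::] = finset.set0) ?cards0//; apply/setP => p; rewrite !inE.
have sub : positions (w :: ws) \subset ([set w s | s in 'I_t] :|: positions ws)%SET.
  apply/fintype.subsetP => p; rewrite !inE /= => /orP[/existsP[s /eqP <-]|->]; last by rewrite orbT.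
  by rewrite imset_f.
apply: (leq_trans (subset_leq_card sub)); apply: (leq_trans (leq_card_setU _ _)).
rewrite /= mulSn; apply: leq_add => //.
by apply: (leq_trans (leq_imset_card _ _)); rewrite card_ord.
Qed.

Lemma imset_positions (pi : {perm pos}) (ws : seq batch) :
  pi @: positions ws = positions [seq [ffun s => pi (w s)] | w : batch <- ws].
Proof.
apply/setP => q; rewrite inE has_map; apply/imsetP/hasP => [[p]|[w wws]].
  rewrite inE => /hasP[w wws /existsP[s /eqP <-]] ->; exists w => //=.
  by apply/existsP; exists s; rewrite ffunE.
move=> /= /existsP[s /eqP]; rewrite ffunE => <-; exists (w s) => //.
by rewrite inE; apply/hasP; exists w => //; apply/existsP; exists s.
Qed.

Lemma avgs_map (pi : {perm pos}) k (F : seq batch -> R) :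
  avgs k (fun ws => F [seq [ffun s => pi (w s)] | w : batch <- ws]) = avgs k F.
Proof.
elim: k F => [//|k IH] F /=.
have inj : injective (fun w : batch => [ffun s => pi (w s)] : batch).
  move=> w w' /ffunP h; apply/ffunP => s; have := h s; rewrite !ffunE.
  exact: perm_inj.
rewrite -[RHS](avg_reindex _ inj); apply: eq_avg => w /=.
exact: (IH (fun ws => F ([ffun s => pi (w s)] :: ws))).
Qed.

(* Sampling with replacement draws at most [m] distinct positions, so failure is
   at least as likely as for a uniform [m]-subset. *)
Theorem subset_fraction_le_avgs (bad : pred {set pos}) m k :
  (forall A B : {set pos}, A \subset B -> bad B -> bad A) ->
  (k * t <= m <= n * n)%N ->
  subset_fraction R bad m <= avgs k (fun ws : seq batch => (bad (positions ws))%:R : R).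
Proof.
move=> anti /andP[ktm mnn].
have W0 : (0 < #|{: batch}|)%N by apply: card_batch_gt0.
have P0 : (0 < #|{: {perm pos}}|)%N by apply/card_gt0P; exists 1%g.
rewrite -[leLHS](avgs_const k _ W0).
(* For fixed draws, a random relabelling makes their positions a uniform subset of size at most [m];
   averaged over the draws, relabelling has no effect. *)
apply: (@le_trans _ _ (avgs k (fun ws : seq batch =>
  avg (fun pi : {perm pos} => (bad (pi @: positions ws))%:R : R)))).
  apply: avgs_le => ws sws; apply: subset_fraction_le => //.
  rewrite card_pos -mulnn mnn andbT; apply: leq_trans ktm.
  by rewrite -sws; exact: card_positions.
have -> : avgs k (fun ws : seq batch =>
    avg (fun pi : {perm pos} => (bad (pi @: positions ws))%:R : R)) =
    avg (fun pi : {perm pos} => avgs k (fun ws : seq batch => (bad (pi @: positions ws))%:R : R)).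
  exact: avgs_exchange.
rewrite -[leRHS](avg_const _ P0) le_eqVlt; apply/orP; left; apply/eqP; apply: eq_avg => pi.
rewrite -[RHS](avgs_map pi); apply: eq_avgs => ws.
by rewrite imset_positions.
Qed.

End UniformSubsetsOfPositions.

(** * Incoherence *)

Section Incoherence.
Variables (R : realType) (n : nat).

(** Uniqueness of the orthogonal projection: equal ranges give [P U U^T = P] and [U^T P = U^T], and
    transposing the first identity identifies the two projections. *)
Lemma orth_proj_orthonormal r (U : 'M[R]_(n, r)) : U^T *m U = 1%:M ->
  orth_proj U^T = U *m U^T.
Proof.
move=> UU.
have [PT PP /andP[PU UP]] : [/\ (orth_proj U^T)^T = orth_proj U^T,
    orth_proj U^T *m orth_proj U^T = orth_proj U^T & (orth_proj U^T == U^T)%MS].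
  apply: (xgetPex 0 (P := fun P : 'M[R]_n => [/\ P^T = P, P *m P = P & (P == U^T)%MS])).
  exists (U *m U^T); split; first by rewrite trmx_mul trmxK.
    by rewrite !mulmxA -(mulmxA U) UU mulmx1.
  by rewrite submxMl /= -{1}[U^T]mul1mx -UU -mulmxA submxMl.
move: (orth_proj _) PT PP PU UP => P PT PP /submxP[X PX] /submxP[Y UY].
have e1 : P *m (U *m U^T) = P by rewrite PX !mulmxA -(mulmxA X) UU mulmx1.
have e2 : U^T *m P = U^T by rewrite UY -mulmxA PP.
by have := congr1 trmx e1; rewrite !trmx_mul trmxK PT -mulmxA e2 => <-.
Qed.

Lemma coherence_row_bound r (U : 'M[R]_(n, r)) mu0 : U^T *m U = 1%:M -> (0 < n)%N ->
  (0 < r)%N -> coherence U^T <= mu0 ->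
  forall i, (U *m U^T) i i <= mu0 * r%:R / n%:R.
Proof.
move=> UU n_gt0 r_gt0 + i.
have n0 : 0 < n%:R :> R by rewrite ltr0n.
have r0 : 0 < r%:R :> R by rewrite ltr0n.
have rk : \rank U^T = r.
  apply/eqP; rewrite eqn_leq rank_leq_row /=.
  by rewrite -[X in (X <= _)%N](mxrank1 R r) -UU mxrankM_maxl.
rewrite /coherence rk orth_proj_orthonormal// => h.
have e (k : 'I_n) : \sum_(j < n) (U *m U^T *m (delta_mx k 0 : 'cV[R]_n)) j 0 ^+ 2 = (U *m U^T) k k.
  transitivity (frob (U *m U^T *m (delta_mx k 0 : 'cV[R]_n)) (U *m U^T *m delta_mx k 0)).
    by rewrite frobE; apply: eq_bigr => j _; rewrite big_ord1 expr2.
  rewrite -mulmxA frob_orthogonal// frob_mull trmxK mulmxA frob_deltal -colE.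
  by rewrite mxE.
have {h} : n%:R / r%:R * (U *m U^T) i i <= mu0.
  apply: le_trans h; rewrite ler_wpM2l ?divr_ge0// -e.
  exact: (le_bigmax _ (fun i : 'I_n => \sum_(j < n) (U *m U^T *m (delta_mx i 0 : 'cV[R]_n)) j 0 ^+ 2)).
rewrite -(ler_pM2l (divr_gt0 r0 n0)).
have -> : r%:R / n%:R * (n%:R / r%:R * (U *m U^T) i i) = (U *m U^T) i i.
  by field; rewrite !gt_eqF.
by rewrite mulrC mulrA.
Qed.

Lemma coherence_ge1 r (U : 'M[R]_(n, r)) mu0 : U^T *m U = 1%:M -> (0 < n)%N ->
  (0 < r)%N -> (forall i, (U *m U^T) i i <= mu0 * r%:R / n%:R) -> 1 <= mu0.
Proof.
move=> UU n_gt0 r_gt0 h.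
have n0 : 0 < n%:R :> R by rewrite ltr0n.
have r0 : 0 < r%:R :> R by rewrite ltr0n.
have tr : \tr (U *m U^T) = r%:R :> R by rewrite mxtrace_mulC UU mxtrace1.
have : \tr (U *m U^T) <= \sum_(i < n) mu0 * r%:R / n%:R by apply: ler_sum => i _.
rewrite tr sumr_const card_ord -[_ *+ n]mulr_natr divfK ?gt_eqF//.
by rewrite -{1}[r%:R]mul1r ler_pM2r.
Qed.

Lemma orthonormal_row_le1 r (U : 'M[R]_(n, r)) i : U^T *m U = 1%:M -> (U *m U^T) i i <= 1.
Proof.
move=> UU; set P := U *m U^T.
have PP : P *m P = P by rewrite /P !mulmxA -(mulmxA U) UU mulmx1.
have PT : P^T = P by rewrite /P trmx_mul trmxK.
clearbody P.
have : P i i = \sum_j P i j ^+ 2.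
  by rewrite -{1}PP mxE; apply: eq_bigr => j _; rewrite -{2}PT mxE expr2.
rewrite (bigD1 i)//= => e; rewrite leNgt; apply/negP => P1.
have s0 : 0 <= \sum_(j | j != i) P i j ^+ 2 by apply: sumr_ge0 => j _; rewrite sqr_ge0.
by move: e s0 P1; rewrite expr2; nra.
Qed.

Lemma orthonormal_row_ge0 r (U : 'M[R]_(n, r)) i : 0 <= (U *m U^T) i i.
Proof. by rewrite mxE sumr_ge0// => k _; rewrite mxE -expr2 sqr_ge0. Qed.

Lemma sign_entry_le r (U V : 'M[R]_(n, r)) i j c : 0 <= c ->
  (U *m U^T) i i <= c -> (V *m V^T) j j <= c -> `|(U *m V^T) i j| <= c.
Proof.
move=> c0 Uc Vc; rewrite -(@ler_pXn2r _ 2)// ?nnegrE// real_normK ?num_real//.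
have e (A B : 'M[R]_(n, r)) a b : (A *m B^T) a b = frob (row a A) (row b B).
  rewrite frobE big_ord1 mxE; apply: eq_bigr => k _; rewrite !mxE//.
move: Uc Vc; rewrite !e => Uc Vc; apply: (le_trans (frob_CS _ _)).
by rewrite expr2 ler_pM ?frob_ge0.
Qed.

(** The squared norm is the entry [(i, j)], namely [1 - (1 - x) (1 - y)] with [x], [y] the diagonal
    entries of the two projections. *)
Lemma frob_tangent_delta_le r (U V : 'M[R]_(n, r)) c :
  U^T *m U = 1%:M -> V^T *m V = 1%:M ->
  (forall i, (U *m U^T) i i <= c) -> (forall i, (V *m V^T) i i <= c) ->
  forall i j, frob (tangent_proj U V (delta_mx i j)) (tangent_proj U V (delta_mx i j)) <= 2 * c.
Proof.
move=> UU VV Uc Vc i j.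
rewrite tangent_proj_sym// tangent_proj_idem// frob_deltal tangent_projE /normal_proj.
have -> : (1%:M - U *m U^T) *m delta_mx i j *m (1%:M - V *m V^T) =
    col i (1%:M - U *m U^T) *m row j (1%:M - V *m V^T).
  by rewrite colE rowE -(mul_delta_mx (0 : 'I_1)) !mulmxA.
have e (X Y : 'M[R]_n) : (delta_mx i j - col i X *m row j Y) i j = 1 - X i i * Y j j.
  by rewrite mxE [X in X + _]mxE !eqxx [X in _ + X]mxE [X in _ - X]mxE big_ord1 !mxE.
have d (X : 'M[R]_n) k : (1%:M - X) k k = 1 - X k k.
  by rewrite mxE [Y in Y + _]mxE eqxx [Y in _ + Y]mxE.
rewrite e !d.
have := Uc i; have := Vc j.
have := mulr_ge0 (orthonormal_row_ge0 U i) (orthonormal_row_ge0 V j).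
move: ((U *m U^T) i i) ((V *m V^T) j j) => x y; lra.
Qed.

End Incoherence.

(** * Recovery of one block *)

Section BlockRecovery.
Variable R : realType.

Lemma expR_half_le2 : expR (1 / 2 : R) <= 2.
Proof.
have h : 1 / 2 <= expR (- (1 / 2) : R).
  by apply: le_trans (expR_ge1Dx _); lra.
rewrite -[expR _]invrK -expRN -[leRHS]invrK lef_pV2 ?posrE ?expR_gt0//.
by apply: le_trans h; lra.
Qed.

(** Makes the Chernoff rate [4^-p] at least as good as the rate [e^-p] from Bernstein's
    inequality. *)
Lemma expR1_le4 : expR (1 : R) <= 4.
Proof.
have -> : expR (1 : R) = expR (1 / 2) ^+ 2 by rewrite expr2 -expRD -splitr.
apply: (@le_trans _ _ (2 ^+ 2)); last by rewrite expr2; lra.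
by apply: lerXn2r; rewrite ?nnegrE ?expR_ge0// expR_half_le2.
Qed.

Lemma ln_ge_half (n : nat) : (2 <= n)%N -> 1 / 2 <= ln (n%:R : R).
Proof.
move=> n2; have n0 : 0 < n%:R :> R by rewrite ltr0n (leq_trans _ n2).
rewrite -ler_expR lnK ?posrE//; apply: le_trans expR_half_le2 _.
by rewrite ler_nat.
Qed.

(** Writing [n = b^10] turns the exponents 1/5 and 6/5 into integer powers of [b]. *)
Lemma powR_tenth (n : nat) : (0 < n)%N -> exists b : R,
  [/\ 1 <= b, b ^+ 10 = n%:R, b ^+ 2 = n%:R `^ 5^-1 & b ^+ 12 = n%:R `^ (6 / 5)].
Proof.
move=> n_gt0; have n1 : 1 <= n%:R :> R by rewrite ler1n.
have pw k : (n%:R `^ 10^-1) ^+ k = n%:R `^ (10^-1 * k%:R) :> R.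
  by rewrite powRrM powR_mulrn// powR_ge0.
exists (n%:R `^ 10^-1); split.
- have : n%:R `^ 0 <= n%:R `^ 10^-1 :> R by rewrite ler_powR// invr_ge0.
  by rewrite powRr0.
- by rewrite pw mulVf ?pnatr_eq0// powRr1.
- by rewrite pw; congr (_ `^ _); field.
- by rewrite pw; congr (_ `^ _); field.
Qed.

Lemma subset_fraction_le1 (T : finType) (bad : pred {set T}) m :
  subset_fraction R bad m <= 1.
Proof.
rewrite /subset_fraction; have [->|c0] := posnP 'C(#|T|, m).
  by rewrite invr0 mulr0.
rewrite ler_pdivrMr ?ltr0n// mul1r ler_nat -card_draws.
by apply: subset_leq_card; apply/fintype.subsetP => S; rewrite !inE => /andP[].
Qed.

Lemma subset_fraction0 (T : finType) (bad : pred {set T}) m :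
  (forall S, ~~ bad S) -> subset_fraction R bad m = 0.
Proof.
move=> nb; rewrite /subset_fraction (_ : [set S | _]%SET = finset.set0) ?cards0 ?mul0r//.
by apply/setP => S; rewrite !inE (negbTE (nb S)) andbF.
Qed.

Lemma unique_minimizer_rank0 n (A : 'M[R]_n) (Omega : {set 'I_n * 'I_n}) :
  \rank A = 0%N -> unique_minimizer A Omega.
Proof.
move=> rA A' _ le.
have A0 : A = 0 by apply/eqP; rewrite -mxrank_eq0 rA.
have nA : nuclear_norm A = 0.
  by rewrite /nuclear_norm big1// => k _; have := ltn_ord k; rewrite [X in (_ < X)%N]rA.
rewrite A0; apply: frob_eq0; apply: le_trans (frob_le_nuclear_norm A') _.
have -> : nuclear_norm A' = 0; last by rewrite expr0n.
by apply/le_anti; rewrite nuclear_norm_ge0 andbT -nA.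
Qed.

Lemma unique_minimizer_mono n (A : 'M[R]_n) (S S' : {set 'I_n * 'I_n}) :
  S \subset S' -> unique_minimizer A S -> unique_minimizer A S'.
Proof.
move=> /fintype.subsetP SS' um A' agree; apply: um => p pS; exact: agree (SS' _ pS).
Qed.

(** At most [2 n^2] chains of 60 steps, each step failing with probability at most [6 n^2 e^-p]: the
    4 in [beta + 4] pays for [n^4], and [720 = 2 * 60 * 6]. *)
Lemma total_failure_le (n p : nat) (beta : R) : (2 <= n)%N ->
  (beta + 4) * ln n%:R <= p%:R ->
  (1 + n%:R ^+ 2) * (60%:R * step_failure R n p) <= 720 * n%:R `^ (- beta).
Proof.
move=> n2 hp; have n1 : 1 <= n%:R :> R by rewrite ler1n (leq_trans _ n2).
have n0 : 0 < n%:R :> R by apply: lt_le_trans n1.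
have e4 : (4 ^+ p)^-1 <= expR (- p%:R) :> R.
  rewrite expRN lef_pV2 ?posrE ?expR_gt0 ?exprn_gt0//.
  rewrite -[p%:R]mulr1 expRM_natl; apply: lerXn2r; rewrite ?nnegrE ?expR_ge0//.
  exact: expR1_le4.
have e0 : 0 <= expR (- p%:R) :> R by rewrite expR_ge0.
have n12 : n%:R <= n%:R ^+ 2 :> R by rewrite expr2 ler_peMl// ltW.
have sf : step_failure R n p <= 6 * n%:R ^+ 2 * expR (- p%:R).
  rewrite /step_failure.
  have h1 : 4 * n%:R / 4 ^+ p <= 4 * n%:R ^+ 2 * expR (- p%:R) :> R.
    by apply: ler_pM; rewrite ?invr_ge0 ?exprn_ge0 ?mulr_ge0//; rewrite ler_pM2l.
  lra.
have ep : expR (- p%:R) <= n%:R `^ (- beta) / n%:R ^+ 4 :> R.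
  have -> : n%:R `^ (- beta) / n%:R ^+ 4 = expR (- ((beta + 4) * ln n%:R)) :> R.
    have -> : n%:R ^+ 4 = expR (4%:R * ln n%:R) :> R by rewrite expRM_natl lnK ?posrE.
    rewrite /powR gt_eqF// -expRN -expRD; congr expR; ring.
  by rewrite ler_expR lerN2.
have pw0 : 0 <= n%:R `^ (- beta) :> R by rewrite powR_ge0.
have n2_1 : 1 <= n%:R ^+ 2 :> R by apply: le_trans n12.
apply: (@le_trans _ _ (2 * n%:R ^+ 2 * (60%:R * (6 * n%:R ^+ 2 * (n%:R `^ (- beta) / n%:R ^+ 4))))).
  apply: ler_pM; first by rewrite addr_ge0// exprn_ge0// ltW.
  - by rewrite mulr_ge0// step_failure_ge0.
  - lra.
  - rewrite ler_pM2l//; apply: le_trans sf _; apply: ler_wpM2l ep.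
    by rewrite mulr_ge0 ?sqr_ge0.
rewrite le_eqVlt; apply/orP; left; apply/eqP; field.
by rewrite gt_eqF.
Qed.

(* 60 batches cost a factor 120 after rounding, [p <= 4 beta ln n], and
   [384 * 16] is the constant of [sampling_op_concentration] at
   [tau = 1 / (4 kap)]; this is the only use of the size of [C]. *)
Theorem block_recovery n (A : 'M[R]_n) (C mu0 kap beta : R) (m : nat) :
  384 * 16 * (4 * 120) <= C ->
  (0 < n)%N -> decoherent A mu0 -> 2 < beta -> ((0 < \rank A)%N -> 0 < kap) ->
  (forall i j, `|(left_singular_vectors A *m (right_singular_vectors A)^T) i j| <= kap) ->
  (m <= n * n)%N ->
  C * mu0 * beta * (\rank A)%:R * (n%:R `^ (6 / 5) * ln n%:R) <= m%:R ->
  C * beta * (n%:R ^+ 3 * kap ^+ 2) * ln n%:R <= m%:R ->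
  subset_fraction R (fun S => ~~ `[< unique_minimizer A S >]) m <= 720 * n%:R `^ (- beta).
Proof.
move=> + n_gt0 dec beta2 kap0 Ek mn H1 H2.
have pw0 : 0 <= n%:R `^ (- beta) :> R by rewrite powR_ge0.
have [rA0|r_gt0] := posnP (\rank A).
  move=> _; rewrite subset_fraction0; first exact: mulr_ge0 (ler0n _ _) pw0.
  move=> S; rewrite negbK; apply/asboolP; exact: unique_minimizer_rank0.
(* For [n = 1] the logarithm vanishes and the conditions do not force [m] to be large, but the
   claimed bound is 720, above any probability. *)
move: (n_gt0); rewrite leq_eqVlt => /orP[/eqP n1|n2].
  move=> _; apply: (le_trans (subset_fraction_le1 _ _)).
  by rewrite -n1 powR1 mulr1; lra.
have {}kap0 := kap0 r_gt0.
have UU := left_singular_vectors_orthonormal A.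
have VV := right_singular_vectors_orthonormal A.
set U := left_singular_vectors A in UU Ek *; set V := right_singular_vectors A in VV Ek *.
set r := \rank A in U V UU VV Ek r_gt0 H1 *.
have n0 : 0 < n%:R :> R by rewrite ltr0n.
have r0 : 0 < r%:R :> R by rewrite ltr0n.
have r1 : 1 <= r%:R :> R by rewrite ler1n.
have [Ui Vi] : (forall i, (U *m U^T) i i <= mu0 * r%:R / n%:R) /\
    (forall i, (V *m V^T) i i <= mu0 * r%:R / n%:R).
  move: dec; rewrite /decoherent ge_max => /andP[dU dV].
  by split=> i; apply: coherence_row_bound.
have mu1 : 1 <= mu0 := coherence_ge1 UU n_gt0 r_gt0 Ui.
have [b [b1 b10 b2 b12]] := powR_tenth n_gt0.
have b0 : 0 < b by apply: lt_le_trans b1.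
have l2 := ln_ge_half n2.
set l := ln n%:R in l2 H1 H2 *.
pose q := beta * l.
have q1 : 1 <= q.
  have := ler_pM _ _ (ltW beta2) l2; rewrite -/q; move: (q) => z.
  by rewrite !(ler0n, divr_ge0)// => /(_ isT isT); lra.
(* [p] is [(beta + 4) ln n] rounded up: [beta > 2] gives [beta + 4 <= 3 beta], and [q >= 1] pays for
   the rounding. *)
have [p [p_gt0 plow pup]] : exists p : nat,
    [/\ (0 < p)%N, (beta + 4) * l <= p%:R & p%:R <= 4 * q].
  have x0 : 0 <= (beta + 4) * l by apply: mulr_ge0; lra.
  exists (Num.truncn ((beta + 4) * l)).+1; split => //.
    by apply/ltW/truncnS_gt.
  rewrite -natr1; have := truncn_le ((beta + 4) * l); rewrite x0 => h.
  apply: (@le_trans _ _ ((beta + 4) * l + 1)); first by rewrite lerD2r.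
  by move: q1; rewrite /q; nra.
(* Up to constants, [X] is the sample size for contracting entries and [Y] the one for the operator
   norm. *)
pose X := mu0 * r%:R * (q * b ^+ 12).
pose Y := q * (n%:R ^+ 3 * kap ^+ 2).
have HX : C * X <= m%:R.
  by apply: le_trans H1; rewrite le_eqVlt /X /q -b12; apply/orP; left; apply/eqP; ring.
have HY : C * Y <= m%:R.
  by apply: le_trans H2; rewrite le_eqVlt /Y /q; apply/orP; left; apply/eqP; ring.
have b_2 : 1 <= b ^+ 2 by rewrite exprn_ege1.
have b12n : b ^+ 12 = n%:R * b ^+ 2 by rewrite -b10 -exprD.
have mr1 : 1 <= mu0 * r%:R by rewrite mulr_ege1.
have nq0 : 0 < q * n%:R by rewrite mulr_gt0//; lra.
have Xqn : q * n%:R <= X.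
  rewrite /X b12n [q * (_ * _)]mulrA [leRHS]mulrCA.
  by rewrite ler_peMr ?mulr_ege1// ltW.
have X1 : 1 <= X.
  by apply: le_trans Xqn; rewrite mulr_ege1// ler1n.
move=> HC.
have Y0 : 0 <= Y.
  by apply: mulr_ge0; [exact: le_trans q1|rewrite mulr_ge0 ?exprn_ge0// ltW].
(* The lower bound on [m] keeps the 60 batches nonempty, so that rounding down costs at most a
   factor 2. *)
have [m1 mX mY] : [/\ 118 <= m%:R :> R, 120 * (80 * (4 * X)) <= m%:R
    & 120 * (384 * 16 * (4 * Y)) <= m%:R].
  have X0 : 0 <= X by apply: le_trans X1.
  have hX := le_trans (ler_wpM2r X0 HC) HX; have hY := le_trans (ler_wpM2r Y0 HC) HY.
  split; last by move: hY; clear; lra.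
  - by move: hX X1; clear; lra.
  - by move: hX X0; clear; lra.
clear HC HX HY.
pose t := (m %/ 60)%N.
have tm : (60 * t <= m)%N by rewrite mulnC leq_divM.
have mt : m%:R <= 120 * t%:R :> R.
  have m118 : (118 <= m)%N by rewrite -(ler_nat R).
  by rewrite -natrM ler_nat /t; move: m118; clear; lia.
have t_gt0 : (0 < t)%N.
  by rewrite -(ltr_nat R); move: mt m1; clear; lra.
(* [golfing] asks for [kappa <= 1]; truncation is free because no entry of [U V^T] exceeds 1. *)
pose kap' := Num.min kap 1.
have kap'0 : 0 < kap' by rewrite /kap' lt_min kap0 ltr01.
have kap'1 : kap' <= 1 by rewrite /kap' ge_min lexx orbT.
have kap'k : kap' <= kap by rewrite /kap' ge_min lexx.
have Ek' i j : `|(U *m V^T) i j| <= kap'.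
  by rewrite /kap' le_min Ek /=; apply: sign_entry_le => //; exact: orthonormal_row_le1.
(* [eps] enters the contraction condition squared and so spends [b^2 = n^(1/5)]. After 60 batches
   [eps^60 = 2^-60 n^-6] beats [16 n^6]. Next, [tau] solves [2 tau kap' = 1 / 2]. *)
pose eps := 1 / (2 * b).
pose tau := 1 / (4 * kap').
have eps0 : 0 < eps by rewrite divr_gt0// mulr_gt0.
have eps_half : eps <= 1 / 2.
  by rewrite /eps ler_pdivrMr ?mulr_gt0//; move: b1; clear; lra.
have tau0 : 0 < tau by rewrite divr_gt0// mulr_gt0.
pose rho := 2 * (mu0 * r%:R / n%:R).
have rho0 : 0 < rho by rewrite mulr_gt0// divr_gt0//; apply: lt_le_trans mr1.
have t_contract : 10 * p%:R * rho * n%:R ^+ 2 <= t%:R * eps ^+ 2.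
  have -> : t%:R * eps ^+ 2 = t%:R / (4 * b ^+ 2) by rewrite /eps; field; rewrite gt_eqF.
  rewrite ler_pdivlMr ?mulr_gt0 ?exprn_gt0//.
  have -> : 10 * p%:R * rho * n%:R ^+ 2 * (4 * b ^+ 2) =
      80 * (mu0 * r%:R * (p%:R * b ^+ 12)).
    by rewrite b12n /rho; field; rewrite gt_eqF.
  apply: (@le_trans _ _ (80 * (4 * X))); last by move: mt mX X1; clear; lra.
  rewrite ler_pM2l// /X [leRHS]mulrCA; apply: ler_wpM2l; first by apply: le_trans mr1.
  by rewrite [leRHS]mulrA; apply: ler_wpM2r => //; rewrite exprn_ge0// ltW.
have t_large : 2 * p%:R * n%:R <= t%:R :> R.
  apply: (@le_trans _ _ (8 * X)); last by move: mt mX X1; clear; lra.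
  apply: (@le_trans _ _ (2 * (4 * q) * n%:R)).
    by rewrite ler_pM2r// ler_pM2l.
  by move: Xqn; clear; lra.
have t_op : 384 * p%:R * n%:R ^+ 3 <= tau ^+ 2 * t%:R.
  have -> : tau ^+ 2 * t%:R = t%:R / (16 * kap' ^+ 2) by rewrite /tau; field; rewrite gt_eqF.
  rewrite ler_pdivlMr ?mulr_gt0 ?exprn_gt0//.
  apply: (@le_trans _ _ (384 * 16 * (4 * Y))); last by move: mt mY; clear; lra.
  have -> : 384 * p%:R * n%:R ^+ 3 * (16 * kap' ^+ 2) = 384 * 16 * (p%:R * (n%:R ^+ 3 * kap' ^+ 2)) by ring.
  have -> : 384 * 16 * (4 * Y) = 384 * 16 * (4 * q * (n%:R ^+ 3 * kap ^+ 2)) by rewrite /Y; ring.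
  apply: ler_wpM2l; first exact: mulr_ge0 (ler0n _ _) (ler0n _ _).
  apply: ler_pM => //; first by rewrite mulr_ge0 ?exprn_ge0// ltW.
  rewrite ler_pM2l ?exprn_gt0//.
  by apply: lerXn2r; rewrite ?nnegrE// ltW.
have tauk : 2 * tau * kap' <= 1 / 2.
  by rewrite le_eqVlt /tau; apply/orP; left; apply/eqP; field; rewrite gt_eqF.
have epsn : 16 * n%:R ^+ 6 * eps ^+ 60 <= 1.
  have -> : eps ^+ 60 = (2 ^+ 60 * n%:R ^+ 6)^-1.
    by rewrite /eps expr_div_n expr1n exprMn -b10 -exprM mul1r.
  rewrite ler_pdivrMr ?mulr_gt0 ?exprn_gt0// mul1r ler_pM2r ?exprn_gt0//.
  rewrite (_ : 16 = 2 ^+ 4); last by rewrite -natrX.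
  by apply: ler_weXn2l => //; rewrite ler1n.
have gol := golfing n_gt0 t_gt0 p_gt0 eps0 eps_half tau0 rho0
  (frob_tangent_delta_le UU VV Ui Vi) t_contract t_large t_op kap'0 kap'1 Ek' tauk epsn.
apply: (le_trans (subset_fraction_le_avgs R (t := t) (k := 60) n_gt0 _ _)).
- move=> S S' SS'; apply: contraNN => /asboolP um; apply/asboolP.
  exact: unique_minimizer_mono um.
- by rewrite tm.
- exact: le_trans gol (total_failure_le n2 plow).
Qed.

Lemma decoherent_bounds n (A : 'M[R]_n) mu0 : (0 < n)%N -> (0 < \rank A)%N ->
  decoherent A mu0 ->
  (forall i, (left_singular_vectors A *m (left_singular_vectors A)^T) i i <=
     mu0 * (\rank A)%:R / n%:R) /\
  (forall i, (right_singular_vectors A *m (right_singular_vectors A)^T) i i <=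
     mu0 * (\rank A)%:R / n%:R).
Proof.
move=> n_gt0 r_gt0; rewrite /decoherent ge_max => /andP[dU dV].
split=> i; apply: coherence_row_bound => //.
  exact: left_singular_vectors_orthonormal.
exact: right_singular_vectors_orthonormal.
Qed.

Lemma sum_col_mul_row n r (U V : 'M[R]_(n, r)) : \sum_k col k U *m (col k V)^T = U *m V^T.
Proof.
apply/matrixP => i j; rewrite summxE mxE; apply: eq_bigr => k _.
by rewrite mxE big_ord1 !mxE.
Qed.

Lemma powR_six_fifths (n : nat) : (0 < n)%N -> n%:R `^ (6 / 5) = n%:R * n%:R `^ 5^-1 :> R.
Proof.
move=> n_gt0; have -> : 6 / 5 = 1 + 5^-1 :> R by field.
by rewrite powRD ?powRr1// pnatr_eq0 -lt0n n_gt0 implybT.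
Qed.

(** The term [mu0 n^(1/4)] of the maximum covers the [mu0 n^(1/5)] of the contraction, and [mu1^2]
    covers the operator norm. *)
Lemma block_recovery_delocalized n (A : 'M[R]_n) (C mu0 mu1 beta : R) (m : nat) :
  384 * 16 * (4 * 120) <= C ->
  (0 < n)%N -> decoherent A mu0 -> 0 < mu0 -> delocalized A mu1 -> 0 < mu1 ->
  2 < beta -> (m <= n * n)%N ->
  C * Num.max (mu1 ^+ 2) (Num.max (Num.sqrt mu0 * mu1) (mu0 * n%:R `^ (4^-1)))
    * beta * (\rank A)%:R * (n%:R * ln n%:R) <= m%:R ->
  subset_fraction R (fun S => ~~ `[< unique_minimizer A S >]) m <= 720 * n%:R `^ (- beta).
Proof.
move=> HC n_gt0 dec mu0_gt0 deloc mu1_gt0 beta2 mn.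
set mx := Num.max _ _ => H.
have n0 : 0 < n%:R :> R by rewrite ltr0n.
have l0 : 0 <= ln n%:R :> R by rewrite ln_ge0// ler1n.
have C0 : 0 <= C.
  by apply: le_trans HC; exact: mulr_ge0 (mulr_ge0 (ler0n _ _) (ler0n _ _))
    (mulr_ge0 (ler0n _ _) (ler0n _ _)).
have b0 : 0 <= beta by apply: le_trans (ltW beta2).
have mono x : x <= mx -> C * x * beta * (\rank A)%:R * (n%:R * ln n%:R) <= m%:R.
  move=> xm; apply: le_trans H; apply: ler_wpM2r; first by rewrite mulr_ge0// ltW.
  by apply: ler_wpM2r => //; apply: ler_wpM2r => //; apply: ler_wpM2l.
apply: (@block_recovery n A C mu0 (mu1 * Num.sqrt ((\rank A)%:R / n%:R ^+ 2)) beta m) => //.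
- by move=> r_gt0; rewrite mulr_gt0// sqrtr_gt0 divr_gt0 ?exprn_gt0 ?ltr0n.
- by move=> i j; have := deloc i j; rewrite sum_col_mul_row.
- have := mono (mu0 * n%:R `^ (4^-1)); rewrite {1}/mx !le_max lexx !orbT => /(_ isT).
  apply: le_trans; rewrite powR_six_fifths//.
  have -> : C * mu0 * beta * (\rank A)%:R * (n%:R * n%:R `^ 5^-1 * ln n%:R) =
      C * (mu0 * n%:R `^ 5^-1) * beta * (\rank A)%:R * (n%:R * ln n%:R) by ring.
  apply: ler_wpM2r; first by rewrite mulr_ge0// ltW.
  apply: ler_wpM2r => //; apply: ler_wpM2r => //; apply: ler_wpM2l => //.
  rewrite ler_pM2l//; apply: ler_powR; first by rewrite ler1n.
  by rewrite lef_pV2 ?posrE// ler_nat.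
- have := mono (mu1 ^+ 2); rewrite {1}/mx !le_max lexx => /(_ isT).
  apply: le_trans; rewrite le_eqVlt; apply/orP; left; apply/eqP.
  rewrite exprMn sqr_sqrtr; last by rewrite divr_ge0 ?exprn_ge0.
  by field; rewrite gt_eqF.
Qed.

(** The entry bound on [U V^T] comes from Cauchy-Schwarz on the rows of [U] and [V]; the rank
    condition then makes the operator-norm requirement follow from the contraction one. *)
Lemma block_recovery_small_rank n (A : 'M[R]_n) (C mu0 beta : R) (m : nat) :
  384 * 16 * (4 * 120) <= C ->
  (0 < n)%N -> decoherent A mu0 -> 0 < mu0 -> 2 < beta -> (m <= n * n)%N ->
  (\rank A)%:R <= n%:R `^ (5^-1) / mu0 ->
  C * mu0 * beta * (\rank A)%:R * (n%:R `^ (6 / 5) * ln n%:R) <= m%:R ->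
  subset_fraction R (fun S => ~~ `[< unique_minimizer A S >]) m <= 720 * n%:R `^ (- beta).
Proof.
move=> HC n_gt0 dec mu0_gt0 beta2 mn rn H.
have n0 : 0 < n%:R :> R by rewrite ltr0n.
have l0 : 0 <= ln n%:R :> R by rewrite ln_ge0// ler1n.
have C0 : 0 <= C.
  by apply: le_trans HC; exact: mulr_ge0 (mulr_ge0 (ler0n _ _) (ler0n _ _))
    (mulr_ge0 (ler0n _ _) (ler0n _ _)).
have b0 : 0 <= beta by apply: le_trans (ltW beta2).
apply: (@block_recovery n A C mu0 (mu0 * (\rank A)%:R / n%:R) beta m) => //.
- by move=> r_gt0; rewrite divr_gt0// mulr_gt0// ltr0n.
- move=> i j; have [r0|r_gt0] := posnP (\rank A).
    by rewrite mxE big1 ?normr0 ?divr_ge0 ?mulr_ge0// ?ltW// => k; have := ltn_ord k; rewrite [X in (_ < X)%N]r0.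
  have [dU dV] := decoherent_bounds n_gt0 r_gt0 dec.
  by apply: sign_entry_le => //; rewrite divr_ge0// ?mulr_ge0// ltW.
- apply: le_trans H; rewrite powR_six_fifths//.
  have -> : C * beta * (n%:R ^+ 3 * (mu0 * (\rank A)%:R / n%:R) ^+ 2) * ln n%:R =
      C * mu0 * beta * (\rank A)%:R * (n%:R * (mu0 * (\rank A)%:R) * ln n%:R).
    by field; rewrite gt_eqF.
  apply: ler_wpM2l; first by rewrite !mulr_ge0// ltW.
  apply: ler_wpM2r => //; rewrite ler_pM2l//.
  by rewrite mulrC -ler_pdivlMr.
Qed.

End BlockRecovery.

Local Open Scope classical_set_scope.
Local Open Scope ring_scope.

(** * Union over the blocks *)

Section FiniteValuedMaps.
Variables (R : realType) (d : measure_display) (T : measurableType d) (U : finType) (F : T -> U).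
(** Events on a finite type are finite unions of fibres, so their measurability reduces to that of
    the fibres. *)
Hypothesis mF : forall u, measurable [set w | F w = u].

Lemma mem_consE u (s : seq U) :
  [set w | F w \in u :: s] = [set w | F w = u] `|` [set w | F w \in s].
Proof.
apply/seteqP; split=> w /=; rewrite inE; first by case/orP => [/eqP|]; [left|right].
by case=> [->|->]; rewrite ?eqxx ?orbT.
Qed.

Lemma measurable_mem (s : seq U) : measurable [set w | F w \in s].
Proof.
elim: s => [|u s IH]; last by rewrite mem_consE; exact: measurableU.
by rewrite (_ : [set w | _] = set0)//; apply/seteqP; split.
Qed.

Lemma mem_enum_predE (q : pred U) : [set w | q (F w)] = [set w | F w \in enum q].
Proof. by apply/seteqP; split=> w /=; rewrite mem_enum. Qed.

Lemma measurable_pred (q : pred U) : measurable [set w | q (F w)].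
Proof. by rewrite mem_enum_predE; exact: measurable_mem. Qed.

Lemma probability_mem (P : probability T R) (f : U -> R) (s : seq U) :
  (forall u, P [set w | F w = u] = (f u)%:E) -> uniq s ->
  P [set w | F w \in s] = (\sum_(u <- s) f u)%:E.
Proof.
move=> Pf; elim: s => [_|u s IH /= /andP[us uqs]].
  by rewrite big_nil (_ : [set w | _] = set0) ?measure0//; apply/seteqP; split.
rewrite mem_consE measureU//; last 2 first.
- exact: measurable_mem.
- by apply/seteqP; split=> // w /= [-> us']; rewrite us' in us.
by rewrite big_cons EFinD; congr (_ + _)%E; [exact: Pf|exact: IH].
Qed.

Lemma probability_pred (P : probability T R) (f : U -> R) (q : pred U) :
  (forall u, P [set w | F w = u] = (f u)%:E) ->
  P [set w | q (F w)] = (\sum_(u | q u) f u)%:E.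
Proof.
move=> Pf; rewrite mem_enum_predE (probability_mem Pf (enum_uniq _)).
by rewrite big_enum_cond /=; congr (_%:E); apply: eq_bigl => u; rewrite andbT.
Qed.

End FiniteValuedMaps.

Section UniformSample.
Variables (R : realType) (d : measure_display) (T : measurableType d) (P : probability T R).
Variables (n m : nat) (Omega : T -> {set 'I_n * 'I_n}).
Hypothesis uOmega : uniform_sample P m Omega.

Lemma uniform_sample_pred (bad : pred {set 'I_n * 'I_n}) :
  P [set w | bad (Omega w)] = (subset_fraction R bad m)%:E.
Proof.
pose f (S : {set 'I_n * 'I_n}) : R := if #|S| == m then ('C(n * n, m)%:R)^-1 else 0.
rewrite (@probability_pred _ _ _ _ Omega _ P f bad).
2, 3: by move=> S; case: (uOmega S).
congr (_%:E); rewrite /f -big_mkcondr sumr_const /subset_fraction card_prod card_ord.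
rewrite -[LHS]mulr_natl; congr (_%:R * _).
by apply: eq_card => S; rewrite !inE andbC.
Qed.

(** For [m > n^2] every fibre would have probability 0, against total mass 1. *)
Lemma uniform_sample_size : (m <= n * n)%N.
Proof.
rewrite leqNgt; apply/negP => mn.
have := uniform_sample_pred predT.
rewrite (_ : [set w | _] = setT); last by apply/seteqP; split.
rewrite probability_setT /subset_fraction card_prod card_ord bin_small// invr0 mulr0.
by move=> /eqP; rewrite eqe oner_eq0.
Qed.

End UniformSample.

Section UnionBound.
Variables (R : realType) (d : measure_display) (T : measurableType d) (P : probability T R).

Lemma probability_has_le (I : eqType) (bad : I -> pred T) (p : I -> R) (s : seq I) :
  (forall i, measurable [set w | bad i w]) -> (forall i, P [set w | bad i w] <= (p i)%:E)%E ->
  measurable [set w | has (bad^~ w) s] /\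
  (P [set w | has (bad^~ w) s] <= (\sum_(i <- s) p i)%:E)%E.
Proof.
move=> mb pb; elim: s => [|i s [mIH IH]].
  by rewrite big_nil (_ : [set w | _] = set0) ?measure0//; apply/seteqP; split.
have -> : [set w | has (bad^~ w) (i :: s)] = [set w | bad i w] `|` [set w | has (bad^~ w) s].
  by apply/seteqP; split=> w /=; [case/orP; [left|right]|case=> ->; rewrite ?orbT].
split; first exact: measurableU.
rewrite big_cons EFinD; apply: le_trans (leeD (pb i) IH).
exact: measureU2.
Qed.

End UnionBound.

Theorem theorem3p1 (R : realType) :
  exists C c : R, [/\ 0 < C, 0 < c &
  forall (D : set (R * R)) (K : mesh R) (h sigma : R)
    (p : nat) (piece : 'I_p -> set (R * R)) (aval : 'rV[R]_p),
  polygonal_domain D -> mesh_of D K ->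
  h = mesh_size K -> shape_regular K sigma ->
  (forall k, measurable (piece k)) -> trivIset setT piece ->
  D `<=` \bigcup_k piece k -> (forall k, 0 < aval 0 k) ->
  let L := dtn_matrix D K (piecewise_constant piece aval) in
  forall (N n : nat) (rows cols : 'I_N -> 'I_n -> 'I_(dof D K))
    (r m : 'I_N -> nat) (mu0 mu1 beta : 'I_N -> R),
  (0 < n)%N -> block_partition rows cols ->
  (forall i, \rank (block rows cols L i) = r i) ->
  (forall i, 0 < mu0 i) -> (forall i, decoherent (block rows cols L i) (mu0 i)) ->
  (forall i, 0 < mu1 i) -> (forall i, delocalized (block rows cols L i) (mu1 i)) ->
  (forall i, 2 < beta i) ->
  forall (d : measure_display) (T : measurableType d) (P : probability T R)
    (Omega : 'I_N -> T -> {set 'I_n * 'I_n})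
    (Lt : {ffun 'I_N -> {set 'I_n * 'I_n}} -> 'M[R]_(dof D K)),
  (forall i, uniform_sample P (m i) (Omega i)) ->
  reconstruction rows cols L Lt ->
  let large i :=
    C * Num.max (mu1 i ^+ 2)
          (Num.max (Num.sqrt (mu0 i) * mu1 i) (mu0 i * n%:R `^ (4^-1)))
      * beta i * (r i)%:R * (n%:R * ln n%:R) <= (m i)%:R in
  let small_rank_large i :=
    (r i)%:R <= n%:R `^ (5^-1) / mu0 i /\
    C * mu0 i * beta i * (r i)%:R * (n%:R `^ (6 / 5) * ln n%:R) <= (m i)%:R in
  let recovered :=
    ((1 - c * \sum_(i < N) n%:R `^ (- beta i))%:E
       <= P [set w | L = Lt [ffun i => Omega i w]])%E in
  ((forall i, large i) -> recovered) /\
  ((forall i, large i \/ small_rank_large i) -> recovered)].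
Proof.
have [C HC] : exists C : R, 384 * 16 * (4 * 120) <= C by eexists.
exists C, 720; split.
- apply: lt_le_trans HC; exact: mulr_gt0 (mulr_gt0 (ltr0Sn _ _) (ltr0Sn _ _))
    (mulr_gt0 (ltr0Sn _ _) (ltr0Sn _ _)).
- exact: ltr0Sn.
move=> D K h sigma p piece aval _ _ _ _ _ _ _ _ L N n rows cols r m mu0 mu1 beta.
move=> n_gt0 part rk mu0_gt0 dec mu1_gt0 deloc beta2 d T P Omega Lt uOmega rec.
move=> large small recovered.
suff rec_or : (forall i, large i \/ small i) -> recovered.
  by split => // hl; apply: rec_or => i; left.
move=> big_enough.
pose bad i w := ~~ `[< unique_minimizer (block rows cols L i) (Omega i w) >].
have mbad i : measurable [set w | bad i w].
  have mO S : measurable [set w | Omega i w = S] by case: (uOmega i S).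
  exact: (measurable_pred mO (fun S => ~~ `[< unique_minimizer (block rows cols L i) S >])).
have Pbad i : (P [set w | bad i w] <= (720 * n%:R `^ (- beta i))%:E)%E.
  rewrite (uniform_sample_pred (uOmega i)
    (fun S => ~~ `[< unique_minimizer (block rows cols L i) S >])) lee_fin.
  have mn := uniform_sample_size (uOmega i).
  case: (big_enough i) => [lrg|[rle lrg]].
    by apply: (block_recovery_delocalized HC n_gt0 (dec i) (mu0_gt0 i) (deloc i)) => //; rewrite rk.
  by apply: (block_recovery_small_rank HC n_gt0 (dec i) (mu0_gt0 i)); rewrite ?rk.
have [mhas Phas] := probability_has_le (enum 'I_N) mbad Pbad.
have mOmega f : measurable [set w | [ffun i => Omega i w] = f].
  have -> : [set w | [ffun i => Omega i w] = f] = \bigcap_(i in setT) [set w | Omega i w = f i].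
    apply/seteqP; split=> [w <- i _|w fw]; first by rewrite /= ffunE.
    by apply/ffunP => i; rewrite ffunE; exact: fw.
  by apply: fin_bigcap_measurable => [|i _]; [exact: finite_finset|case: (uOmega i (f i))].
have mrec : measurable [set w | L = Lt [ffun i => Omega i w]].
  have := measurable_pred mOmega (fun f => `[< L = Lt f >]).
  rewrite (_ : [set w | _] = [set w | L = Lt [ffun i => Omega i w]])//.
  by apply/seteqP; split=> w /= /asboolP.
have sub : ~` [set w | has (bad^~ w) (enum 'I_N)] `<=` [set w | L = Lt [ffun i => Omega i w]].
  move=> w /= /negP; rewrite -all_predC => /allP good.
  (* The true block is feasible for its own problem, so the reconstructed block, a minimizer, has no
     larger nuclear norm; uniqueness identifies the two. *)
  have blk i : block rows cols (Lt [ffun i => Omega i w]) i = block rows cols L i.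
    have /= := good i (mem_enum _ i); rewrite negbK => /asboolP um.
    have [agree le] := rec [ffun i => Omega i w] i.
    by rewrite ffunE in agree le; apply: um => //; apply: le.
  case: part => g gK Kg; apply/matrixP => a b.
  have := Kg (a, b); case: (g (a, b)) => i [x y] /= [<- <-].
  by have /matrixP/(_ x y) := blk i; rewrite !mxE.
rewrite /recovered; apply: (@le_trans _ _ (P (~` [set w | has (bad^~ w) (enum 'I_N)]))).
  rewrite probability_setC// EFinB; apply: leeB => //.
  by rewrite mulr_sumr; move: Phas; rewrite big_enum.
by apply: le_measure; rewrite ?inE//; exact: measurableC.
Qed.
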